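(* Let $\phi:\mathbb{R}^n\to\mathbb{R}\cup\{+\infty\}$ be a super-linear convex function with $\int_{\mathbb{R}^n} e^{-\phi}>0$. For $t>0$ consider the convex function $\phi_t=-\log P_t(e^{-\phi})$, where $P_t$ is the Heat semi-group, and let $\psi_t=(\phi_t)^*$ be its Legendre transform. Then for every $z\in\mathbb{R}^n$ and every $t>0$, $$\partial_t\psi_t(z)=|z|^2-\mathrm{Tr}\big((D^2\psi_t(z))^{-1}\big).$$
   Context: $\mathbb{R}^n$ carries its standard Euclidean inner product $x\cdot y$ and norm $|\cdot|$. A convex function $\phi:\mathbb{R}^n\to\mathbb{R}\cup\{+\infty\}$ is called super-linear if $\phi(x)/|x|\to+\infty$ as $|x|\to\infty$; equivalently (for $\phi$ not identically $+\infty$), its Legendre transform takes only finite values on $\mathbb{R}^n$. The Legendre transform of $\phi$ is $\phi^*(z)=\sup_{x\in\mathbb{R}^n}\{x\cdot z-\phi(x)\}$, $z\in\mathbb{R}^n$. The Heat semi-group is defined, for a Borel function $u:\mathbb{R}^n\to[0,\infty)$ and $t>0$, by $$P_tu(x)=\int_{\mathbb{R}^n}u(y)\,e^{-|x-y|^2/(4t)}\,\frac{dy}{(4\pi t)^{n/2}},\qquad x\in\mathbb{R}^n,$$ so that $\partial_t P_tu=\Delta P_tu$ when $u\in L^1(\mathbb{R}^n)$. The convention $e^{-\infty}=0$ is used. $D^2\psi_t(z)$ denotes the Hessian matrix of $\psi_t$ in the space variable, at the point $z$, and $\mathrm{Tr}$ is the trace. *)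

(* Defs.v *)
From HB Require Import structures.
From mathcomp Require Import all_boot all_order all_algebra.
From mathcomp Require Import all_classical all_reals all_analysis.

Set Implicit Arguments.
Unset Strict Implicit.
Unset Printing Implicit Defensive.

Import Order.TTheory GRing.Theory Num.Theory.
Import numFieldNormedType.Exports.

Local Open Scope classical_set_scope.
Local Open Scope ring_scope.

Section lebesgue_measure_Rn.
Context {R : realType}.
Local Notation RB := (measurableTypeR R).

Definition tuple_cons n (x : RB * n.-tuple RB) : n.+1.-tuple RB :=
  [tuple of x.1 :: x.2].

Lemma measurable_tuple_cons n : measurable_fun setT (@tuple_cons n).
Proof. exact: measurable_cons. Qed.

Section lebesgue_tupleS.
Variables (n : nat) (mu : {measure set (n.-tuple RB) -> \bar R}).

Definition lebesgue_tupleS : set (n.+1.-tuple RB) -> \bar R :=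
  pushforward (lebesgue_measure \x^ mu)%E (@tuple_cons n).

Let mcons := @measurable_tuple_cons n.

Let lebesgue_tupleS0 : lebesgue_tupleS set0 = 0%E.
Proof. exact: measure0. Qed.

Let lebesgue_tupleS_ge0 A : (0 <= lebesgue_tupleS A)%E.
Proof. exact: measure_ge0. Qed.

Let lebesgue_tupleS_additive : semi_sigma_additive lebesgue_tupleS.
Proof. exact: measure_semi_sigma_additive. Qed.

HB.instance Definition _ := isMeasure.Build _ _ _ lebesgue_tupleS
  lebesgue_tupleS0 lebesgue_tupleS_ge0 lebesgue_tupleS_additive.

End lebesgue_tupleS.

(* The n-fold product of the Lebesgue measure of the line, on the product
   sigma-algebra of n.-tuple R (the Borel sigma-algebra of R^n); for n = 0 it
   is the unit mass on the one-point space. See lebesgue_tuple_box. *)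
Fixpoint lebesgue_tuple n : {measure set (n.-tuple RB) -> \bar R} :=
  match n with
  | 0%N => dirac [tuple]
  | m.+1 => lebesgue_tupleS (lebesgue_tuple m)
  end.

Lemma lebesgue_tuple_box n (A : 'I_n -> set RB) :
  (forall i, measurable (A i)) ->
  lebesgue_tuple n [set x | forall i, A i (tnth x i)] =
  (\prod_(i < n) lebesgue_measure (A i))%E.
Proof.
elim: n A => [|n ih] A mA.
  by rewrite big_ord0 /= diracE mem_set// => -[].
rewrite big_ord_recl /= /lebesgue_tupleS /pushforward -ih//.
rewrite (_ : _ @^-1` _ = A ord0 `*`
    [set x : n.-tuple RB | forall i, A (lift ord0 i) (tnth x i)]); last first.
  apply/seteqP; split=> [[x y] /= H|[x y] /= [Hx Hy] i].
    by split=> [|i]; [exact: (H ord0)|rewrite -(tnthS x y i); exact: H].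
  have [j ->|->] := unliftP ord0 i; last exact: Hx.
  by rewrite tnthS.
rewrite product_measure2E//.
rewrite (_ : mkset _ = \bigcap_(i in [set: 'I_n])
    ((fun x : n.-tuple RB => tnth x i) @^-1` A (lift ord0 i))); last first.
  by apply/seteqP; split=> x /= H i => [_|]; exact: H.
apply: fin_bigcap_measurable => // i _.
by rewrite -[X in measurable X]setTI; exact: measurable_tnth.
Qed.

Definition row_of_tuple n (x : n.-tuple R) : 'rV[R]_n := \row_i tnth x i.

Definition integral_Rn n (f : 'rV[R]_n -> \bar R) : \bar R :=
  (\int[lebesgue_tuple n]_x f (row_of_tuple x))%E.

End lebesgue_measure_Rn.

Section heat_legendre.
Context {R : realType} {n : nat}.
Implicit Types (x y z : 'rV[R]_n) (f u : 'rV[R]_n -> \bar R).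

(* The norm that the library puts on 'rV[R]_n is the sup norm, hence these
   Euclidean versions. *)
Definition edot x y : R := \sum_i x 0 i * y 0 i.

Definition enorm x : R := Num.sqrt (edot x x).

Definition econvex f := forall x y (l : R), 0 <= l <= 1 ->
  (f (l *: x + (1 - l) *: y)%R <= l%:E * f x + (1 - l)%:E * f y)%E.

Definition superlinear f := forall A : R, exists r : R,
  forall x, r <= enorm x -> (A%:E <= f x / (enorm x)%:E)%E.

Definition legendre f z : \bar R :=
  ereal_sup (range (fun x => ((edot x z)%:E - f x)%E)).

Definition heat_kernel (t : R) x y : R :=
  expR (- (enorm (x - y) ^+ 2 / (4 * t))) / (4 * pi * t) `^ (n%:R / 2).

(* The integral of a nonnegative function is the supremum of the integrals of
   the Borel simple functions below it: it is the usual one as soon as u is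
   Lebesgue measurable, which exp (- phi) is for every convex phi. *)
Definition heat (t : R) u x : \bar R :=
  integral_Rn (fun y => (u y * (heat_kernel t x y)%:E)%E).

Definition heat_log (phi : 'rV[R]_n -> \bar R) (t : R) x : \bar R :=
  (- lne (heat t (fun y => expeR (- phi y)) x))%E.

Definition heat_dual (phi : 'rV[R]_n -> \bar R) (t : R) : 'rV[R]_n -> \bar R :=
  legendre (heat_log phi t).

Definition gradient (g : 'rV[R]_n -> R) x : 'rV[R]_n :=
  \row_i 'D_(delta_mx 0 i) g x.

Definition twice_differentiable (g : 'rV[R]_n -> R) x : Prop :=
  (\forall y \near x, differentiable g y) /\ differentiable (gradient g) x.

Definition hessian (g : 'rV[R]_n -> R) x : 'M[R]_n :=
  \matrix_(i, j) 'D_(delta_mx 0 i) (fun y => 'D_(delta_mx 0 j) g y) x.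

End heat_legendre.

(* Main.v *)
(* Up to a maximal Borel minorant [f] of [exp (- phi)], the heat flow is a Gaussian integral:
   with [a = 1 / (4 t)] and [b = x / (2 t)], [phi_t x = b.b / 4 a - L a b + (n / 2) ln (4 pi t)]
   where [L] is the logarithm of [int f y exp (b.y - a |y|^2) dy]. Its differential is
   [(- E |y|^2, E y)] and its Hessian in [b] is the covariance [C] of the tilted measure, so a
   maximiser [b] of [x.z - phi_t x] solves [z = b - 2 a E y], and
   [(D^2 psi_t)^-1 = 2 a (1 - 2 a C)]; the derivative in [t] follows from the envelope theorem.
   That [1 - 2 a C] is positive definite is the strict form of the bound of a covariance by that
   of the Gaussian factor. By Prekopa-Leindler the marginals of the tilted measure convolved
   with a Gaussian are Gaussian times a positive log-concave function vanishing at infinity, and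
   such a density minus the Gaussian of the same mass and mean changes sign as -, +, -. *)

Require Import Defs.
From HB Require Import structures.
From mathcomp Require Import all_boot all_order all_algebra.
From mathcomp Require Import all_classical all_reals all_analysis.
From mathcomp Require Import measurable_realfun ring lra.

Set Implicit Arguments.
Unset Strict Implicit.
Unset Printing Implicit Defensive.

Import Order.TTheory GRing.Theory Num.Theory.
Import numFieldNormedType.Exports.

Local Open Scope classical_set_scope.
Local Open Scope ring_scope.

(** Lower semicontinuity of [phi] is not assumed, so [exp (- phi)] may fail to be Borel on the
    boundary of the domain. A measurable minorant inherits log-concavity only at almost every
    midpoint, which is why Brunn-Minkowski and Prekopa-Leindler are proved here with exceptional
    null sets. Super-linearity makes [f] decay faster than every exponential. Hence all exponential
    moments are finite, the dual objective is coercive, and the log-concave factor of a marginal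
    vanishes at infinity; this last point excludes an exponential [f], for which the covariance
    bound would be an equality. The pair (a, b) replaces (t, x) because the exponent b.y - a |y|^2
    is linear in it. Regularity is carried by first-order expansions with an explicit quadratic
    remainder. They are stable under the operations needed and, combined with a Lipschitz bound for
    the maximiser, they give the derivatives of the dual without an implicit function theorem. *)

(** * Lebesgue measure on tuples: sigma-finiteness and Tonelli in the first coordinate *)

Section lebesgue_power.
Context {R : realType}.
Local Notation RB := (measurableTypeR R).
Local Notation mu1 := (@lebesgue_measure R).

Let box (k n : nat) : set (n.-tuple RB) :=
  [set x | forall i, `[- k%:R, k%:R]%classic (tnth x i)].

Lemma measurable_box n (A : 'I_n -> set RB) :
  (forall i, measurable (A i)) ->
  measurable [set x : n.-tuple RB | forall i, A i (tnth x i)].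
Proof.
move=> mA; rewrite (_ : mkset _ = \bigcap_(i in [set: 'I_n])
    ((fun x : n.-tuple RB => tnth x i) @^-1` A i)); last first.
  by apply/seteqP; split=> x /= H i => [_|]; exact: H.
apply: fin_bigcap_measurable => // i _.
by rewrite -[X in measurable X]setTI; exact: measurable_tnth.
Qed.

Lemma lebesgue_tuple_sigma_finite n : sigma_finite setT (@lebesgue_tuple R n).
Proof.
exists (fun k => @box k n).
  apply/esym/seteqP; split => // x _.
  exists (Num.truncn (\sum_(i < n) `|tnth x i|)).+1 => //= i.
  rewrite /= in_itv/= -ler_norml.
  apply: (@le_trans _ _ (\sum_(i < n) `|tnth x i|)).
    by rewrite (bigD1 i)//= lerDl sumr_ge0.
  by apply/ltW; exact: truncnS_gt.
move=> k; split; first by apply: (@measurable_box n (fun=> `[- k%:R, k%:R]%classic)) => i;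
    exact: measurable_itv.
have := @lebesgue_tuple_box R n (fun=> `[- k%:R, k%:R]%classic)
  (fun=> measurable_itv _).
rewrite /box => ->.
have fin (i : 'I_n) : (lebesgue_measure `[- k%:R, k%:R]%classic : \bar R) \is a fin_num.
  by rewrite lebesgue_measure_itv/=; case: ifPn => _ //; rewrite fin_numE.
by rewrite ltey_eq; apply/orP; left; apply: prode_fin_num => i _; exact: fin.
Qed.

(** A named constant, whose head can key the sigma-finite instance that product measures and Tonelli
    look for. *)
Definition lebn (n : nat) := Measure.sort (@lebesgue_tuple R n).
Arguments lebn n : clear implicits.

HB.instance Definition _ n := Measure.copy (lebn n) (@lebesgue_tuple R n).

HB.instance Definition _ n :=
  Measure_isSigmaFinite.Build _ _ _ (lebn n) (@lebesgue_tuple_sigma_finite n).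

Lemma lebn0 (f : 0.-tuple RB -> \bar R) :
  measurable_fun [set: 0.-tuple RB] f ->
  (\int[lebn 0]_x f x = f [tuple])%E.
Proof. by move=> mf; rewrite [LHS]integral_dirac// diracT mul1e. Qed.

Lemma lebnS n (f : n.+1.-tuple RB -> \bar R) :
  measurable_fun [set: n.+1.-tuple RB] f -> (forall x, (0 <= f x)%E) ->
  (\int[lebn n.+1]_x f x = \int[mu1]_a \int[lebn n]_x f (tuple_cons (a, x)))%E.
Proof.
move=> mf f0.
transitivity (\int[pushforward (mu1 \x^ lebn n) (@tuple_cons R n)]_x f x)%E.
  by [].
rewrite ge0_integral_pushforward//=; last exact: measurable_tuple_cons.
rewrite preimage_setT.
have mfc : measurable_fun [set: RB * n.-tuple RB] (f \o @tuple_cons R n).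
  by apply: measurableT_comp => //; exact: measurable_tuple_cons.
rewrite -(fubini_tonelli1 (m1 := mu1) (m2 := lebn n) (f \o @tuple_cons R n))//; last first.
  by move=> x; exact: f0.
(* The recursive measure is built on [\x^] while [fubini_tonelli1] speaks of [\x]; the two agree by
   uniqueness of the product measure. *)
apply: eq_measure_integral => A mA _.
apply/esym/product_measure_unique => // A1 A2 mA1 mA2.
by rewrite /= product_measure2E.
Qed.
End lebesgue_power.
Arguments lebn {R} n : rename.

(** * Affine changes of variable on the line *)

Section affine.
Context {R : realType}.
Local Notation RB := (measurableTypeR R).
Local Notation mu1 := (@lebesgue_measure R).

Lemma measurable_affine (c d : R) : measurable_fun setT (fun x : RB => c * x + d : RB).
Proof. by apply: measurable_funD => //; exact: measurable_funM. Qed.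

(** The scaled image measure agrees with Lebesgue measure on half-open intervals, hence everywhere
    by uniqueness. *)
Lemma lebesgue_measure_affine (c d : R) (A : set RB) : 0 < c -> measurable A ->
  (c%:E * mu1 ((fun x => c * x + d)%R @^-1` A) = mu1 A)%E.
Proof.
move=> c0 mA.
have mphi := measurable_affine c d.
pose phi := (fun x : RB => c * x + d : RB).
pose m := mscale (NngNum (ltW c0))
  (measure_function_pushforward__canonical__measure_function_Measure mu1 mphi).
rewrite -[LHS]/(m A); apply/esym.
apply: lebesgue_measure_unique => //= _ [[a b]] _ <-.
rewrite /m /mscale /pushforward /=.
rewrite [X in _ = (_ * mu1 X)%E](_ : _ = `](a - d) / c, (b - d) / c]%classic); last first.
  apply/seteqP; split => x /=; rewrite !in_itv/=.
    by rewrite ltr_pdivrMr// ler_pdivlMr// ltrBlDr lerBrDr mulrC.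
  by rewrite ltr_pdivrMr// ler_pdivlMr// ltrBlDr lerBrDr mulrC.
rewrite !lebesgue_measure_itv/= !lte_fin.
rewrite ltr_pM2r ?invr_gt0// ltrD2r.
case: ifPn => ab; last by rewrite mule0.
rewrite -!EFinD -EFinM; congr EFin.
by field; rewrite gt_eqF.
Qed.

Lemma integral_affine (c d : R) (f : RB -> \bar R) : 0 < c ->
  measurable_fun setT f -> (forall x, (0 <= f x)%E) ->
  (\int[mu1]_x f x = c%:E * \int[mu1]_x f (c * x + d)%R)%E.
Proof.
move=> c0 mf f0.
have mphi := measurable_affine c d.
pose phi := (fun x : RB => c * x + d : RB).
transitivity (\int[mscale (NngNum (ltW c0))
  (measure_function_pushforward__canonical__measure_function_Measure mu1 mphi)]_x
    f x)%E.
  apply: eq_measure_integral => A mA _.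
  exact/esym/(lebesgue_measure_affine d c0 mA).
rewrite ge0_integral_mscale//=; congr (_ * _)%E.
by rewrite ge0_integral_pushforward.
Qed.

End affine.

(** * Null sets of a product measure and their sections *)

Section null_sections.
Context d1 d2 (T1 : measurableType d1) (expansion2 : measurableType d2) {R : realType}.
Variables (m1 : {sigma_finite_measure set T1 -> \bar R}).
Variables (m2 : {sigma_finite_measure set expansion2 -> \bar R}).

Lemma ge0_integral_eq0 d (T : measurableType d) (m : {measure set T -> \bar R})
    (f : T -> \bar R) : measurable_fun setT f -> (forall x, (0 <= f x)%E) ->
  (\int[m]_x f x = 0)%E -> \forall x \ae m, f x = 0%E.
Proof.
move=> mf f0 if0.
have : (\int[m]_x `|f x| = 0)%E.
  by rewrite -[RHS]if0; apply: eq_integral => x _; rewrite gee0_abs.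
by move/(ae_eq_integral_abs m measurableT mf); apply: filterS => x; exact.
Qed.

Lemma null_xsection (N : set (T1 * expansion2)) : measurable N -> (m1 \x m2)%E N = 0%E ->
  \forall x \ae m1, m2 (xsection N x) = 0%E.
Proof.
by move=> mN N0; apply: ge0_integral_eq0 => //; exact: measurable_fun_xsection.
Qed.

Lemma null_ysection (N : set (T1 * expansion2)) : measurable N -> (m1 \x m2)%E N = 0%E ->
  \forall y \ae m2, m1 (ysection N y) = 0%E.
Proof.
move=> mN N0; apply: ge0_integral_eq0 => //; first exact: measurable_fun_ysection.
rewrite -[RHS]N0; apply/esym.
apply: (product_measure_unique (m1 := m1) (m2 := m2) (m' := (m1 \x^ m2)%E)) => // *.
by rewrite /= product_measure2E.
Qed.

Lemma null_prod (N : set (T1 * expansion2)) : measurable N ->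
  (\forall x \ae m1, m2 (xsection N x) = 0%E) -> (m1 \x m2)%E N = 0%E.
Proof.
move=> mN N0; rewrite /product_measure1.
rewrite (_ : \int[m1]_x _ = \int[m1]_x (cst 0) x)%E; last first.
  apply: ae_eq_integral => //; first exact: measurable_fun_xsection.
  by apply: filterS N0 => x /= -> _.
by rewrite integral0.
Qed.

End null_sections.

(** * Brunn-Minkowski on the line, up to null sets *)

Section brunn_minkowski.
Context {R : realType}.
Local Notation RB := (measurableTypeR R).
Local Notation mu1 := (@lebesgue_measure R).

Lemma nonnull_ae_nonempty (A : set RB) (P : set RB) : (0 < mu1 A)%E -> measurable A ->
  (\forall x \ae mu1, P x) -> A `&` P !=set0.
Proof.
move=> A0 mA [N [mN N0 PN]]; apply/set0P/eqP => AP0.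
suff : (mu1 A <= mu1 N)%E by rewrite N0 leNgt A0.
apply: le_measure; rewrite ?inE// => x Ax; apply: PN => /= Px.
by have : (A `&` P) x by []; rewrite AP0.
Qed.

(** The supremum of [A] need be neither attained nor a good point, so [a] is a good point of [A]
    within [e] of the supremum of the good ones. What [A] has beyond [a] lies in an interval of
    length at most [e] or in the null set of bad points. *)
Lemma near_top (A P : set RB) (k e : R) : measurable A -> (0 < mu1 A)%E ->
  (forall x, A x -> x <= k) -> (\forall x \ae mu1, P x) -> 0 < e ->
  exists a : R, [/\ A a, P a & (mu1 A <= mu1 (A `&` `]-oo, a[) + e%:E)%E].
Proof.
move=> mA A0 Ak aeP e0.
have /nonnull_ae_nonempty := A0 => /(_ _ mA aeP) AP0.
have supAP : has_sup (A `&` P).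
  by split => //; exists k => x [/Ak].
have [a [Aa Pa] sa] := sup_adherent e0 supAP.
exists a; split => //.
have [N [mN N0 PN]] := aeP.
have sub : A `<=` (A `&` `]-oo, a[) `|` (`[a, sup (A `&` P)] `|` N).
  move=> x Ax; have [xa|ax] := ltP x a; first by left; split => //=; rewrite in_itv.
  right; have [Px|nPx] := pselect (P x); last by right; apply: PN.
  left; rewrite /= in_itv/= ax/=; apply: sup_upper_bound => //.
have mAa : measurable (A `&` `]-oo, a[) by exact: measurableI.
have mI : measurable (`[a, sup (A `&` P)] : set RB) by exact: measurable_itv.
apply: (@le_trans _ _ (mu1 ((A `&` `]-oo, a[) `|` (`[a, sup (A `&` P)] `|` N)))).
  apply: le_measure => //; rewrite inE//; apply: measurableU => //.
  exact: measurableU.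
apply: le_trans (measureU2 _ _ _) _ => //; first exact: measurableU.
rewrite -[leLHS]/(mu1 _ + mu1 _)%E; apply: leeD2l;
    rewrite measureU0// -[leLHS]/(mu1 _) lebesgue_measure_itv/=; case: ifPn => _;
        rewrite -?EFinB lee_fin//; lra.
Qed.

Lemma near_bot (A P : set RB) (k e : R) : measurable A -> (0 < mu1 A)%E ->
  (forall x, A x -> k <= x) -> (\forall x \ae mu1, P x) -> 0 < e ->
  exists a : R, [/\ A a, P a & (mu1 A <= mu1 (A `&` `]a, +oo[) + e%:E)%E].
Proof.
move=> mA A0 Ak aeP e0.
have /nonnull_ae_nonempty := A0 => /(_ _ mA aeP) AP0.
have infAP : has_inf (A `&` P).
  by split => //; exists k => x [/Ak].
have [a [Aa Pa] sa] := inf_adherent e0 infAP.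
exists a; split => //.
have [N [mN N0 PN]] := aeP.
have sub : A `<=` (A `&` `]a, +oo[) `|` (`[inf (A `&` P), a] `|` N).
  move=> x Ax; have [xa|ax] := ltP a x; first by left; split => //=; rewrite in_itv/= xa.
  right; have [Px|nPx] := pselect (P x); last by right; apply: PN.
  left; rewrite /= in_itv/= ax andbT; apply: ge_inf => //; exact: infAP.2.
have mAa : measurable (A `&` `]a, +oo[) by exact: measurableI.
have mI : measurable (`[inf (A `&` P), a] : set RB) by exact: measurable_itv.
apply: (@le_trans _ _ (mu1 ((A `&` `]a, +oo[) `|` (`[inf (A `&` P), a] `|` N)))).
  apply: le_measure => //; rewrite inE//; apply: measurableU => //.
  exact: measurableU.
apply: le_trans (measureU2 _ _ _) _ => //; first exact: measurableU.
rewrite -[leLHS]/(mu1 _ + mu1 _)%E; apply: leeD2l;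
    rewrite measureU0// -[leLHS]/(mu1 _) lebesgue_measure_itv/=; case: ifPn => _;
        rewrite -?EFinB lee_fin//; lra.
Qed.

(* Up to null sets, [2 C] contains [a + (B `&` `]b, +oo[)] and [b + (A `&` `]-oo, a[)],
   which are disjoint; [a] and [b] are taken near the top of [A] and the bottom of [B]. *)
Lemma brunn_minkowski_ae (A B C : set RB) (N : set (RB * RB)) (k : R) :
  measurable A -> measurable B -> measurable C -> measurable N ->
  (mu1 \x mu1)%E N = 0%E ->
  (0 < mu1 A)%E -> (0 < mu1 B)%E ->
  (forall x, A x -> x <= k) -> (forall y, B y -> - k <= y) ->
  (forall x y, A x -> B y -> ~ N (x, y) -> C ((x + y) / 2)) ->
  (mu1 A + mu1 B <= 2%:E * mu1 C)%E.
Proof.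
move=> mA mB mC mN N0 A0 B0 Ak Bk ABC.
apply/lee_addgt0Pr => e e0.
have e20 : 0 < e / 2 by rewrite divr_gt0.
have [a [Aa Na ha]] := near_top mA A0 Ak (null_xsection mN N0) e20.
have [b [Bb Nb hb]] := near_bot mB B0 Bk (null_ysection mN N0) e20.
pose A' := A `&` `]-oo, a[; pose B' := B `&` `]b, +oo[.
have mA' : measurable A' by exact: measurableI.
have mB' : measurable B' by exact: measurableI.
have two0 : (0 : R) < 2 by [].
(* [shift c S] is the set of all [(c + s) / 2] with [s] in [S], and has half the measure of [S]. *)
pose shift c (S : set RB) := (fun z : RB => 2 * z + - c) @^-1` S.
have mshift c S : measurable S -> measurable (shift c S).
  move=> mS; rewrite -[X in measurable X]setTI.
  by apply: (measurable_affine 2 (- c)) => //.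
have shiftE c S : measurable S -> (mu1 S = 2%:E * mu1 (shift c S))%E.
  by move=> mS; rewrite -(lebesgue_measure_affine (- c) two0 mS).
have mxN : measurable (xsection N a) by exact: measurable_xsection.
have myN : measurable (ysection N b) by exact: measurable_ysection.
have sub (z : R) : (shift a B' `|` shift b A') z ->
    (C `|` (shift a (xsection N a) `|` shift b (ysection N b))) z.
  move=> [] [/= h1 h2].
  - have [nz|nz] := pselect (N (a, 2 * z + - a)).
      by right; left; rewrite /shift/= /xsection/= inE.
    left; rewrite (_ : z = (a + (2 * z + - a)) / 2); first exact: ABC.
    by field.
  - have [nz|nz] := pselect (N (2 * z + - b, b)).
      by right; right; rewrite /shift/= /ysection/= inE.
    left; rewrite (_ : z = ((2 * z + - b) + b) / 2); first exact: ABC.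
    by field.
have N1 : mu1 (shift a (xsection N a)) = 0%E.
  have := shiftE a _ mxN; rewrite Na => /esym/eqP.
  by rewrite mule_eq0 eqe pnatr_eq0 /= => /eqP.
have N2 : mu1 (shift b (ysection N b)) = 0%E.
  have := shiftE b _ myN; rewrite Nb => /esym/eqP.
  by rewrite mule_eq0 eqe pnatr_eq0 /= => /eqP.
have hC : (mu1 (shift a B') + mu1 (shift b A') <= mu1 C)%E.
  rewrite -measureU; [|exact: mshift|exact: mshift|]; last first.
    (* The first set lies above [(a + b) / 2] and the second below it. *)
    rewrite -subset0 => z [[_ /=]]; rewrite in_itv/= andbT => h1 [_ /=].
    rewrite in_itv/= => h2.
    have lt_absurd (u v w : R) : v < 2 * w + - u -> 2 * w + - v < u -> False by lra.
    exact: lt_absurd h1 h2.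
  rewrite -[leRHS](@measureU0 _ _ _ mu1 C (shift a (xsection N a) `|` shift b (ysection N
      b)))//.
  - apply: le_measure; rewrite ?inE//.
    + by apply: measurableU; exact: mshift.
    + by apply: measurableU => //; apply: measurableU; exact: mshift.
  - by apply: measurableU; exact: mshift.
  - by rewrite measureU0//; [exact: mshift|exact: mshift].
apply: (@le_trans _ _ (mu1 A' + (e / 2)%:E + (mu1 B' + (e / 2)%:E))%E).
  exact: leeD.
rewrite addeACA -EFinD -splitr leeD2r//.
rewrite (shiftE b _ mA') (shiftE a _ mB') -ge0_muleDr// addeC.
by rewrite lee_wpmul2l.
Qed.
End brunn_minkowski.

(** * The layer cake formula *)

Section layer_cake.
Context {R : realType}.
Local Notation RB := (measurableTypeR R).
Local Notation mu1 := (@lebesgue_measure R).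

(** The clause [0 < r] empties the levels at nonpositive heights, so that the layer cake integral
    can run over the whole line. *)
Definition level (f : RB -> \bar R) (r : R) : set RB :=
  [set x | 0 < r /\ (r%:E < f x)%E].

Let undergraph (f : RB -> \bar R) : set (RB * RB) :=
  [set z | 0 < z.2 /\ (z.2%:E < f z.1)%E].

Let measurable_undergraph f : measurable_fun setT f -> measurable (undergraph f).
Proof.
move=> mf; rewrite (_ : undergraph f =
  (setT `*` `]0, +oo[%classic) `&` [set z | ((EFin \o snd) z < (f \o fst) z)%E]).
  rewrite -[_ `*` _](setTI); rewrite -setIA; apply: measurableI => //.
  rewrite setIC -[X in X `&` _]setTI; apply: measurableI.
    apply: measurable_lte => //.
      by apply: (measurableT_comp (f:=@EFin R)) => //; exact: measurable_snd.
    by apply: measurableT_comp => //; exact: measurable_fst.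
  by apply: measurableX => //; exact: measurable_itv.
by apply/seteqP; split => -[x r]/=; rewrite in_itv/= andbT; [move=> [? ?]|move=> [[? ?] ?]].
Qed.

Lemma measurable_level f r : measurable_fun setT f -> measurable (level f r).
Proof.
by move=> mf; have := measurable_ysection r (measurable_undergraph mf);
  congr (measurable _); apply/seteqP; split => x; rewrite /ysection/= inE.
Qed.

Let levelE f r : level f r = ysection (undergraph f) r.
Proof. by apply/seteqP; split => x; rewrite /ysection/= inE. Qed.

Lemma measurable_level_measure f : measurable_fun setT f ->
  measurable_fun setT (fun r : RB => mu1 (level f r)).
Proof.
move=> mf; rewrite (_ : (fun r => _) = mu1 \o ysection (undergraph f)).
  by apply: measurable_fun_ysection; exact: measurable_undergraph.
by apply/funext => r; rewrite levelE.
Qed.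

(** Both sides are the area of the undergraph, sliced vertically and horizontally. *)
Lemma layer_cake f : measurable_fun setT f -> (forall x, (0 <= f x)%E) ->
  (\int[mu1]_x f x = \int[mu1]_r mu1 (level f r))%E.
Proof.
move=> mf f0; have mU := measurable_undergraph mf.
have := indic_fubini_tonelli mu1 mu1 mU.
rewrite indic_fubini_tonelli_FE// indic_fubini_tonelli_GE// => e.
transitivity (\int[mu1]_x (mu1 \o xsection (undergraph f)) x)%E.
  apply: eq_integral => x _ /=.
  rewrite (_ : xsection _ _ = [set r | 0 < r /\ (r%:E < f x)%E]); last first.
    by apply/seteqP; split => r; rewrite /xsection/= inE.
  case: (f x) (f0 x) => [a|_|//].
  - rewrite lee_fin => a0; rewrite (_ : [set _ | _] = `]0, a[%classic); last first.
      apply/seteqP; split => r/=; rewrite in_itv/= lte_fin; first by move=> [-> ->].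
      by move=> /andP.
    rewrite lebesgue_measure_itv/= lte_fin.
    move: a0; rewrite le_eqVlt => /predU1P[<-|->]; first by rewrite ltxx.
    by rewrite oppr0 adde0.
  - rewrite (_ : [set _ | _] = `]0, +oo[%classic); first by rewrite lebesgue_measure_itv/= ltry.
    apply/seteqP; split => r/=; rewrite in_itv/= andbT; first by case.
    by move=> ->; rewrite ltry.
by rewrite e; apply: eq_integral => r _; rewrite levelE.
Qed.

End layer_cake.

(** * Prekopa-Leindler on the line *)

Section prekopa_leindler_line.
Context {R : realType}.
Local Notation RB := (measurableTypeR R).
Local Notation mu1 := (@lebesgue_measure R).

Let subset_level (f : RB -> \bar R) (a b : R) : 0 < a -> a <= b ->
  level f b `<=` level f a.
Proof.
move=> a0 ab x [b0 bf]; split => //; apply: le_lt_trans bf; by rewrite lee_fin.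
Qed.

Let le_level (f : RB -> \bar R) (a b : R) : measurable_fun setT f -> 0 < a -> a <= b ->
  (mu1 (level f b) <= mu1 (level f a))%E.
Proof.
by move=> mf a0 ab; apply: le_measure; rewrite ?inE; [exact: measurable_level..|
  exact: subset_level].
Qed.

(** [M] is the essential supremum of [f], read through its level sets. Brunn-Minkowski needs both
    level sets to be nonnull, so the two functions have to be rescaled until their essential suprema
    coincide. *)
Lemma ess_top (f : RB -> \bar R) (k : R) : measurable_fun setT f ->
  (forall x, (0 <= f x)%E) -> (forall x, (f x <= k%:E)%E) ->
  (0 < \int[mu1]_x f x)%E ->
  exists M, [/\ 0 < M,
    (forall a, 0 < a -> a < M -> (0 < mu1 (level f a))%E) &
    (forall a, M < a -> mu1 (level f a) = 0%E)].
Proof.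
move=> mf f0 fk if0.
pose E := [set a : R | 0 < a /\ (0 < mu1 (level f a))%E].
have E0 : E !=set0.
  apply/set0P/eqP => E0; move: if0; rewrite (layer_cake mf f0).
  rewrite (eq_integral (cst 0%E)); first by rewrite integral0 ltxx.
  move=> r _ /=; apply/eqP; rewrite -measure_le0 leNgt; apply/negP => h.
  have : E r.
    split => //; rewrite ltNge; apply/negP => r0; move: h.
    rewrite (_ : level f r = set0) ?measure0 ?ltxx// -subset0 => x [].
    by rewrite ltNge r0.
  by rewrite E0.
have supE : has_sup E.
  split => //; exists k => a [a0 la]; rewrite leNgt; apply/negP => ka.
  move: la; rewrite (_ : level f a = set0) ?measure0 ?ltxx// -subset0 => x [_].
  by apply/negP; rewrite -leNgt (le_trans (fk x))// lee_fin ltW.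
exists (sup E); split.
- by have [a Ea] := E0; apply: lt_le_trans (sup_upper_bound supE Ea); case: Ea.
- move=> a a0 aM; have /(sup_adherent (eps := sup E - a)) : 0 < sup E - a by rewrite subr_gt0.
  move=> /(_ _ supE)[b [b0 Eb]]; rewrite opprB addrC subrK => /ltW ab.
  exact: lt_le_trans Eb (le_level mf a0 ab).
- move=> a Ma; apply/eqP; rewrite -measure_le0 leNgt; apply/negP => h.
  have Ea : E a.
    split => //; apply: lt_trans Ma.
    by have [b Eb] := E0; apply: lt_le_trans (sup_upper_bound supE Eb); case: Eb.
  by move: Ma; apply/negP; rewrite -leNgt; exact: sup_upper_bound.
Qed.

(** With both essential suprema equal to 1, the level sets of [f] and [g] are both nonnull below
    height 1 and both null above it, so Brunn-Minkowski applies height by height; the height 1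
    itself is negligible. The sum inequality implies the product one by the arithmetic-geometric
    mean. *)
Let pl_normalised (f g h : RB -> \bar R) (N : set (RB * RB)) (k : R) :
  measurable_fun setT f -> measurable_fun setT g -> measurable_fun setT h ->
  (forall x, (0 <= f x)%E) -> (forall x, (0 <= g x)%E) -> (forall x, (0 <= h x)%E) ->
  (forall x, (0 < f x)%E -> x <= k) -> (forall x, (0 < g x)%E -> - k <= x) ->
  (forall a, 0 < a -> a < 1 -> (0 < mu1 (level f a))%E) ->
  (forall a, 0 < a -> a < 1 -> (0 < mu1 (level g a))%E) ->
  (forall a, 1 < a -> mu1 (level f a) = 0%E) ->
  (forall a, 1 < a -> mu1 (level g a) = 0%E) ->
  measurable N -> (mu1 \x mu1)%E N = 0%E ->
  (forall x y, ~ N (x, y) ->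
    (f x * g y <= h ((x + y) / 2)%R * h ((x + y) / 2)%R)%E) ->
  (\int[mu1]_x f x + \int[mu1]_x g x <= 2%:E * \int[mu1]_x h x)%E.
Proof.
move=> mf mg mh f0 g0 h0 fk gk lf lg lf0 lg0 mN N0 fgh.
rewrite (layer_cake mf f0) (layer_cake mg g0) (layer_cake mh h0) -ge0_integralD//;
    [|exact: measurable_level_measure..].
rewrite -ge0_integralZl_EFin//; last exact: measurable_level_measure.
apply: ae_ge0_le_integral => //.
- by move=> x _; exact: adde_ge0.
- by apply: emeasurable_funD; exact: measurable_level_measure.
- by move=> x _; rewrite mule_ge0.
- by apply: measurable_funeM; exact: measurable_level_measure.
exists [set 1]; split => //; first exact: lebesgue_measure_set1.
move=> r /=; rewrite not_implyE => -[_ hr]; apply: contrapT => r1; apply: hr.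
have [r0|r0] := leP r 0.
  have E f' : level f' r = set0.
    by rewrite -subset0 => x [] /(le_lt_trans r0); rewrite ltxx.
  by rewrite !E !measure0 adde0 mule0.
have [r1'|r1'] := leP 1 r.
  have {}r1' : 1 < r by rewrite lt_neqAle r1' andbT; apply/eqP => e; apply: r1.
  by rewrite lf0// lg0// adde0 mule_ge0.
apply: (@brunn_minkowski_ae _ _ _ _ N k) => //; try exact: measurable_level.
- exact: lf.
- exact: lg.
- by move=> x [_ rf]; apply: fk; apply: lt_trans rf; rewrite lte_fin.
- by move=> x [_ rf]; apply: gk; apply: lt_trans rf; rewrite lte_fin.
- move=> x y [_ rf] [_ rg] /fgh fgh'; split => //.
  rewrite ltNge; apply/negP => hr.
  have : ((r * r)%:E < f x * g y)%E.
    rewrite EFinM; apply: lte_pmul => //; rewrite lee_fin; exact: ltW.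
  apply/negP; rewrite -leNgt; apply: (le_trans fgh').
  by rewrite EFinM; apply: lee_pmul.
Qed.

Let sqr_le (a b c : \bar R) : (0 <= a)%E -> (0 <= b)%E -> (0 <= c)%E ->
  (a + b <= 2%:E * c)%E -> (a * b <= c * c)%E.
Proof.
move: c => [c| |//]; last by move=> *; rewrite mulyy leey.
move: a b => [a| |] [b| |]//.
rewrite !lee_fin => a0 b0 c0 h.
have : (a + b) * (a + b) <= (2 * c) * (2 * c) by apply: ler_pM => //; rewrite addr_ge0.
by have := sqr_ge0 (a - b); nra.
Qed.

Let pl_bounded (f g h : RB -> \bar R) (N : set (RB * RB)) (k : R) :
  measurable_fun setT f -> measurable_fun setT g -> measurable_fun setT h ->
  (forall x, (0 <= f x)%E) -> (forall x, (0 <= g x)%E) -> (forall x, (0 <= h x)%E) ->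
  (forall x, (0 < f x)%E -> x <= k) -> (forall x, (0 < g x)%E -> - k <= x) ->
  (forall x, (f x <= k%:E)%E) -> (forall x, (g x <= k%:E)%E) ->
  measurable N -> (mu1 \x mu1)%E N = 0%E ->
  (forall x y, ~ N (x, y) ->
    (f x * g y <= h ((x + y) / 2)%R * h ((x + y) / 2)%R)%E) ->
  (\int[mu1]_x f x * \int[mu1]_x g x <= \int[mu1]_x h x * \int[mu1]_x h x)%E.
Proof.
move=> mf mg mh f0 g0 h0 fk gk fb gb mN N0 fgh.
have h0' : (0 <= \int[mu1]_x h x)%E by exact: integral_ge0.
have [if0|] := leP (\int[mu1]_x f x)%E 0%E.
  rewrite (_ : \int[mu1]_x f x = 0)%E ?mul0e ?mule_ge0//.
  by apply/eqP; rewrite eq_le if0 integral_ge0.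
move=> /(ess_top mf f0 fb)[M [M0 lf lf0]].
have [ig0|] := leP (\int[mu1]_x g x)%E 0%E.
  rewrite (_ : \int[mu1]_x g x = 0)%E ?mule0 ?mule_ge0//.
  by apply/eqP; rewrite eq_le ig0 integral_ge0.
move=> /(ess_top mg g0 gb)[L [L0 lg lg0]].
(* Dividing [h] by the geometric mean of the two suprema preserves the hypothesis on products. *)
pose s := Num.sqrt (M * L).
have s0 : 0 < s by rewrite sqrtr_gt0 mulr_gt0.
have ss : s * s = M * L by rewrite -expr2 sqr_sqrtr// mulr_ge0// ltW.
have scale (c : R) (q : RB -> \bar R) : 0 < c -> measurable_fun setT q ->
    (forall x, (0 <= q x)%E) ->
    (\int[mu1]_x q x = c%:E * \int[mu1]_x (c^-1%:E * q x))%E.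
  move=> c0 mq q0; rewrite ge0_integralZl_EFin//; last by rewrite invr_ge0 ltW.
  by rewrite muleA -EFinM divff ?gt_eqF// mul1e.
have levelZ (c : R) (q : RB -> \bar R) a : 0 < c -> 0 < a ->
    level (fun x => (c^-1)%:E * q x)%E a = level q (c * a).
  move=> c0 a0; apply/seteqP; split => x [_ h1]; split; rewrite ?mulr_gt0//.
    by move: h1; rewrite muleC lte_pdivlMr// -EFinM mulrC.
  by rewrite muleC lte_pdivlMr// -EFinM mulrC.
rewrite (scale M f)// (scale L g)// (scale s h)//.
rewrite [X in (X <= _)%E]muleACA [X in (_ <= X)%E]muleACA -!EFinM ss.
apply: lee_wpmul2l; first by rewrite lee_fin mulr_ge0// ltW.
have pos (c : R) (q : RB -> \bar R) : 0 < c -> (forall x, (0 <= q x)%E) ->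
  forall x, (0 <= c^-1%:E * q x)%E.
  by move=> c0 q0 x; rewrite mule_ge0// lee_fin invr_ge0 ltW.
apply: sqr_le; [apply: integral_ge0 => x _; exact: pos..|].
apply: (@pl_normalised _ _ _ N k) => //; try exact: measurable_funeM; try exact: pos.
- move=> x; rewrite pmule_rgt0 ?lte_fin ?invr_gt0//; exact: fk.
- move=> x; rewrite pmule_rgt0 ?lte_fin ?invr_gt0//; exact: gk.
- move=> a a0 a1; rewrite levelZ// lf ?mulr_gt0//.
  by rewrite -[ltRHS]mulr1 ltr_pM2l.
- move=> a a0 a1; rewrite levelZ// lg ?mulr_gt0//.
  by rewrite -[ltRHS]mulr1 ltr_pM2l.
- move=> a a1; rewrite levelZ ?(lt_trans _ a1)// lf0//.
  by rewrite -[ltLHS]mulr1 ltr_pM2l.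
- move=> a a1; rewrite levelZ ?(lt_trans _ a1)// lg0//.
  by rewrite -[ltLHS]mulr1 ltr_pM2l.
- move=> x y /fgh fgh'; rewrite [X in (X <= _)%E]muleACA [X in (_ <= X)%E]muleACA -!EFinM.
  rewrite -!invfM ss; apply: lee_wpmul2l => //.
  by rewrite lee_fin invr_ge0 mulr_ge0// ltW.
Qed.

(** Cut in height, for a finite essential supremum, and in space, for the one-sided bounds of
    [brunn_minkowski_ae]. Monotone convergence removes both cuts; [h] is left as it is. *)
Let trunc (f : RB -> \bar R) (k : nat) (x : RB) : \bar R :=
  (mine (f x) k%:R%:E * (\1_`[- k%:R, k%:R]%classic x)%:E)%E.

Let measurable_trunc f k : measurable_fun setT f -> measurable_fun setT (trunc f k).
Proof.
move=> mf; apply: emeasurable_funM; first exact: measurable_mine.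
by apply/measurable_EFinP; exact: measurable_indic.
Qed.

Let trunc_ge0 f k : (forall x, (0 <= f x)%E) -> forall x, (0 <= trunc f k x)%E.
Proof. by move=> f0 x; apply: mule_ge0; [rewrite le_min f0/= lee_fin|rewrite lee_fin]. Qed.

Let trunc_le f k : (forall x, (0 <= f x)%E) -> forall x, (trunc f k x <= f x)%E.
Proof.
move=> f0 x; rewrite /trunc indicE; case: (_ \in _).
  by rewrite mule1 ge_min lexx.
by rewrite mule0.
Qed.

Let trunc_homo f x : (forall x, (0 <= f x)%E) ->
  {homo (trunc f)^~ x : n m / (n <= m)%N >-> (n <= m)%E}.
Proof.
move=> f0 n m nm; have nm' : n%:R <= m%:R :> R by rewrite ler_nat.
apply: lee_pmul.
- by rewrite le_min f0/= lee_fin.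
- by rewrite lee_fin.
- by rewrite le_min ge_min lexx/= ge_min lee_fin nm' orbT.
rewrite lee_fin !indicE; case: (boolP (x \in _)) => //; rewrite inE/= in_itv/= => /andP[h1 h2].
by rewrite mem_set//= in_itv/= (le_trans h2)// (le_trans _ h1)// lerN2.
Qed.

Let trunc_cvg f x : (forall x, (0 <= f x)%E) -> trunc f n x @[n --> \oo] --> f x.
Proof.
move=> f0.
have ind : \forall n \near \oo, \1_`[- n%:R, n%:R]%classic x = 1 :> R.
  near=> n; rewrite indicE mem_set//= in_itv/= -ler_norml.
  near: n; exact: nbhs_infty_ger.
move: (f0 x); case E : (f x) => [a| |//] a0.
- apply: cvg_near_cst; near=> n.
  rewrite /trunc E (near ind n)// mule1; apply/min_idPl; rewrite lee_fin.
  near: n; exact: nbhs_infty_ger.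
- apply/cvgeyPge => A; near=> n.
  rewrite /trunc E (near ind n)// mule1 le_min leey lee_fin/=.
  near: n; exact: nbhs_infty_ger.
Unshelve. all: end_near. Qed.

Let trunc_integral f : measurable_fun setT f -> (forall x, (0 <= f x)%E) ->
  (\int[mu1]_x trunc f n x)%E @[n --> \oo] --> (\int[mu1]_x f x)%E.
Proof.
move=> mf f0.
rewrite [X in _ --> X](_ : _ = \int[mu1]_x (limn (trunc f ^~ x)))%E; last first.
  by apply: eq_integral => x _; apply/esym/cvg_lim => //; exact: trunc_cvg.
apply: cvg_monotone_convergence => //.
- by move=> n; exact: measurable_trunc.
- by move=> n x _; exact: trunc_ge0.
- by move=> x _; exact: trunc_homo.
Qed.

Lemma prekopa_leindler_line (f g h : RB -> \bar R) (N : set (RB * RB)) :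
  measurable_fun setT f -> measurable_fun setT g -> measurable_fun setT h ->
  (forall x, (0 <= f x)%E) -> (forall x, (0 <= g x)%E) -> (forall x, (0 <= h x)%E) ->
  measurable N -> (mu1 \x mu1)%E N = 0%E ->
  (forall x y, ~ N (x, y) ->
    (f x * g y <= h ((x + y) / 2)%R * h ((x + y) / 2)%R)%E) ->
  (\int[mu1]_x f x * \int[mu1]_x g x <= \int[mu1]_x h x * \int[mu1]_x h x)%E.
Proof.
move=> mf mg mh f0 g0 h0 mN N0 fgh.
have h0' : (0 <= \int[mu1]_x h x)%E by exact: integral_ge0.
have [if0|if0] := leP (\int[mu1]_x f x)%E 0%E.
  rewrite (_ : \int[mu1]_x f x = 0)%E ?mul0e ?mule_ge0//.
  by apply/eqP; rewrite eq_le if0 integral_ge0.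
have [ig0|ig0] := leP (\int[mu1]_x g x)%E 0%E.
  rewrite (_ : \int[mu1]_x g x = 0)%E ?mule0 ?mule_ge0//.
  by apply/eqP; rewrite eq_le ig0 integral_ge0.
(* Both integrals are positive by now, which rules out a product of 0 and infinity, where
   multiplication is not continuous. *)
have cv : (\int[mu1]_x trunc f n x * \int[mu1]_x trunc g n x)%E @[n --> \oo] -->
    (\int[mu1]_x f x * \int[mu1]_x g x)%E.
  apply: cvgeM; [|exact: trunc_integral..].
  move: if0 ig0; case: (\int[mu1]_x f x)%E => [a| |]; case: (\int[mu1]_x g x)%E => [b| |]//=.
    by rewrite lte_fin => /gt_eqF ->.
  by move=> _; rewrite lte_fin => /gt_eqF ->.
rewrite -(cvg_lim _ cv)//; apply: lime_le; first by apply/cvg_ex; eexists; exact: cv.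
near=> n.
have tr (q : RB -> \bar R) (x : RB) : (0 < trunc q n x)%E -> - n%:R <= x <= n%:R.
  rewrite /trunc indicE; case: (boolP (x \in _)); last by rewrite mule0 ltxx.
  by rewrite inE/= in_itv.
have trb (q : RB -> \bar R) (x : RB) : (trunc q n x <= n%:R%:E)%E.
  rewrite /trunc indicE; case: (x \in _); last by rewrite mule0 lee_fin.
  by rewrite mule1 ge_min lexx orbT.
apply: (@pl_bounded _ _ _ N n%:R) => //.
- exact: measurable_trunc.
- exact: measurable_trunc.
- exact: trunc_ge0.
- exact: trunc_ge0.
- by move=> x /tr/andP[].
- by move=> x /tr/andP[].
- move=> x y /fgh; apply: le_trans; apply: lee_pmul; try exact: trunc_ge0; exact: trunc_le.
Unshelve. all: end_near. Qed.

End prekopa_leindler_line.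

(** * Prekopa-Leindler in dimension n *)

Section prekopa_leindler.
Context {R : realType}.
Local Notation RB := (measurableTypeR R).
Local Notation mu1 := (@lebesgue_measure R).
Local Notation lebn := (@lebn R).

Definition midpoint n (x y : n.-tuple RB) : n.-tuple RB :=
  [tuple (2^-1 * tnth x i + tnth y i / 2 : R) | i < n].

Definition reflection n (x z : n.-tuple RB) : n.-tuple RB :=
  [tuple (2 * tnth z i - tnth x i : R) | i < n].

Lemma midpoint_cons n a b (x y : n.-tuple RB) :
  midpoint (tuple_cons (a, x)) (tuple_cons (b, y)) =
  tuple_cons (((a : R) + b) / 2, midpoint x y).
Proof.
apply: eq_from_tnth => i; rewrite tnth_mktuple.
have [j ->|->] := unliftP ord0 i; last first.
  by rewrite !(tnth_nth 0)/= mulrDl mulrC.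
rewrite /tuple_cons/= (tnthS (T := RB)) (tnthS (T := RB)) (tnthS (T := RB)).
by rewrite tnth_mktuple.
Qed.

Lemma reflection_midpoint n (x y : n.-tuple RB) : reflection x (midpoint x y) = y.
Proof.
by apply: eq_from_tnth => i; rewrite !tnth_mktuple; field.
Qed.

Lemma measurable_midpoint n :
  measurable_fun [set: n.-tuple RB * n.-tuple RB] (fun z => midpoint z.1 z.2).
Proof.
apply/measurable_fun_tnthP => i.
rewrite (_ : _ \o _ = (fun z => 2^-1 * tnth z.1 i + tnth z.2 i / 2 : RB)); last first.
  by apply/funext => z; rewrite /= tnth_mktuple.
apply: measurable_funD; apply: measurable_funM => //.
  by apply: (measurableT_comp (measurable_tnth i)); exact: measurable_fst.
by apply: (measurableT_comp (measurable_tnth i)); exact: measurable_snd.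
Qed.

Lemma measurable_midpointr n (x : n.-tuple RB) : measurable_fun setT (midpoint x).
Proof.
exact: (measurableT_comp (@measurable_midpoint n) (pair1_measurable x)).
Qed.

Lemma measurable_reflection n (x : n.-tuple RB) : measurable_fun setT (reflection x).
Proof.
apply/measurable_fun_tnthP => i.
rewrite (_ : _ \o _ = (fun z => 2 * tnth z i - tnth x i : RB)); last first.
  by apply/funext => z; rewrite /= tnth_mktuple.
apply: measurable_funB => //; apply: measurable_funM => //; exact: measurable_tnth.
Qed.

Lemma measurable_tuple_consr n (a : RB) :
  measurable_fun setT (fun x : n.-tuple RB => tuple_cons (a, x)).
Proof.
exact: (measurableT_comp (@measurable_tuple_cons R n) (pair1_measurable a)).
Qed.

(** Change of variable for the homothety of ratio 1/2 centred at [x], one coordinate at a time. It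
    shows that such maps pull null sets back to null sets. *)
Lemma integral_midpoint n (x : n.-tuple RB) (f : n.-tuple RB -> \bar R) :
  measurable_fun setT f -> (forall y, (0 <= f y)%E) ->
  (\int[lebn n]_y f y = (2^-1 ^+ n)%:E * \int[lebn n]_y f (midpoint x y))%E.
Proof.
elim: n x f => [|n ih] x f mf f0.
  rewrite expr0 mul1e !lebn0//; first by congr f; apply: eq_from_tnth => -[].
  by apply: measurableT_comp => //; exact: measurable_midpointr.
case/tupleP: x => a x.
have mfm : measurable_fun setT (f \o midpoint [tuple of a :: x]).
  by apply: measurableT_comp => //; exact: measurable_midpointr.
have mfc : measurable_fun [set: RB * n.-tuple RB] (f \o @tuple_cons R n).
  by apply: measurableT_comp => //; exact: measurable_tuple_cons.
rewrite lebnS// lebnS//.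
under eq_integral => b _.
  rewrite (ih x); [|by apply: measurableT_comp => //; exact: measurable_tuple_consr|by []].
  over.
have mF : measurable_fun setT
    (fun b : RB => \int[lebn n]_y f (tuple_cons (b, midpoint x y)))%E.
  apply: (measurable_fun_fubini_tonelli_F (m2 := lebn n)
    (fun z : RB * n.-tuple RB => f (tuple_cons (z.1, midpoint x z.2)))) => //.
  apply: (measurableT_comp mfc).
  apply/measurable_fun_pair => /=; first exact: measurable_fst.
  by apply: (measurableT_comp (@measurable_midpointr n x)); exact: measurable_snd.
have c0 : (0 : R) <= 2^-1 ^+ n by rewrite exprn_ge0// invr_ge0.
rewrite ge0_integralZl_EFin//; last by move=> b _; exact: integral_ge0.
rewrite [in LHS](@integral_affine _ 2^-1 (a / 2))//; last by move=> b; exact: integral_ge0.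
rewrite muleA -EFinM -exprSr; congr (_ * _)%E.
apply: eq_integral => b _; apply: eq_integral => y _; rewrite midpoint_cons.
by congr (f (tuple_cons (_, _))); rewrite [RHS]mulrDl [2^-1 * _]mulrC addrC.
Qed.

Lemma integral_indicT d (T : measurableType d) (m : {measure set T -> \bar R})
  (A : set T) : measurable A -> (\int[m]_x (\1_A x)%:E = m A)%E.
Proof. by move=> mA; rewrite integral_indic// setIT. Qed.

Lemma integral_indicT_prod d1 d2 (T1 : measurableType d1) (expansion2 : measurableType d2)
  (m1 : {sigma_finite_measure set T1 -> \bar R})
  (m2 : {sigma_finite_measure set expansion2 -> \bar R})
  (A : set (T1 * expansion2)) : measurable A -> (\int[m1 \x m2]_x (\1_A x)%:E = (m1 \x m2) A)%E.
Proof. by move=> mA; rewrite integral_indic// setIT. Qed.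

Lemma null_midpoint n (x : n.-tuple RB) (N : set (n.-tuple RB)) :
  measurable N -> lebn n N = 0%E -> lebn n (midpoint x @^-1` N) = 0%E.
Proof.
move=> mN N0.
have mN' : measurable (midpoint x @^-1` N).
  by rewrite -[X in measurable X]setTI; apply: measurable_midpointr.
have m1N : measurable_fun setT (EFin \o (\1_N : _ -> R)).
  by apply/measurable_EFinP; exact: measurable_indic.
have ind0 y : (0 <= (EFin \o (\1_N : _ -> R)) y)%E by rewrite lee_fin.
have /esym/eqP := integral_midpoint x m1N ind0.
have := integral_indicT (lebn n) mN'; rewrite /= => ->.
have := integral_indicT (lebn n) mN; rewrite /= => ->.
rewrite N0 mule_eq0 => /orP[|/eqP//].
by rewrite eqe expf_eq0 invr_eq0 pnatr_eq0 andbF.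
Qed.

(** Tonelli on the four variables head of x, tail of x, head of y, tail of y, with the two middle
    ones exchanged: for almost every pair of heads, the exceptional set of pairs of tails is null.
    This feeds the induction on the dimension. *)
Let null_rearrange n (N : set (n.+1.-tuple RB * n.+1.-tuple RB)) :
  measurable N -> (lebn n.+1 \x lebn n.+1)%E N = 0%E ->
  \forall z \ae (mu1 \x mu1)%E, (lebn n \x lebn n)%E
    [set w | N (tuple_cons (z.1, w.1), tuple_cons (z.2, w.2))] = 0%E.
Proof.
move=> mN N0.
pose Phi (p : (RB * RB) * (n.-tuple RB * n.-tuple RB)) :=
  (tuple_cons (p.1.1, p.2.1), tuple_cons (p.1.2, p.2.2)).
have mPhi : measurable_fun setT Phi.
  apply/measurable_fun_pair => /=;
    (apply: (measurableT_comp (@measurable_tuple_cons R n)); apply/measurable_fun_pair => /=).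
  - exact: measurableT_comp measurable_fst measurable_fst.
  - exact: measurableT_comp measurable_fst measurable_snd.
  - exact: measurableT_comp measurable_snd measurable_fst.
  - exact: measurableT_comp measurable_snd measurable_snd.
pose F p : \bar R := (\1_N (Phi p))%:E.
have m1N : measurable_fun setT (EFin \o (\1_N : _ -> R)).
  by apply/measurable_EFinP; exact: measurable_indic.
have ind0 p : (0 <= (EFin \o (\1_N : _ -> R)) p)%E by rewrite lee_fin.
have mF : measurable_fun setT F by exact: (measurableT_comp m1N mPhi).
have F0 p : (0 <= F p)%E by rewrite lee_fin.
have mK : measurable_fun setT (fun z : (RB * RB) * n.-tuple RB =>
    \int[lebn n]_y F (z.1, (z.2, y)))%E.
  apply: (measurable_fun_fubini_tonelli_F (m2 := lebn n) (fun w => F (w.1.1, (w.1.2,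
      w.2)))) => //.
  apply: (measurableT_comp mF); apply/measurable_fun_pair => /=.
    exact: measurableT_comp measurable_fst measurable_fst.
  apply/measurable_fun_pair => /=; last exact: measurable_snd.
  exact: measurableT_comp measurable_snd measurable_fst.
pose k (z : RB * RB) : \bar R := (\int[lebn n]_x \int[lebn n]_y F (z, (x, y)))%E.
have mk : measurable_fun setT k.
  apply: (measurable_fun_fubini_tonelli_F (m2 := lebn n) _ mK) => z.
  exact: integral_ge0.
have k0 z : (0 <= k z)%E by do 2 (apply: integral_ge0 => ? _).
have ik : (\int[mu1 \x mu1]_z k z = 0)%E.
  rewrite (fubini_tonelli1 k)//.
  have := integral_indicT_prod (lebn n.+1) (lebn n.+1) mN.
  rewrite /= N0 => <-.
  rewrite (fubini_tonelli1 (EFin \o \1_N))//.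
  rewrite lebnS; last 2 first.
  - exact: measurable_fun_fubini_tonelli_F.
  - by move=> z; apply: integral_ge0 => w _; exact: ind0.
  apply: eq_integral => a _.
  pose G (z : n.-tuple RB * RB) : \bar R :=
    (\int[lebn n]_y F ((a, z.2), (z.1, y)))%E.
  have mFa : measurable_fun setT (fun p : (n.-tuple RB * RB) * n.-tuple RB =>
      F ((a, p.1.2), (p.1.1, p.2))).
    apply: (measurableT_comp mF); apply/measurable_fun_pair => /=.
      apply/measurable_fun_pair => //=.
      exact: measurableT_comp measurable_snd measurable_fst.
    apply/measurable_fun_pair => /=; last exact: measurable_snd.
    exact: measurableT_comp measurable_fst measurable_fst.
  have mG : measurable_fun setT G.
    by apply: (measurable_fun_fubini_tonelli_F (m2 := lebn n) _ mFa) => z.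
  transitivity (\int[mu1]_b \int[lebn n]_x G (x, b))%E; first by [].
  rewrite -(fubini_tonelli (m1 := lebn n) (m2 := mu1) G)//; last first.
    by move=> z; exact: integral_ge0.
  apply: eq_integral => x _; rewrite /fubini_F lebnS//.
  exact: (measurableT_comp m1N (pair1_measurable (tuple_cons (a, x)))).
have := ge0_integral_eq0 mk k0 ik; apply: filterS => z kz.
have mS : measurable [set w : n.-tuple RB * n.-tuple RB |
    N (tuple_cons (z.1, w.1), tuple_cons (z.2, w.2))].
  by have := measurableT_comp mPhi (pair1_measurable z) measurableT mN; rewrite setTI.
have := integral_indicT_prod (lebn n) (lebn n) mS; rewrite /= => <-.
rewrite -kz -[RHS](fubini_tonelli1 (m1 := lebn n) (m2 := lebn n) (fun w => F (z, w)))//.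
exact: (measurableT_comp mF (pair1_measurable z)).
Qed.

(** Off the null set of heads given by [null_rearrange], the induction hypothesis on the tails is
    exactly the one-dimensional assumption for the partial integrals. *)
Lemma prekopa_leindler n (f g h : n.-tuple RB -> \bar R) N :
  measurable_fun setT f -> measurable_fun setT g -> measurable_fun setT h ->
  (forall x, (0 <= f x)%E) -> (forall x, (0 <= g x)%E) -> (forall x, (0 <= h x)%E) ->
  measurable N -> (lebn n \x lebn n)%E N = 0%E ->
  (forall x y, ~ N (x, y) -> (f x * g y <= h (midpoint x y) * h (midpoint x y))%E) ->
  (\int[lebn n]_x f x * \int[lebn n]_x g x <= \int[lebn n]_x h x * \int[lebn n]_x h x)%E.
Proof.
elim: n f g h N => [|n ih] f g h N mf mg mh f0 g0 h0 mN N0 fgh.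
  rewrite !lebn0//.
  (* The one-point space has mass 1, so a null exceptional set misses its only point. *)
  have := null_xsection mN N0 => -[M [mM M0 NM]].
  have nM : ~ M [tuple] by move=> M1; move: M0; rewrite [LHS]diracE mem_set// => /eqP;
      rewrite onee_eq0.
  have /contrapT : ~ ~ (lebn 0 (xsection N [tuple]) = 0%E) by move=> h1; apply: nM; exact: NM.
  move=> e; have := fgh [tuple] [tuple]; rewrite (_ : midpoint _ _ = [tuple]); last first.
    by apply: eq_from_tnth => -[].
  apply => N1; move: e; rewrite [LHS]diracE mem_set ?/xsection/= ?inE// => /eqP.
  by rewrite onee_eq0.
have mc (q : n.+1.-tuple RB -> \bar R) : measurable_fun setT q ->
    measurable_fun setT (fun z : RB * n.-tuple RB => q (tuple_cons z)).
  by move=> mq; apply: (measurableT_comp mq); exact: measurable_tuple_cons.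
have mI (q : n.+1.-tuple RB -> \bar R) : measurable_fun setT q -> (forall x, (0 <= q x)%E) ->
    measurable_fun setT (fun a : RB => \int[lebn n]_x q (tuple_cons (a, x)))%E.
  by move=> mq q0; apply: (measurable_fun_fubini_tonelli_F (m2 := lebn n) _ (mc q mq)).
rewrite !lebnS//.
have [M [mM M0 NM]] := null_rearrange mN N0.
apply: (@prekopa_leindler_line _ _ _ _ M) => //; try exact: mI;
  try by move=> a; exact: integral_ge0.
move=> a b Mab.
have /contrapT : ~ ~ ((lebn n \x lebn n)%E
    [set w | N (tuple_cons (a, w.1), tuple_cons (b, w.2))] = 0%E).
  by move=> h1; apply: Mab; exact: NM.
move=> e; apply: (ih _ _ _ [set w | N (tuple_cons (a, w.1), tuple_cons (b, w.2))]) => //.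
- by apply: (measurableT_comp mf); exact: measurable_tuple_consr.
- by apply: (measurableT_comp mg); exact: measurable_tuple_consr.
- by apply: (measurableT_comp mh); exact: measurable_tuple_consr.
- have : measurable_fun setT (fun w : n.-tuple RB * n.-tuple RB =>
    (tuple_cons (a, w.1), tuple_cons (b, w.2))).
    apply/measurable_fun_pair => /=.
      by apply: (measurableT_comp (@measurable_tuple_consr n a)); exact: measurable_fst.
    by apply: (measurableT_comp (@measurable_tuple_consr n b)); exact: measurable_snd.
  by move=> /(_ measurableT N mN); rewrite setTI.
- by move=> x y Nxy; rewrite -midpoint_cons; exact: fgh.
Qed.

(** This is the form in which log-concavity of a minorant is available: for every [x] and almost
    every midpoint [z]. Pulling back by [midpoint x] turns it into a statement on almost every
    pair. *)
Lemma prekopa_leindler_ae n (f g h : n.-tuple RB -> \bar R) :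
  measurable_fun setT f -> measurable_fun setT g -> measurable_fun setT h ->
  (forall x, (0 <= f x)%E) -> (forall x, (0 <= g x)%E) -> (forall x, (0 <= h x)%E) ->
  (forall x, \forall z \ae lebn n, (f x * g (reflection x z) <= h z * h z)%E) ->
  (\int[lebn n]_x f x * \int[lebn n]_x g x <= \int[lebn n]_x h x * \int[lebn n]_x h x)%E.
Proof.
move=> mf mg mh f0 g0 h0 fgh.
pose N := [set w : n.-tuple RB * n.-tuple RB |
  (h (midpoint w.1 w.2) * h (midpoint w.1 w.2) < f w.1 * g w.2)%E].
have mN : measurable N.
  rewrite -[N]setTI; apply: measurable_lte => //.
    by apply: emeasurable_funM; apply: (measurableT_comp mh); exact: measurable_midpoint.
  apply: emeasurable_funM.
    by apply: (measurableT_comp mf); exact: measurable_fst.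
  by apply: (measurableT_comp mg); exact: measurable_snd.
apply: (@prekopa_leindler _ _ _ _ N) => //; last first.
  by move=> x y /negP; rewrite -leNgt.
apply: null_prod => //; apply: aeW => x.
have [M [mM M0 NM]] := fgh x.
apply/eqP; rewrite -measure_le0 -(null_midpoint x mM M0).
apply: le_measure; rewrite ?inE.
- exact: measurable_xsection.
- by rewrite -[X in measurable X]setTI; apply: measurable_midpointr.
- move=> y; rewrite /xsection/= inE/N/= => h1; apply: NM => /=.
  by rewrite reflection_midpoint; apply/negP; rewrite -ltNge.
Qed.

End prekopa_leindler.

(** * A convex set containing a Borel set of positive measure contains a cube *)

Section convex_ball.
Context {R : realType}.
Local Notation RB := (measurableTypeR R).
Local Notation mu1 := (@lebesgue_measure R).
Local Notation lebn := (@lebn R).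

Definition row_cons n (a : R) (x : 'rV[R]_n) : 'rV[R]_n.+1 :=
  \row_i (if unlift ord0 i is Some j then x 0 j else a).

Lemma row_cons0 n a (x : 'rV[R]_n) : row_cons a x 0 ord0 = a.
Proof. by rewrite mxE unlift_none. Qed.

Lemma row_consS n a (x : 'rV[R]_n) j : row_cons a x 0 (lift ord0 j) = x 0 j.
Proof. by rewrite mxE liftK. Qed.

Lemma row_of_tuple_cons n (a : R) (x : n.-tuple RB) :
  row_of_tuple (tuple_cons (a, x)) = row_cons a (row_of_tuple x).
Proof.
apply/rowP => i; have [j ->|->] := unliftP ord0 i.
  by rewrite row_consS !mxE /tuple_cons/= (tnthS (T := RB)).
by rewrite row_cons0 mxE.
Qed.

Lemma row_cons_conv n (l a b : R) (x y : 'rV[R]_n) :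
  l *: row_cons a x + (1 - l) *: row_cons b y =
  row_cons (l * a + (1 - l) * b) (l *: x + (1 - l) *: y).
Proof.
apply/rowP => i; have [j ->|->] := unliftP ord0 i.
  by rewrite !mxE liftK !mxE.
by rewrite !mxE unlift_none.
Qed.

Definition convexS n (S : set 'rV[R]_n) := forall x y l, 0 <= l <= 1 -> S x -> S y ->
  S (l *: x + (1 - l) *: y).

Let two_points (f : RB -> \bar R) : measurable_fun setT f -> (forall x, (0 <= f x)%E) ->
  (0 < \int[mu1]_x f x)%E -> exists a b : R, [/\ a <> b, (0 < f a)%E & (0 < f b)%E].
Proof.
move=> mf f0 if0.
have [a fa] : exists a, (0 < f a)%E.
  apply/not_existsP => h; move: if0; rewrite integral0_eq ?ltxx// => x _.
  by apply/eqP; rewrite eq_le f0 andbT leNgt; apply/negP/h.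
have [b [ab fb]] : exists b, b <> a /\ (0 < f b)%E.
  apply/not_existsP => h; move: if0.
  suff -> : (\int[mu1]_x f x = \int[mu1]_x (cst 0) x)%E by rewrite integral0 ltxx.
  apply: ae_eq_integral => //; exists [set a].
  split => //; first exact: lebesgue_measure_set1.
  move=> x /=; rewrite not_implyE => -[_ hx]; apply: contrapT => xa; apply: hx.
  apply/eqP; rewrite eq_le f0 andbT leNgt; apply/negP => fx.
  exact: (h x).
by exists a, b; split => //; exact/nesym.
Qed.

(** By Tonelli two distinct slices of [A] have positive measure; by induction the corresponding
    slices of [S] contain cubes, and the convex hull of these contains a cube centred halfway
    between them. *)
Lemma convex_ball n (S : set 'rV[R]_n) (A : set (n.-tuple RB)) : convexS S ->
  measurable A -> (0 < lebn n A)%E -> (forall a, A a -> S (row_of_tuple a)) ->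
  exists (p : 'rV[R]_n) (r : R), 0 < r /\
    forall x : 'rV[R]_n, (forall i, `|x 0 i - p 0 i| <= r) -> S x.
Proof.
elim: n S A => [|n ih] S A cS mA A0 AS.
  have [a Aa] : A !=set0.
    by apply/set0P/eqP => AE; move: A0; rewrite AE measure0 ltxx.
  exists 0, 1; split => // x _.
  by rewrite (_ : x = row_of_tuple a); [exact: AS|apply/rowP => -[]].
have m1A : measurable_fun setT (EFin \o (\1_A : _ -> R)).
  by apply/measurable_EFinP; exact: measurable_indic.
have ind0 p : (0 <= (EFin \o (\1_A : _ -> R)) p)%E by rewrite lee_fin.
pose s (a : RB) := (fun x : n.-tuple RB => tuple_cons (a, x)) @^-1` A.
have ms a : measurable (s a).
  rewrite -[X in measurable X]setTI; exact: (@measurable_tuple_consr R n a).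
have sE a : (\int[lebn n]_x (EFin \o (\1_A : _ -> R)) (tuple_cons (a, x)) = lebn n (s a))%E.
  by have := integral_indicT (lebn n) (ms a).
have := integral_indicT (lebn n.+1) mA.
rewrite -[LHS]/(\int[lebn n.+1]_x (EFin \o (\1_A : _ -> R)) x)%E lebnS// => eA.
have [|||a [b [ab]]] := two_points
    (f := fun a => \int[lebn n]_x (EFin \o (\1_A : _ -> R)) (tuple_cons (a, x)))%E.
- apply: (measurable_fun_fubini_tonelli_F (m2 := lebn n)
    (fun z : RB * n.-tuple RB => (EFin \o (\1_A : _ -> R)) (tuple_cons z))) => //.
  by apply: (measurableT_comp m1A); exact: measurable_tuple_cons.
- by move=> a; exact: integral_ge0.
- by rewrite eA.
rewrite !sE => sa sb.
pose Sl a := [set x : 'rV[R]_n | S (row_cons a x)].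
have cSl c : convexS (Sl c).
  move=> x y l l01 Sx Sy; have := cS _ _ _ l01 Sx Sy; rewrite /Sl /=.
  by rewrite row_cons_conv -mulrDl addrC subrK mul1r.
have sS c x : s c x -> Sl c (row_of_tuple x).
  by move=> /AS; rewrite row_of_tuple_cons.
have [p [r [r0 pS]]] := ih (Sl a) (s a) (@cSl a) (ms a) sa (sS a).
have [q [r' [r'0 qS]]] := ih (Sl b) (s b) (@cSl b) (ms b) sb (sS b).
pose t := Num.min r r'; pose D := `|b - a|; pose K := \sum_i `|p 0 i - q 0 i|.
have t0 : 0 < t by rewrite lt_min r0 r'0.
have ba0 : b - a != 0 by rewrite subr_eq0; apply/eqP => e; exact: ab.
have D0 : 0 < D by rewrite normr_gt0.
have K0 : 0 <= K by exact: sumr_ge0.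
have KD0 : 0 < 1 + K / D by rewrite ltr_pwDl// divr_ge0// ltW.
(* [D / 2] keeps the weight [l] in [0, 1]; the other term pays for the drift of the interpolated
   centre when [l] leaves 1/2, so that the offset [e] stays within [t]. *)
pose rho := Num.min (D / 2) (t / (1 + K / D)).
exists (row_cons ((a + b) / 2) (2^-1 *: p + 2^-1 *: q)), rho; split.
  by rewrite lt_min !divr_gt0.
move=> x hx.
pose l := (b - x 0 ord0) / (b - a).
have xE : x 0 ord0 = l * a + (1 - l) * b.
  by rewrite /l; field.
pose x' : 'rV[R]_n := \row_j x 0 (lift ord0 j).
have -> : x = row_cons (l * a + (1 - l) * b) x'.
  apply/rowP => i; have [j ->|->] := unliftP ord0 i.
    by rewrite row_consS mxE.
  by rewrite row_cons0 -xE.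
(* [x'] is the combination, with weight [l], of the two points at the same offset [e] from [p] and
   from [q]. *)
pose e := x' - (l *: p + (1 - l) *: q).
have -> : x' = l *: (p + e) + (1 - l) *: (q + e).
  by apply/rowP => i; rewrite /e !mxE; ring.
have l2 : `|l - 2^-1| <= rho / D.
  have := hx ord0; rewrite row_cons0 => h0.
  rewrite ler_pdivlMr// /D -normrM.
  by rewrite (_ : _ * _ = - (x 0 ord0 - (a + b) / 2)) ?normrN//; rewrite /l; field.
have rD : rho <= D / 2 by rewrite ge_min lexx.
have l01 : 0 <= l <= 1.
  have : `|l - 2^-1| <= 2^-1.
    by apply: le_trans l2 _; rewrite ler_pdivrMr// mulrC.
  by rewrite ler_norml => /andP[h1 h2]; apply/andP; split; lra.
have eb i : `|e 0 i| <= t.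
  have := hx (lift ord0 i); rewrite row_consS !mxE => h1.
  rewrite (_ : _ + _ = (x 0 (lift ord0 i) - (2^-1 * p 0 i + 2^-1 * q 0 i)) -
    (l - 2^-1) * (p 0 i - q 0 i)); last by field.
  apply: le_trans (ler_normB _ _) _; rewrite normrM.
  apply: (@le_trans _ _ (rho + rho / D * K)).
    apply: lerD => //; apply: ler_pM => //.
    by rewrite /K (bigD1 i)//= lerDl sumr_ge0.
  rewrite (_ : _ + _ = rho * (1 + K / D)); last by field; rewrite gt_eqF.
  by rewrite -ler_pdivlMr// ge_min lexx orbT.
rewrite -row_cons_conv; apply: cS => //.
- apply: pS => i; rewrite mxE addrAC subrr add0r (le_trans (eb i))// ge_min lexx//.
- apply: qS => i; rewrite mxE addrAC subrr add0r (le_trans (eb i))// ge_min lexx orbT//.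
Qed.

End convex_ball.

(** * Lower bounds for [phi]: above every multiple of the l1 norm, up to a constant *)

Section convex_bounds.
Context {R : realType} {n : nat}.
Local Notation RB := (measurableTypeR R).
Local Notation lebn := (@lebn R).
Variable phi : 'rV[R]_n -> \bar R.
Hypothesis phi_gtNy : forall x, (-oo < phi x)%E.
Hypothesis phi_convex : econvex phi.
Hypothesis phi_superlinear : superlinear phi.
Hypothesis phi_mass : (0 < integral_Rn (fun x => expeR (- phi x)))%E.

(** The l1 norm, preferred to the Euclidean one because exponentials of it factor over the
    coordinates. *)
Definition ell (x : 'rV[R]_n) : R := \sum_i `|x 0 i|.

Lemma ell_ge0 x : 0 <= ell x. Proof. exact: sumr_ge0. Qed.

Lemma coord_le_ell (x : 'rV[R]_n) i : `|x 0 i| <= ell x.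
Proof. by rewrite /ell (bigD1 i)//= lerDl sumr_ge0. Qed.

Lemma coord_le_enorm (x : 'rV[R]_n) i : `|x 0 i| <= enorm x.
Proof.
rewrite -sqrtr_sqr /enorm ler_wsqrtr// /edot (bigD1 i)//= expr2 lerDl sumr_ge0// => j _.
by rewrite -expr2 sqr_ge0.
Qed.

Lemma ell_le_enorm (x : 'rV[R]_n) : ell x <= n%:R * enorm x.
Proof.
apply: (@le_trans _ _ (\sum_(i < n) enorm x)).
  by apply: ler_sum => i _; exact: coord_le_enorm.
by rewrite sumr_const card_ord mulr_natl.
Qed.

Import HBNNSimple.

(** A sublevel set of [phi] need not be Borel; the measurable set comes from a simple function below
    [exp (- phi)] with positive integral. *)
Lemma positive_sublevel : exists (c : R) (A : set (n.-tuple RB)),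
  [/\ measurable A, (0 < lebn n A)%E & forall a, A a -> (phi (row_of_tuple a) <= c%:E)%E].
Proof.
have u0 (y : n.-tuple RB) : (0 <= expeR (- phi (row_of_tuple y)))%E by exact: expeR_ge0.
move: phi_mass; rewrite /integral_Rn ge0_integralTE// => /ereal_sup_gt[_ [h /= hu <-]].
move=> sh.
have ih : (0 < \int[lebn n]_y (h y)%:E)%E by rewrite integralT_nnsfun.
pose A k := [set y | (k.+1%:R^-1 <= h y)].
have mA k : measurable (A k).
  rewrite (_ : A k = setT `&` [set y | (k.+1%:R^-1%:E <= (EFin \o h) y)%E]).
    by apply: measurable_lee => //; exact/measurable_EFinP.
  by rewrite setTI; apply/seteqP; split => y; rewrite /A/= lee_fin.
have [k Ak] : exists k, (0 < lebn n (A k))%E.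
  apply/not_existsP => hA; move: ih.
  suff -> : (\int[lebn n]_y (h y)%:E = \int[lebn n]_y (cst 0) y)%E by rewrite integral0 ltxx.
  apply: ae_eq_integral => //; first exact/measurable_EFinP.
  have nA : (lebn n).-negligible (\bigcup_k A k).
    apply: negligible_bigcup => k; apply/negligibleP => //.
    by apply/eqP; rewrite eq_le measure_ge0 andbT leNgt; exact/negP/hA.
  apply: negligibleS nA => y /=; rewrite not_implyE => -[_ hy].
  have hy0 : 0 < h y by rewrite lt_neqAle fun_ge0 andbT; apply/eqP => e; apply: hy; rewrite -e.
  have [k hk] : exists k, k.+1%:R^-1 < h y.
    exists (Num.truncn (h y)^-1).
    by rewrite invf_plt ?posrE// truncnS_gt.
  by exists k => //; exact: ltW.
exists (- ln k.+1%:R^-1), (A k); split => // y Aky.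
have := hu y; have := phi_gtNy (row_of_tuple y).
case: (phi _) => [v| |]//= _; last by rewrite lee_fin => /(le_trans Aky);
    rewrite leNgt invr_gt0 ltr0n.
rewrite !lee_fin lerNr => /(le_trans Aky) h1.
by rewrite -[leRHS]expRK ler_ln ?posrE ?invr_gt0 ?expR_gt0.
Qed.

(** [phi] is at most [c] on a cube around [p] and finite at [p]. Since [p] lies between [x] and a
    point [y] of that cube, a very negative value at [x] would make [phi p] too small. *)
Lemma phi_lower_cube (B : R) : exists m : R, forall x : 'rV[R]_n,
  (forall i, `|x 0 i| <= B) -> (m%:E <= phi x)%E.
Proof.
have [c [A [mA A0 Ac]]] := positive_sublevel.
have cS : convexS [set x | (phi x <= c%:E)%E].
  move=> x y l l01 /= hx hy; apply: le_trans (phi_convex x y l01) _.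
  move: l01 => /andP[l0 l1].
  apply: (@le_trans _ _ (l%:E * c%:E + (1 - l)%:E * c%:E)%E).
    by apply: leeD; apply: lee_wpmul2l => //; rewrite lee_fin// subr_ge0.
  by rewrite -!EFinM -EFinD lee_fin -mulrDl addrC subrK mul1r.
have [p [r [r0 pS]]] := convex_ball cS mA A0 Ac.
(* [D] dominates the coordinates of [p - x], and [p - l *: x] is rescaled so that [y - p] is [r / D]
   times [p - x]; hence [y] stays within [r] of [p]. *)
pose D := `|B| + ell p + 1.
have D0 : 0 < D by rewrite ltr_wpDl// addr_ge0// ell_ge0.
pose l := r / (r + D).
have rD0 : 0 < r + D by rewrite addr_gt0.
have l0 : 0 < l by rewrite divr_gt0.
have l1 : l < 1 by rewrite ltr_pdivrMr// mul1r ltrDl.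
have [v pv] : exists v, phi p = v%:E.
  have /= : (phi p <= c%:E)%E by apply: pS => i; rewrite subrr normr0 ltW.
  by have := phi_gtNy p; case: (phi p) => [v| |]//; exists v.
exists ((v - (1 - l) * c) / l) => x xB.
pose y := (1 - l)^-1 *: (p - l *: x).
have l1' : 1 - l != 0 by rewrite subr_eq0 gt_eqF.
have py : p = l *: x + (1 - l) *: y.
  by rewrite /y scalerA divff// scale1r addrC subrK.
have yc : (phi y <= c%:E)%E.
  apply: pS => i; rewrite /y !mxE.
  rewrite (_ : _ - _ = (l / (1 - l)) * (p 0 i - x 0 i)); last by field.
  rewrite normrM ger0_norm; last by rewrite divr_ge0 ?subr_ge0 ?ltW.
  have -> : l / (1 - l) = r / D.
    by rewrite /l; field; rewrite !gt_eqF//= addrC addrK gt_eqF.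
  rewrite mulrAC ler_pdivrMr// ler_pM2l//.
  apply: le_trans (ler_normB _ _) _.
  apply: (@le_trans _ _ (ell p + `|B|)).
    apply: lerD; first exact: coord_le_ell.
    by apply: le_trans (xB i) _; exact: ler_norm.
  by rewrite /D [`|B| + _]addrC lerDl.
have l01 : 0 <= l <= 1 by rewrite !ltW.
have := phi_convex x y l01; rewrite -py pv => h.
have := phi_gtNy x; move: h; case: (phi x) => [w| |]// h _; last by rewrite leey.
rewrite lee_fin ler_pdivrMr// lerBlDr [w * l]mulrC -lee_fin.
apply: le_trans h _; rewrite -[leRHS]/(l%:E * w%:E + (1 - l)%:E * c%:E)%E.
apply: leeD; first by [].
by apply: lee_wpmul2l => //; rewrite lee_fin subr_ge0 ltW.
Qed.

Lemma phi_lower_ell (A : R) : exists C : R, forall x, ((A * ell x - C)%:E <= phi x)%E.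
Proof.
have [r hr] := phi_superlinear (`|A| * n%:R).
(* The maximum with 1 keeps [enorm x] positive where the quotient in [superlinear] is cleared. *)
pose B := Num.max r 1.
have [m hm] := phi_lower_cube B.
exists (`| `|A| * (n%:R * B) - m |) => x.
have eA : A * ell x <= `|A| * (n%:R * enorm x).
  apply: (@le_trans _ _ (`|A| * ell x)).
    by apply: ler_wpM2r; [exact: ell_ge0|exact: ler_norm].
  by apply: ler_wpM2l => //; exact: ell_le_enorm.
have [xB|Bx] := leP B (enorm x).
  have e0 : 0 < enorm x by apply: lt_le_trans xB; rewrite lt_max ltr01 orbT.
  have := hr x (le_trans _ xB); rewrite le_max lexx => /(_ isT).
  rewrite inver gt_eqF// lee_pdivlMr// => h; apply: le_trans h.
  rewrite -EFinM lee_fin lerBlDr -[leLHS]addr0 lerD// -mulrA//.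
apply: le_trans (hm x _) => [|i]; last by rewrite (le_trans (coord_le_enorm _ _))// ltW.
rewrite lee_fin lerBlDr -lerBlDl; apply: le_trans (ler_norm _).
rewrite lerD2r; apply: le_trans eA _; rewrite ler_wpM2l// ler_wpM2l//.
exact: ltW.
Qed.

End convex_bounds.

(** * Integrability of the exponential of minus the l1 norm *)

Section exp_ell.
Context {R : realType}.
Local Notation RB := (measurableTypeR R).
Local Notation mu1 := (@lebesgue_measure R).
Local Notation lebn := (@lebn R).

Lemma ell_row_of_tuple n (y : n.-tuple RB) :
  ell (row_of_tuple y) = \sum_i `|tnth y i|.
Proof. by apply: eq_bigr => i _; rewrite mxE. Qed.

Lemma measurable_ell n : measurable_fun [set: n.-tuple RB] (fun y => ell (row_of_tuple y)).
Proof.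
rewrite (_ : (fun y => _) = (fun y => \sum_i `|tnth y i|)); last first.
  by apply/funext => y; rewrite ell_row_of_tuple.
apply: measurable_sum => i; apply: measurableT_comp => //; exact: measurable_tnth.
Qed.

Lemma ell_cons n a (x : n.-tuple RB) :
  ell (row_of_tuple (tuple_cons (a, x))) = `|a| + ell (row_of_tuple x).
Proof.
rewrite row_of_tuple_cons /ell big_ord_recl row_cons0; congr (_ + _).
by apply: eq_bigr => i _; rewrite row_consS.
Qed.

Lemma integral_exp_norm : (\int[mu1]_x (expR (- `|x|))%:E = 2%:E)%E.
Proof.
rewrite ge0_symfun_integralT; last 3 first.
- by move=> x; exact: expR_ge0.
- move=> x; apply: continuous_comp; last exact: continuous_expR.
  by apply: cvgN; exact: norm_continuous.
- by move=> x /=; rewrite normrN.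
rewrite -[RHS]mule1 -(integral_exponential_pdf (ltr01 : 0 < 1 :> R)); congr (_ * _)%E.
rewrite (_ : [set x | _] = `[0, +oo[%classic); last first.
  by apply/seteqP; split => x/=; rewrite in_itv/= andbT.
rewrite integral_mkcond; apply: eq_integral => x _.
rewrite /exponential_pdf !patchE; case: ifPn => //.
by rewrite inE/= in_itv/= andbT => x0; rewrite ger0_norm// mul1r mulN1r.
Qed.

Lemma measurable_exp_ell n (A : R) : measurable_fun [set: n.-tuple RB]
  (fun y => expR (A * ell (row_of_tuple y))).
Proof.
by apply: measurableT_comp => //; apply: measurable_funM => //; exact: measurable_ell.
Qed.

Lemma integral_exp_ell n :
  (\int[lebn n]_y (expR (- ell (row_of_tuple y)))%:E < +oo)%E.
Proof.
have m k : measurable_fun [set: k.-tuple RB] (fun y => (expR (- ell (row_of_tuple y)))%:E).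
  apply/measurable_EFinP.
  by have := @measurable_exp_ell k (-1); under eq_fun do rewrite mulN1r.
suff -> : (\int[lebn n]_y (expR (- ell (row_of_tuple y)))%:E = (2 ^+ n)%:E)%E by rewrite ltry.
elim: n => [|n ih]; first by rewrite lebn0// /ell big_ord0 oppr0 expR0.
rewrite lebnS//.
rewrite (eq_integral (fun a : RB => (expR (- `|a : R|))%:E * (2 ^+ n)%:E)%E).
  rewrite ge0_integralZr//.
  - by rewrite integral_exp_norm -EFinM exprS.
  - by apply/measurable_EFinP; apply: measurableT_comp => //; exact: measurableT_comp.
move=> a _; rewrite -ih -ge0_integralZl_EFin//.
  by apply: eq_integral => x _; rewrite ell_cons opprD expRD EFinM.
exact: m.
Qed.

End exp_ell.

(** * The largest measurable minorant of a nonnegative function *)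

Section measurable_minorant.
Context d (T : measurableType d) {R : realType} (m : {measure set T -> \bar R}).
Variable u : T -> \bar R.
Hypothesis u0 : forall x, (0 <= u x)%E.
Hypothesis uoo : forall x, (u x < +oo)%E.
Hypothesis iu : (\int[m]_x u x < +oo)%E.

Import HBNNSimple.

Lemma le_integral_minorant (g : T -> \bar R) : (forall x, (0 <= g x)%E) ->
  (forall x, (g x <= u x)%E) -> (\int[m]_x g x <= \int[m]_x u x)%E.
Proof.
move=> g0 gu; rewrite !ge0_integralTE//; apply: ereal_sup_le => _ [h /= hg <-].
exists h => // x; exact: le_trans (hg x) (gu x).
Qed.

(* The integral of [u] is a lower integral: [F] is a largest measurable minorant of [u]. *)
Lemma max_minorant : exists F : T -> \bar R,
  [/\ measurable_fun setT F, forall x, (0 <= F x)%E, forall x, (F x <= u x)%E &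
   forall g : T -> \bar R, measurable_fun setT g -> (forall x, (0 <= g x)%E) ->
     (forall x, (g x <= u x)%E) -> \forall x \ae m, (g x <= F x)%E].
Proof.
have uE : (\int[m]_x u x)%E \is a fin_num by rewrite ge0_fin_numE ?integral_ge0.
have ex k : exists h : {nnsfun T >-> R}, (forall x, ((h x)%:E <= u x)%E) /\
    (\int[m]_x u x - (k.+1%:R^-1)%:E < \int[m]_x (h x)%:E)%E.
  have k0 : 0 < k.+1%:R^-1 :> R by rewrite invr_gt0.
  move: uE; rewrite ge0_integralTE// => uE.
  have [_ [h hu <-] hh] := ub_ereal_sup_adherent k0 uE.
  by exists h; split => //; rewrite integralT_nnsfun.
have [h hP] := choice ex.
pose F x := esups (fun k => (h k x)%:E) 0.
have mF : measurable_fun setT F.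
  by apply: measurable_fun_esups => k; exact/measurable_EFinP.
have hF k x : ((h k x)%:E <= F x)%E.
  by apply: ereal_sup_ubound; exists k.
have F0 x : (0 <= F x)%E by apply: le_trans (hF 0%N x); rewrite lee_fin.
have Fu x : (F x <= u x)%E.
  by apply: ge_ereal_sup => _ [k _ <-]; exact: (hP k).1.
exists F; split => // g mg g0 gu.
have FE : (\int[m]_x F x = \int[m]_x u x)%E.
  apply/eqP; rewrite eq_le le_integral_minorant//=.
  apply/lee_addgt0Pr => e e0.
  have [k ke] : exists k, k.+1%:R^-1 < e.
    exists (Num.truncn e^-1); rewrite invf_plt ?posrE// truncnS_gt//.
  have := (hP k).2; rewrite lteBlDr// => /ltW/le_trans; apply; apply: leeD.
    by apply: ge0_le_integral => //; [move=> x _; rewrite lee_fin|exact/measurable_EFinP].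
  by rewrite lee_fin ltW.
(* [G] is again a minorant of [u], so its integral does not exceed that of [F], which already equals
   that of [u]; as [G] dominates [F], the two agree almost everywhere. *)
pose G x := maxe (g x) (F x).
have mG : measurable_fun setT G by exact: measurable_maxe.
have G0 x : (0 <= G x)%E by rewrite le_max F0 orbT.
have FG x : (F x <= G x)%E by rewrite le_max lexx orbT.
have iG : m.-integrable setT G.
  apply/integrableP; split => //.
  rewrite (eq_integral G); last by move=> x _; rewrite gee0_abs.
  by apply: le_lt_trans iu; apply: le_integral_minorant => // x; rewrite ge_max gu Fu.
have iF : m.-integrable setT F.
  apply/integrableP; split => //.
  by rewrite (eq_integral F); [rewrite FE|move=> x _; rewrite gee0_abs].
have GE : (\int[m]_x G x = \int[m]_x F x)%E.
  apply/eqP; rewrite eq_le; apply/andP; split.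
    by rewrite FE; apply: le_integral_minorant => // x; rewrite ge_max gu Fu.
  by apply: ge0_le_integral.
have GF : (\int[m]_x (G x - F x) = 0)%E.
  by rewrite -[LHS]/(\int[m]_x (G \- F) x)%E integralB// GE subee// FE.
have Ffin x : F x \is a fin_num by rewrite ge0_fin_numE//; exact: le_lt_trans (uoo x).
have aGF : \forall x \ae m, (G x - F x = 0)%E.
  apply: ge0_integral_eq0 => //; first exact: emeasurable_funB.
  by move=> x; rewrite sube_ge0 ?Ffin.
apply: filterS aGF => x GFx.
have : (G x - F x <= 0)%E by rewrite GFx.
by rewrite sube_le0 ?Ffin// => /(le_trans _); apply; rewrite le_max lexx.
Qed.

End measurable_minorant.

(** * A Borel, almost everywhere log-concave density in place of [exp (- phi)] *)

Section density.
Context {R : realType} {n : nat}.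
Local Notation RB := (measurableTypeR R).
Local Notation lebn := (@lebn R).
Variable phi : 'rV[R]_n -> \bar R.
Hypothesis phi_gtNy : forall x, (-oo < phi x)%E.
Hypothesis phi_convex : econvex phi.
Hypothesis phi_superlinear : superlinear phi.
Hypothesis phi_mass : (0 < integral_Rn (fun x => expeR (- phi x)))%E.

Import HBNNSimple.

Let u (y : n.-tuple RB) := expeR (- phi (row_of_tuple y)).

Let u0 y : (0 <= u y)%E. Proof. exact: expeR_ge0. Qed.

Let u_le (A : R) : exists C : R, forall y,
  (u y <= (C * expR (- (A * ell (row_of_tuple y))))%:E)%E.
Proof.
have [C hC] := phi_lower_ell phi_gtNy phi_convex phi_superlinear phi_mass A.
exists (expR C) => y; rewrite -expRD.
rewrite -[leRHS]/(expeR (C - A * ell (row_of_tuple y))%:E) lee_expeR.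
by rewrite leeNl; apply: le_trans (hC _); rewrite -EFinN opprB.
Qed.

Let iu : (\int[lebn n]_y u y < +oo)%E.
Proof.
have [C hC] := u_le 1.
have hv0 y := le_trans (u0 y) (hC y).
apply: le_lt_trans (@le_integral_minorant _ _ _ (lebn n) _ hv0 _ u0 hC) _.
have C0 : 0 <= C.
  have := le_trans (u0 [tuple 0 | i < n]) (hC _).
  by rewrite lee_fin pmulr_lge0// expR_gt0.
have m1 : measurable_fun [set: n.-tuple RB] (fun y => (expR (- ell (row_of_tuple y)))%:E).
  apply/measurable_EFinP.
  by have := @measurable_exp_ell R n (-1); under eq_fun do rewrite mulN1r.
suff -> : (\int[lebn n]_y (C * expR (- (1 * ell (row_of_tuple y))))%:E =
    C%:E * \int[lebn n]_y (expR (- ell (row_of_tuple y)))%:E)%E.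
  by rewrite lte_mul_pinfty// integral_exp_ell.
rewrite -ge0_integralZl_EFin//.
by apply: eq_integral => y _; rewrite mul1r EFinM.
Qed.

Let u_conv x z : (u x * u (reflection x z) <= u z * u z)%E.
Proof.
rewrite /u; have := phi_gtNy (row_of_tuple z).
have h2 : 0 <= (2^-1 : R) <= 1 by apply/andP; split; lra.
have := phi_convex (row_of_tuple x) (row_of_tuple (reflection x z)) h2.
have -> : 2^-1 *: row_of_tuple x + (1 - 2^-1) *: row_of_tuple (reflection x z) = row_of_tuple z.
  by apply/rowP => i; rewrite !mxE tnth_mktuple; field.
have := phi_gtNy (row_of_tuple x); have := phi_gtNy (row_of_tuple (reflection x z)).
case: (phi (row_of_tuple x)) => [a| |]// => [|_ _ _ _];
    last by rewrite mul0e mule_ge0 ?expeR_ge0.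
case: (phi (row_of_tuple (reflection x z))) => [b| |]// => [_ _|_ _ _ _]; last first.
  by rewrite mule0 mule_ge0 ?expeR_ge0.
rewrite -!EFinM -EFinD; case: (phi (row_of_tuple z)) => [c| |]//; rewrite lee_fin => h _.
rewrite -!EFinM lee_fin -!expRD ler_expR; lra.
Qed.

(* The last clause is log-concavity: [z] is the midpoint of [x] and [reflection x z]. *)
Lemma log_concave_density : exists f : n.-tuple RB -> R,
  [/\ measurable_fun setT f, forall y, 0 <= f y,
   forall A, exists C, forall y, f y <= C * expR (- (A * ell (row_of_tuple y))),
   forall K : n.-tuple RB -> R, measurable_fun setT K -> (forall y, 0 < K y) ->
     (\int[lebn n]_y (expeR (- phi (row_of_tuple y)) * (K y)%:E) =
      \int[lebn n]_y (f y * K y)%:E)%E &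
   forall x, \forall z \ae lebn n, f x * f (reflection x z) <= f z * f z].
Proof.
have [C hC] := u_le 0.
have uoo y : (u y < +oo)%E by apply: le_lt_trans (hC y) _; rewrite ltry.
have [F [mF F0 Fu Fmax]] := max_minorant u0 uoo iu.
have FE y : F y = (fine (F y))%:E.
  rewrite fineK// ge0_fin_numE//; apply: le_lt_trans (Fu y) _.
  by apply: le_lt_trans (hC y) _; rewrite ltry.
exists (fine \o F); split.
- by apply: measurableT_comp => //; exact: measurable_fine.
- by move=> y; exact: fine_ge0.
- move=> A; have [D hD] := u_le A; exists D => y.
  by rewrite -lee_fin -FE; exact: le_trans (Fu y) (hD y).
- move=> K mK K0.
  have mFK : measurable_fun setT (fun y => (fine (F y) * K y)%:E).
    apply/measurable_EFinP; apply: measurable_funM => //.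
    by apply: measurableT_comp => //; exact: measurable_fine.
  have uK0 y : (0 <= u y * (K y)%:E)%E by rewrite mule_ge0// lee_fin ltW.
  have FK0 y : (0 <= (fine (F y) * K y)%:E)%E.
    by rewrite lee_fin mulr_ge0 ?fine_ge0// ltW.
  apply/eqP; rewrite eq_le; apply/andP; split; last first.
    apply: le_integral_minorant => // y; rewrite EFinM -FE.
    by apply: lee_wpmul2r => //; rewrite lee_fin ltW.
  rewrite [leLHS]ge0_integralTE//; apply: ge_ereal_sup => _ [h /= hu <-].
  rewrite -integralT_nnsfun; apply: ae_ge0_le_integral => //.
  + by move=> y _; rewrite lee_fin.
  + exact/measurable_EFinP.
  (* A simple function below [u * K], divided by [K], is a measurable minorant of [u], so maximality
     puts it below [F] almost everywhere. *)
  have : \forall y \ae lebn n, ((h y / K y)%:E <= F y)%E.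
    apply: Fmax.
    - apply/measurable_EFinP; apply: measurable_funM => //.
      rewrite (_ : (fun y => _) = (fun y => expR (- ln (K y)))); last first.
        by apply/funext => y; rewrite expRN lnK// posrE.
      apply: measurableT_comp => //; apply: measurable_funN.
      by apply: measurableT_comp => //; exact: measurable_ln.
    - by move=> y; rewrite lee_fin divr_ge0// ltW.
    - by move=> y; rewrite EFinM lee_pdivrMr.
  apply: filterS => y hy _; move: hy; rewrite {1}FE !lee_fin.
  by rewrite ler_pdivrMr.
- move=> x.
  (* By convexity of [phi] this geometric mean is a measurable minorant of [u]; maximality of [F]
     then is log-concavity at almost every [z]. *)
  pose g z := Num.sqrt (fine (F x) * fine (F (reflection x z))).
  have mg : measurable_fun setT (EFin \o g).
    have msq : measurable_fun setT (@Num.sqrt R).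
      by apply: continuous_measurable_fun; exact: sqrt_continuous.
    apply/measurable_EFinP; apply: (measurableT_comp msq).
    apply: measurable_funM; first exact: measurable_cst.
    have mfF : measurable_fun setT (fine \o F).
      by apply: measurableT_comp => //; exact: measurable_fine.
    by apply: (measurableT_comp mfF); exact: measurable_reflection.
  have g0 z : (0 <= (EFin \o g) z)%E by rewrite lee_fin sqrtr_ge0.
  have gu z : ((EFin \o g) z <= u z)%E.
    have := u_conv x z.
    have -> : u z = (fine (u z))%:E.
      by rewrite fineK// ge0_fin_numE.
    rewrite -EFinM => h.
    rewrite /= lee_fin -(ler_pXn2r (n := 2))// ?nnegrE ?sqrtr_ge0 ?fine_ge0//.
    rewrite sqr_sqrtr; last by rewrite mulr_ge0 ?fine_ge0.
    rewrite -lee_fin expr2; apply: le_trans h; rewrite EFinM -!FE.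
    exact: lee_pmul.
  apply: filterS (Fmax _ mg g0 gu) => z; rewrite FE lee_fin => hz.
  rewrite /= -[leLHS]sqr_sqrtr; last by rewrite mulr_ge0 ?fine_ge0.
  by rewrite expr2; apply: ler_pM => //; exact: sqrtr_ge0.
Qed.

End density.

(** * First-order expansion of an exponential under the integral sign *)

Section exp_expansion.
Context {R : realType}.

Lemma expR_ge1 (x : R) : 0 <= x -> 1 <= expR x.
Proof. by move=> x0; rewrite -expR0 ler_expR. Qed.

Lemma sqr_le_norm (x c : R) : `|x| <= c -> x ^+ 2 <= c ^+ 2.
Proof.
move=> h; have c0 : 0 <= c by exact: le_trans h.
by rewrite -real_normK ?num_real// ler_pXn2r ?nnegrE.
Qed.

Lemma expR_taylor2 (x : R) : `|expR x - 1 - x| <= x ^+ 2 * expR `|x|.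
Proof.
have h1 : 1 + x <= expR x by exact: expR_ge1Dx.
have h2 : expR x - 1 <= x * expR x.
  have := expR_ge1Dx (- x); rewrite expRN => h.
  have : (1 - x) * expR x <= 1 by rewrite -ler_pdivlMr ?expR_gt0// mul1r.
  lra.
rewrite ger0_norm; last by lra.
have [x0|x0] := leP 0 x.
  rewrite ger0_norm//; apply: (@le_trans _ _ (x * (x * expR x))).
    apply: (@le_trans _ _ (x * (expR x - 1))); first by lra.
    exact: ler_wpM2l.
  by rewrite mulrA expr2.
apply: (@le_trans _ _ (x ^+ 2 * 1)); first by nra.
by rewrite ler_wpM2l ?sqr_ge0// expR_ge1.
Qed.

(** The square of [s * x / 2 <= expR (s * x / 2)]. *)
Lemma sqr_le_expR (s x : R) : 0 < s -> 0 <= x -> x ^+ 2 <= 4 / s ^+ 2 * expR (s * x).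
Proof.
move=> s0 x0; have h := expR_ge1Dx (s * x / 2).
have sx : 0 <= s * x by rewrite mulr_ge0// ltW.
rewrite mulrAC ler_pdivlMr ?exprn_gt0// [s * x]splitr expRD.
have : (s * x / 2) * (s * x / 2) <= expR (s * x / 2) * expR (s * x / 2).
  by apply: ler_pM; lra.
set E := expR _; nra.
Qed.

Context d (T : measurableType d) (m : {measure set T -> \bar R}).
Local Open Scope ring_scope.

(** Half of the spare exponent [de] absorbs the exponential of [|xi|], the other half the square of
    [q]; the constant is [16 / de ^+ 2 = 4 / (de / 2) ^+ 2]. *)
Lemma integral_exp_expansion (w q xi : T -> R) (de e : R) :
  measurable_fun setT w -> measurable_fun setT xi ->
  0 < de -> 0 <= e -> e <= de / 2 -> (forall y, 0 <= q y) ->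
  (forall y, `|xi y| <= e * q y) ->
  m.-integrable setT (EFin \o (fun y => w y * expR (de * q y))) ->
  m.-integrable setT (EFin \o (fun y => w y * xi y)) ->
  `| \int[m]_y (w y * expR (xi y)) - \int[m]_y w y - \int[m]_y (w y * xi y) | <=
  e ^+ 2 * (16 / de ^+ 2 * \int[m]_y `|w y * expR (de * q y)|).
Proof.
move=> mw mxi de0 e0 ede q0 xiq iw iwx.
have mexp : measurable_fun setT (fun y => expR (xi y)) by exact: measurableT_comp.
have dq y : 0 <= de * q y by rewrite mulr_ge0// ltW.
have le1 y : expR (xi y) <= expR (de * q y).
  rewrite ler_expR; apply: (le_trans (ler_norm _)); apply: le_trans (xiq y) _.
  by apply: ler_wpM2r => //; lra.
have i1 : m.-integrable setT (EFin \o w).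
  apply: le_integrable iw => //; first exact/measurable_EFinP.
  move=> y _ /=; rewrite lee_fin normrM ler_peMr//.
  by rewrite ger0_norm ?expR_ge0// expR_ge1.
have i2 : m.-integrable setT (EFin \o (fun y => w y * expR (xi y))).
  apply: le_integrable iw => //; first by apply/measurable_EFinP; exact: measurable_funM.
  move=> y _ /=; rewrite lee_fin !normrM ler_wpM2l//.
  by rewrite !ger0_norm ?expR_ge0.
have i3 : m.-integrable setT (EFin \o (fun y => w y * expR (xi y) - w y)).
  have := integrableB measurableT i2 i1.
  by apply: eq_integrable => //.
have i4 : m.-integrable setT (EFin \o (fun y => w y * expR (xi y) - w y - w y * xi y)).
  have := integrableB measurableT i3 iwx.
  by apply: eq_integrable => //.
rewrite -RintegralB// -RintegralB//.
apply: le_trans (le_normr_Rintegral measurableT i4) _.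
have i5 : m.-integrable setT (EFin \o (fun y => `|w y * expR (de * q y)|)).
  exact: (integrable_norm iw).
rewrite mulrA -RintegralZl//; apply: le_Rintegral => //.
- exact: (integrable_norm i4).
- have := integrableZl measurableT (e ^+ 2 * (16 / de ^+ 2)) i5.
  by apply: eq_integrable => // y _; rewrite /= EFinM.
move=> y _.
rewrite (_ : w y * expR (xi y) - w y - w y * xi y =
  w y * (expR (xi y) - 1 - xi y)); last by ring.
rewrite !normrM mulrCA ler_wpM2l// (ger0_norm (expR_ge0 _)).
apply: le_trans (expR_taylor2 _) _.
have xq : xi y ^+ 2 <= e ^+ 2 * q y ^+ 2.
  by rewrite -exprMn; exact: sqr_le_norm.
have xe : expR `|xi y| <= expR (de / 2 * q y).
  by rewrite ler_expR; apply: le_trans (xiq y) _; exact: ler_wpM2r.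
apply: (@le_trans _ _ (e ^+ 2 * q y ^+ 2 * expR (de / 2 * q y))).
  by apply: ler_pM => //; exact: sqr_ge0.
rewrite -[leLHS]mulrA -[leRHS]mulrA ler_wpM2l ?sqr_ge0//.
have := @sqr_le_expR (de / 2) (q y); rewrite divr_gt0// => /(_ isT (q0 y)) h.
apply: le_trans (ler_wpM2r (expR_ge0 _) h) _.
rewrite -[leLHS]mulrA -expRD -mulrDl -splitr ler_wpM2r ?expR_ge0//.
rewrite (_ : 4 / _ = 16 / de ^+ 2)//; by field; rewrite gt_eqF.
Qed.

End exp_expansion.

(** * Calculus of first-order expansions with quadratic remainder *)

Section quadratic_expansion.
Context {R : realType} {n : nat}.
Implicit Types (a c : R) (b l : 'rV[R]_n) (F : R -> 'rV[R]_n -> R).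

Definition hnorm (al : R) (be : 'rV[R]_n) : R := `|al| + ell be.

Lemma hnorm_ge0 al be : 0 <= hnorm al be.
Proof. by rewrite addr_ge0// ell_ge0. Qed.

(* [c] and [l] are the partial derivatives of [F] at [(a, b)]. *)
Definition expansion2 F a b c l := exists K d, [/\ 0 <= K, 0 < d &
  forall al be, hnorm al be <= d ->
    `|F (a + al) (b + be) - F a b - (c * al + edot l be)| <= K * hnorm al be ^+ 2].

Lemma edotC (x y : 'rV[R]_n) : edot x y = edot y x.
Proof. by apply: eq_bigr => i _; rewrite mulrC. Qed.

Lemma edotDl (x y z : 'rV[R]_n) : edot (x + y) z = edot x z + edot y z.
Proof. by rewrite /edot -big_split/=; apply: eq_bigr => i _; rewrite mxE mulrDl. Qed.

Lemma edotZl (k : R) (x z : 'rV[R]_n) : edot (k *: x) z = k * edot x z.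
Proof. by rewrite /edot mulr_sumr; apply: eq_bigr => i _; rewrite mxE mulrA. Qed.

Lemma edotNl (x z : 'rV[R]_n) : edot (- x) z = - edot x z.
Proof. by rewrite -scaleN1r edotZl mulN1r. Qed.

Lemma edotBl (x y z : 'rV[R]_n) : edot (x - y) z = edot x z - edot y z.
Proof. by rewrite edotDl edotNl. Qed.

Lemma edotDr (x y z : 'rV[R]_n) : edot z (x + y) = edot z x + edot z y.
Proof. by rewrite edotC edotDl !(edotC z). Qed.

Lemma edotZr (k : R) (x z : 'rV[R]_n) : edot z (k *: x) = k * edot z x.
Proof. by rewrite edotC edotZl (edotC z). Qed.

Lemma edotNr (x z : 'rV[R]_n) : edot z (- x) = - edot z x.
Proof. by rewrite edotC edotNl (edotC z). Qed.

Lemma edotBr (x y z : 'rV[R]_n) : edot z (x - y) = edot z x - edot z y.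
Proof. by rewrite edotDr edotNr. Qed.

Lemma edot0r (x : 'rV[R]_n) : edot x 0 = 0.
Proof. by rewrite /edot big1// => i _; rewrite mxE mulr0. Qed.

Lemma edotxx_ge0 (x : 'rV[R]_n) : 0 <= edot x x.
Proof. by apply: sumr_ge0 => i _; rewrite -expr2 sqr_ge0. Qed.

Lemma normr_edot_le (x y : 'rV[R]_n) : `|edot x y| <= ell x * ell y.
Proof.
rewrite /edot; apply: le_trans (ler_norm_sum _ _ _) _.
rewrite {1}/ell mulr_suml; apply: ler_sum => i _; rewrite normrM.
by rewrite ler_wpM2l// coord_le_ell.
Qed.

Lemma edot_delta (x : 'rV[R]_n) i : edot x (delta_mx 0 i) = x 0 i.
Proof.
rewrite /edot (bigD1 i)//= big1 ?addr0; first by rewrite mxE !eqxx mulr1.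
by move=> j ji; rewrite mxE eqxx (negbTE ji) mulr0.
Qed.

Lemma ellZ (k : R) (x : 'rV[R]_n) : ell (k *: x) = `|k| * ell x.
Proof. by rewrite /ell mulr_sumr; apply: eq_bigr => i _; rewrite mxE normrM. Qed.

Lemma ell0 : ell (0 : 'rV[R]_n) = 0.
Proof. by rewrite /ell big1// => i _; rewrite mxE normr0. Qed.

Lemma expansion2_lin_le c l al be : `|c * al + edot l be| <= (`|c| + ell l) * hnorm al be.
Proof.
apply: le_trans (ler_normD _ _) _; rewrite normrM.
have := normr_edot_le l be; have := ell_ge0 l; have := ell_ge0 be.
have := normr_ge0 c; have := normr_ge0 al; rewrite /hnorm; nra.
Qed.

Lemma expansion2_lip F a b c l : expansion2 F a b c l -> exists L d, [/\ 0 <= L, 0 < d &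
  forall al be, hnorm al be <= d ->
    `|F (a + al) (b + be) - F a b| <= L * hnorm al be].
Proof.
move=> [K [d [K0 d0 h]]]; exists (K * d + (`|c| + ell l)), d; split => //.
  by rewrite !addr_ge0 ?ell_ge0// mulr_ge0// ltW.
move=> al be hd.
rewrite -[X in `|X|](subrK (c * al + edot l be)).
apply: le_trans (ler_normD _ _) _; rewrite mulrDl.
apply: lerD; last exact: expansion2_lin_le.
apply: le_trans (h _ _ hd) _; rewrite expr2 mulrA ler_wpM2r ?hnorm_ge0//.
by rewrite ler_wpM2l.
Qed.

Lemma expansion2_add F1 F2 a b c1 c2 l1 l2 : expansion2 F1 a b c1 l1 ->
    expansion2 F2 a b c2 l2 ->
  expansion2 (fun a b => F1 a b + F2 a b) a b (c1 + c2) (l1 + l2).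
Proof.
move=> [K1 [d1 [K10 d10 h1]]] [K2 [d2 [K20 d20 h2]]].
exists (K1 + K2), (Num.min d1 d2); split; rewrite ?addr_ge0// ?lt_min ?d10//.
move=> al be; rewrite le_min => /andP[hd1 hd2].
rewrite edotDl mulrDl (_ : _ - _ = (F1 (a + al) (b + be) - F1 a b - (c1 * al + edot l1 be)) +
  (F2 (a + al) (b + be) - F2 a b - (c2 * al + edot l2 be))); last by ring.
by apply: le_trans (ler_normD _ _) _; rewrite mulrDl lerD ?h1 ?h2.
Qed.

Lemma expansion2_mul F1 F2 a b c1 c2 l1 l2 : expansion2 F1 a b c1 l1 ->
    expansion2 F2 a b c2 l2 ->
  expansion2 (fun a b => F1 a b * F2 a b) a b (F1 a b * c2 + F2 a b * c1)
     (F1 a b *: l2 + F2 a b *: l1).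
Proof.
move=> h1 h2.
have [L1 [e1 [L10 e10 g1]]] := expansion2_lip h1;
    have [L2 [e2 [L20 e20 g2]]] := expansion2_lip h2.
move: h1 h2 => [K1 [d1 [K10 d10 h1]]] [K2 [d2 [K20 d20 h2]]].
exists (`|F1 a b| * K2 + `|F2 a b| * K1 + L1 * L2), (Num.min (Num.min d1 d2) (Num.min e1 e2)).
split; first by rewrite !addr_ge0// mulr_ge0.
  by rewrite !lt_min d10 d20 e10 e20.
move=> al be; rewrite !le_min => /andP[/andP[hd1 hd2] /andP[he1 he2]].
rewrite edotDl !edotZl.
rewrite (_ : _ - _ =
  F1 a b * (F2 (a + al) (b + be) - F2 a b - (c2 * al + edot l2 be)) +
  F2 a b * (F1 (a + al) (b + be) - F1 a b - (c1 * al + edot l1 be)) +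
  (F1 (a + al) (b + be) - F1 a b) * (F2 (a + al) (b + be) - F2 a b)); last by ring.
apply: le_trans (ler_normD _ _) _; rewrite [leRHS]mulrDl; apply: lerD.
  apply: le_trans (ler_normD _ _) _; rewrite [leRHS]mulrDl !normrM -!mulrA.
  by apply: lerD; rewrite ler_wpM2l// ?h1 ?h2.
by rewrite normrM expr2 mulrACA ler_pM// ?g1 ?g2.
Qed.

Lemma expansion2_comp (f : R -> R) (f' : R) F a b c l : expansion2 F a b c l ->
  (exists K d, [/\ 0 <= K, 0 < d & forall v, `|v| <= d ->
     `|f (F a b + v) - f (F a b) - f' * v| <= K * v ^+ 2]) ->
  expansion2 (fun a b => f (F a b)) a b (f' * c) (f' *: l).
Proof.
move=> h [K' [d' [K'0 d'0 hf]]].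
have [L [e [L0 e0 g]]] := expansion2_lip h; move: h => [K [d [K0 d0 h]]].
have L1 : 0 < L + 1 by rewrite ltr_wpDl.
exists (K' * L ^+ 2 + `|f'| * K), (Num.min (Num.min d e) (d' / (L + 1))).
split; first by rewrite !addr_ge0// mulr_ge0// sqr_ge0.
  by rewrite !lt_min d0 e0 divr_gt0.
move=> al be; rewrite !le_min => /andP[/andP[hd he] he'].
set v := F (a + al) (b + be) - F a b.
have vL : `|v| <= L * hnorm al be by exact: g.
have vd : `|v| <= d'.
  move: he'; rewrite ler_pdivlMr// => he'; have := hnorm_ge0 al be; nra.
have Fv : F a b + v = F (a + al) (b + be) by rewrite /v addrC subrK.
have := hf v vd; rewrite Fv => hv.
rewrite edotZl (_ : _ - _ = (f (F (a + al) (b + be)) - f (F a b) - f' * v) +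
  f' * (v - (c * al + edot l be))); last by ring.
apply: le_trans (ler_normD _ _) _; rewrite mulrDl; apply: lerD.
  apply: le_trans hv _; rewrite -mulrA ler_wpM2l// -exprMn; exact: sqr_le_norm.
by rewrite normrM -mulrA ler_wpM2l// h.
Qed.

Lemma expansion2_inv F a b c l : 0 < F a b -> expansion2 F a b c l ->
  expansion2 (fun a b => (F a b)^-1) a b (- (F a b) ^- 2 * c) (- (F a b) ^- 2 *: l).
Proof.
move=> F0 h; apply: expansion2_comp => //; set u := F a b in F0 *.
(* For [|v| <= u / 2] the denominator [u + v] is at least [u / 2], hence the factor 2. *)
exists (2 / u ^+ 3), (u / 2); split; rewrite ?divr_gt0// ?divr_ge0 ?exprn_ge0 ?ltW//.
move=> v; rewrite ler_norml => /andP[v1 v2].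
have uv : 0 < u + v by lra.
rewrite (_ : _ - _ = v ^+ 2 / (u ^+ 2 * (u + v))); last by field; rewrite !gt_eqF.
rewrite ger0_norm; last by rewrite divr_ge0 ?sqr_ge0// mulr_ge0 ?sqr_ge0 ?ltW.
rewrite mulrC ler_wpM2r ?sqr_ge0//.
rewrite -[leLHS]div1r ler_pdivrMr ?mulr_gt0 ?exprn_gt0//.
rewrite [leRHS](_ : _ = 2 * (u + v) / u); last by field; rewrite gt_eqF.
by rewrite ler_pdivlMr//; lra.
Qed.

Lemma expansion2_ln F a b c l : 0 < F a b -> expansion2 F a b c l ->
  expansion2 (fun a b => ln (F a b)) a b ((F a b)^-1 * c) ((F a b)^-1 *: l).
Proof.
move=> F0 h; apply: expansion2_comp => //; set u := F a b in F0 *.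
exists (2 / u ^+ 2), (u / 2); split; rewrite ?divr_gt0// ?divr_ge0 ?exprn_ge0 ?ltW//.
move=> v; rewrite ler_norml => /andP[v1 v2].
have uv : 0 < u + v by lra.
have -> : ln (u + v) - ln u = ln ((u + v) / u) by rewrite ln_div ?posrE.
(* Both bounds come from [ln (1 + x) <= x], the lower one through the inverse ratio; their gap is
   [v ^+ 2 / (u * (u + v))]. *)
have up : ln ((u + v) / u) <= v / u.
  rewrite (_ : (u + v) / u = 1 + v / u); last by field; rewrite gt_eqF.
  by apply: le_ln1Dx; rewrite ltr_pdivlMr//; lra.
have low : v / (u + v) <= ln ((u + v) / u).
  have -> : ln ((u + v) / u) = - ln (u / (u + v)) by rewrite -lnV ?posrE ?divr_gt0// invf_div.
  rewrite lerNr (_ : u / (u + v) = 1 + - (v / (u + v))); last by field; rewrite gt_eqF.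
  by apply: le_ln1Dx; rewrite ltrNr opprK ltr_pdivrMr//; lra.
rewrite ler_norml; apply/andP; split; last first.
  rewrite [u^-1 * v]mulrC; apply: (@le_trans _ _ 0); first by rewrite subr_le0.
  by rewrite mulr_ge0 ?sqr_ge0// divr_ge0 ?sqr_ge0.
rewrite lerNl opprB [u^-1 * v]mulrC; apply: (@le_trans _ _ (v / u - v / (u + v))).
  by rewrite lerD2l lerN2.
rewrite (_ : v / u - _ = v ^+ 2 / (u * (u + v))); last by field; rewrite !gt_eqF.
rewrite mulrC ler_wpM2r ?sqr_ge0//.
rewrite -[leLHS]div1r ler_pdivrMr ?mulr_gt0//.
rewrite [leRHS](_ : _ = 2 * (u + v) / u); last by field; rewrite gt_eqF.
by rewrite ler_pdivlMr//; lra.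
Qed.

Lemma expansion2_cst k a b : expansion2 (fun _ _ => k) a b 0 0.
Proof.
exists 0, 1; split => // al be _.
by rewrite edotC edot0r !mul0r !subrr addr0 subr0 normr0.
Qed.

Lemma expansion2_a a b : expansion2 (fun a _ => a) a b 1 0.
Proof.
exists 0, 1; split => // al be _.
by rewrite mul1r edotC edot0r addr0 mul0r [a + al]addrC addrK subrr normr0.
Qed.

Lemma expansion2_coord i a b : expansion2 (fun _ b => b 0 i) a b 0 (delta_mx 0 i).
Proof.
exists 0, 1; split => // al be _.
by rewrite !mul0r edotC edot_delta add0r mxE [b 0 i + _]addrC addrK subrr normr0.
Qed.

End quadratic_expansion.

(** * Exponentially tilted moments of [f] and their derivatives *)

Section moments.
Context {R : realType} {n : nat}.
Local Notation RB := (measurableTypeR R).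
Local Notation lebn := (@lebn R).
Local Notation T := (n.-tuple RB).
Local Notation Y := (@row_of_tuple R n).

(** At most exponential growth. These functions form an algebra that contains the coordinates and,
    for nonnegative [a], the Gaussian weights, and they are all integrable against [f], whose decay
    beats every exponential. *)
Definition exp_bounded (w : T -> R) := measurable_fun setT w /\
  exists C B, [/\ 0 <= C, 0 <= B & forall y, `|w y| <= C * expR (B * ell (Y y))].

Lemma exp_bounded_cst k : exp_bounded (fun=> k).
Proof.
split; first exact: measurable_cst.
by exists `|k|, 0; split => // y; rewrite mul0r expR0 mulr1.
Qed.

Let exp_mono (B1 B2 : R) y : B1 <= B2 -> expR (B1 * ell (Y y)) <= expR (B2 * ell (Y y)).
Proof. by move=> h; rewrite ler_expR ler_wpM2r// ell_ge0. Qed.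

Lemma exp_bounded_add w1 w2 : exp_bounded w1 -> exp_bounded w2 ->
    exp_bounded (fun y => w1 y + w2 y).
Proof.
move=> [m1 [C1 [B1 [C10 B10 h1]]]] [m2 [C2 [B2 [C20 B20 h2]]]].
split; first exact: measurable_funD.
exists (C1 + C2), (B1 + B2); split; rewrite ?addr_ge0// => y.
apply: le_trans (ler_normD _ _) _; rewrite [leRHS]mulrDl; apply: lerD.
  by apply: le_trans (h1 y) _; rewrite ler_wpM2l// exp_mono// lerDl.
by apply: le_trans (h2 y) _; rewrite ler_wpM2l// exp_mono// lerDr.
Qed.

Lemma exp_bounded_mul w1 w2 : exp_bounded w1 -> exp_bounded w2 ->
    exp_bounded (fun y => w1 y * w2 y).
Proof.
move=> [m1 [C1 [B1 [C10 B10 h1]]]] [m2 [C2 [B2 [C20 B20 h2]]]].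
split; first exact: measurable_funM.
exists (C1 * C2), (B1 + B2); split; rewrite ?addr_ge0 ?mulr_ge0// => y.
by rewrite normrM mulrDl expRD mulrACA; apply: ler_pM.
Qed.

Lemma exp_bounded_opp w : exp_bounded w -> exp_bounded (fun y => - w y).
Proof.
move=> h; have := exp_bounded_mul (exp_bounded_cst (-1)) h.
by congr exp_bounded; apply/funext => y; rewrite mulN1r.
Qed.

Lemma exp_bounded_sub w1 w2 : exp_bounded w1 -> exp_bounded w2 ->
    exp_bounded (fun y => w1 y - w2 y).
Proof. by move=> h1 h2; exact: exp_bounded_add h1 (exp_bounded_opp h2). Qed.

Lemma exp_bounded_sum (K : Type) (s : seq K) (w : K -> T -> R) :
  (forall i, exp_bounded (w i)) -> exp_bounded (fun y => \sum_(i <- s) w i y).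
Proof.
move=> h; elim: s => [|i s ih].
  by under eq_fun do rewrite big_nil; exact: exp_bounded_cst.
by under eq_fun do rewrite big_cons; exact: exp_bounded_add.
Qed.

Lemma exp_bounded_coord i : exp_bounded (fun y => Y y 0 i).
Proof.
split.
  by under eq_fun do rewrite mxE; exact: measurable_tnth.
exists 1, 1; split => // y; rewrite !mul1r.
apply: le_trans (coord_le_ell _ _) _; apply: le_trans (expR_ge1Dx _).
by rewrite lerDr.
Qed.

Lemma exp_bounded_edot (b : 'rV[R]_n) : exp_bounded (fun y => edot b (Y y)).
Proof. by apply: exp_bounded_sum => i; apply: exp_bounded_mul;
    [exact: exp_bounded_cst|exact: exp_bounded_coord]. Qed.

Lemma exp_bounded_sq : exp_bounded (fun y => edot (Y y) (Y y)).
Proof. by apply: exp_bounded_sum => i; apply: exp_bounded_mul; exact: exp_bounded_coord. Qed.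

Lemma exp_bounded_exp_ell c : 0 <= c -> exp_bounded (fun y => expR (c * ell (Y y))).
Proof.
move=> c0; split; first exact: measurable_exp_ell.
by exists 1, c; split => // y; rewrite mul1r ger0_norm// expR_ge0.
Qed.

Definition weight a (b : 'rV[R]_n) (y : T) := expR (edot b (Y y) - a * edot (Y y) (Y y)).

Lemma weight_gt0 a b y : 0 < weight a b y. Proof. exact: expR_gt0. Qed.

Lemma exp_bounded_expR (w : T -> R) (c : R) : measurable_fun setT w -> 0 <= c ->
  (forall y, w y <= c * ell (Y y)) -> exp_bounded (fun y => expR (w y)).
Proof.
move=> mw c0 h; split; first exact: measurableT_comp.
by exists 1, c; split => // y; rewrite mul1r ger0_norm ?expR_ge0// ler_expR.
Qed.

Lemma exp_bounded_weight a b : 0 <= a -> exp_bounded (weight a b).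
Proof.
move=> a0; apply: (@exp_bounded_expR _ (ell b)); last first.
- move=> y; apply: (@le_trans _ _ (edot b (Y y))).
    by rewrite lerBlDr lerDl mulr_ge0// edotxx_ge0.
  by apply: le_trans (ler_norm _) _; exact: normr_edot_le.
- exact: ell_ge0.
- by apply: measurable_funB; [exact: (exp_bounded_edot b).1|apply: measurable_funM => //;
    exact: exp_bounded_sq.1].
Qed.

Variable f : T -> R.
Hypothesis mf : measurable_fun setT f.
Hypothesis f0 : forall y, 0 <= f y.
Hypothesis f_decay : forall A, exists C, forall y, f y <= C * expR (- (A * ell (Y y))).
Hypothesis f_mass : (0 < \int[lebn n]_y (f y)%:E)%E.

Lemma exp_bounded_int w : exp_bounded w ->
    (lebn n).-integrable setT (EFin \o (fun y => w y * f y)).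
Proof.
(* [B] units of decay cancel the growth of [w]; the remaining one leaves an integrable
   exponential. *)
move=> [mw [C [B [C0 B0 h]]]]; have [D hD] := f_decay (B + 1).
have D0 : 0 <= D.
  by have := le_trans (f0 [tuple 0 | i < n]) (hD _); rewrite pmulr_lge0// expR_gt0.
have m1 : measurable_fun [set: T] (fun y => expR (- ell (Y y))).
  by have := @measurable_exp_ell R n (-1); under eq_fun do rewrite mulN1r.
have i1 : (lebn n).-integrable setT (fun y => (C * D)%:E * (expR (- ell (Y y)))%:E)%E.
  apply: integrableZl => //; apply/integrableP; split; first exact/measurable_EFinP.
  apply: le_lt_trans (integral_exp_ell n); rewrite le_eqVlt; apply/orP; left; apply/eqP.
  by apply: eq_integral => y _; rewrite gee0_abs// lee_fin expR_ge0.
apply: le_integrable i1 => //; first by apply/measurable_EFinP; exact: measurable_funM.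
move=> y _; rewrite /= lee_fin normrM (ger0_norm (f0 y)).
rewrite [leRHS]ger0_norm; last by rewrite !mulr_ge0// expR_ge0.
apply: le_trans (ler_pM (normr_ge0 _) (f0 y) (h y) (hD y)) _.
by rewrite mulrACA -expRD mulrDl mul1r opprD addrA subrr add0r.
Qed.

Definition moment w := \int[lebn n]_y (w y * f y).

Lemma moment_add w1 w2 : exp_bounded w1 -> exp_bounded w2 ->
    moment (fun y => w1 y + w2 y) = moment w1 + moment w2.
Proof.
move=> h1 h2; rewrite /moment -RintegralD//; [|exact: exp_bounded_int..].
by apply: eq_Rintegral => y _; rewrite mulrDl.
Qed.

Lemma moment_scale k w : exp_bounded w -> moment (fun y => k * w y) = k * moment w.
Proof.
move=> h; rewrite /moment -RintegralZl//; last exact: exp_bounded_int.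
by apply: eq_Rintegral => y _; rewrite mulrA.
Qed.

Lemma moment_sub w1 w2 : exp_bounded w1 -> exp_bounded w2 ->
    moment (fun y => w1 y - w2 y) = moment w1 - moment w2.
Proof.
move=> h1 h2; rewrite (_ : (fun y => _) = (fun y => w1 y + -1 * w2 y)); last first.
  by apply/funext => y; rewrite mulN1r.
rewrite moment_add//; last by apply: exp_bounded_mul => //; exact: exp_bounded_cst.
by rewrite moment_scale// mulN1r.
Qed.

Lemma moment_sum (K : Type) (s : seq K) (k : K -> R) (w : K -> T -> R) :
  (forall i, exp_bounded (w i)) ->
  moment (fun y => \sum_(i <- s) k i * w i y) = \sum_(i <- s) k i * moment (w i).
Proof.
move=> h; elim: s => [|i s ih].
  rewrite big_nil -[RHS](mul0r (moment (fun=> 0))) -moment_scale; last exact: exp_bounded_cst.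
  by congr moment; apply/funext => y; rewrite big_nil mul0r.
rewrite big_cons -ih -moment_scale// -moment_add; last 2 first.
- by apply: exp_bounded_mul => //; exact: exp_bounded_cst.
- by apply: exp_bounded_sum => j; apply: exp_bounded_mul => //; exact: exp_bounded_cst.
by congr moment; apply/funext => y; rewrite big_cons.
Qed.

Lemma moment_le w1 w2 : exp_bounded w1 -> exp_bounded w2 -> (forall y, w1 y <= w2 y) ->
    moment w1 <= moment w2.
Proof.
move=> h1 h2 h; apply: le_Rintegral => //; [exact: exp_bounded_int..|].
by move=> y _; exact: ler_wpM2r.
Qed.

Lemma moment_gt0 w : exp_bounded w -> (forall y, 0 < w y) -> 0 < moment w.
Proof.
move=> aw w0; rewrite lt_neqAle; apply/andP; split; last first.
  by apply: Rintegral_ge0 => y _; rewrite mulr_ge0// ltW.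
apply/eqP => J0; move: f_mass.
have mwf : measurable_fun setT (fun y => (w y * f y)%:E).
  by apply/measurable_EFinP; apply: measurable_funM => //; exact: aw.1.
have wf0 y : (0 <= (w y * f y)%:E)%E by rewrite lee_fin mulr_ge0// ltW.
have : (\int[lebn n]_y (w y * f y)%:E = 0)%E.
  rewrite -(@fineK _ (\int[lebn n]_y (w y * f y)%:E)%E); last first.
    exact: (integrable_fin_num measurableT (exp_bounded_int aw)).
  by rewrite -[fine _]/(moment w) -J0.
move/(ge0_integral_eq0 mwf wf0) => ae0.
suff -> : (\int[lebn n]_y (f y)%:E = \int[lebn n]_y (cst 0) y)%E by rewrite integral0 ltxx.
apply: ae_eq_integral => //; first exact/measurable_EFinP.
apply: filterS ae0 => y /eqP; rewrite eqe mulf_eq0 gt_eqF//= => /eqP -> _.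
by [].
Qed.

Definition tilted_moment w a b := moment (fun y => w y * weight a b y).

Lemma tilted_moment_gt0 a b : 0 <= a -> 0 < tilted_moment (fun=> 1) a b.
Proof.
move=> a0; apply: moment_gt0 => [|y]; last by rewrite mul1r weight_gt0.
by apply: exp_bounded_mul; [exact: exp_bounded_cst|exact: exp_bounded_weight].
Qed.

(** An increment of [(a, b)] multiplies the weight by the exponential of a function [xi] linear in
    that increment, so [integral_exp_expansion] yields the derivative together with the quadratic
    remainder. *)
Lemma expansion2_tilted_moment w a b : exp_bounded w -> 0 < a ->
  expansion2 (tilted_moment w) a b (- tilted_moment (fun y => w y * edot (Y y) (Y y)) a b)
     (\row_i tilted_moment (fun y => w y * Y y 0 i) a b).
Proof.
move=> aw a0.
pose w' y := w y * weight a b y * f y.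
(* With spare exponent [a], the quadratic part of [a * q y] exactly cancels that of the weight, and
   what is left grows exponentially at most. *)
pose q y := ell (Y y) + edot (Y y) (Y y).
have q0 y : 0 <= q y by rewrite addr_ge0 ?ell_ge0 ?edotxx_ge0.
have iw : (lebn n).-integrable setT (EFin \o (fun y => w' y * expR (a * q y))).
  have := @exp_bounded_int (fun y => w y * expR (edot b (Y y) + a * ell (Y y))).
  have H : exp_bounded (fun y => w y * expR (edot b (Y y) + a * ell (Y y))).
    apply: exp_bounded_mul => //; apply: (@exp_bounded_expR _ (ell b + a)).
    - apply: measurable_funD; first exact: (exp_bounded_edot b).1.
      by apply: measurable_funM => //; exact: measurable_ell.
    - by rewrite addr_ge0 ?ell_ge0// ltW.
    - move=> y; rewrite mulrDl lerD2r; apply: le_trans (ler_norm _) _; exact: normr_edot_le.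
  move=> /(_ H); apply: eq_integrable => // y _ /=; rewrite /w' /weight /q.
  rewrite (_ : edot b (Y y) + _ = edot b (Y y) - a * edot (Y y) (Y y) +
    a * (ell (Y y) + edot (Y y) (Y y))); last by ring.
  by rewrite expRD; congr EFin; ring.
exists (16 / a ^+ 2 * \int[lebn n]_y `|w' y * expR (a * q y)|), (a / 2).
split; last 1 first.
- move=> al be hd.
  pose xi y := edot be (Y y) - al * edot (Y y) (Y y).
  have axi : exp_bounded xi by apply: exp_bounded_sub;
      [exact: exp_bounded_edot|apply: exp_bounded_mul;
          [exact: exp_bounded_cst|exact: exp_bounded_sq]].
  have awt := exp_bounded_weight b (ltW a0).
  have xiq y : `|xi y| <= hnorm al be * q y.
    apply: le_trans (ler_normB _ _) _; rewrite normrM (ger0_norm (edotxx_ge0 _)).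
    have := normr_edot_le be (Y y); have := ell_ge0 be; have := ell_ge0 (Y y).
    have := normr_ge0 al; have := edotxx_ge0 (Y y); rewrite /hnorm /q; nra.
  have mw' : measurable_fun setT w'.
    by apply: measurable_funM => //; exact: (exp_bounded_mul aw awt).1.
  have iwx : (lebn n).-integrable setT (EFin \o (fun y => w' y * xi y)).
    have := exp_bounded_int (exp_bounded_mul (exp_bounded_mul aw awt) axi).
    by apply: eq_integrable => // y _ /=; rewrite /w' mulrAC.
  have := integral_exp_expansion mw' axi.1 a0 (hnorm_ge0 al be) hd q0 xiq iw iwx.
  rewrite [_ ^+ 2 * _]mulrC; apply: le_trans; rewrite le_eqVlt; apply/orP; left; apply/eqP.
  have -> : \int[lebn n]_y (w' y * expR (xi y)) = tilted_moment w (a + al) (b + be).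
    apply: eq_Rintegral => y _.
    have -> : weight (a + al) (b + be) y = weight a b y * expR (xi y).
      by rewrite /weight -expRD; congr expR; rewrite /xi edotDl; ring.
    by rewrite /w'; ring.
  have -> : \int[lebn n]_y w' y = tilted_moment w a b by [].
  have -> : \int[lebn n]_y (w' y * xi y) =
      moment (fun y => w y * weight a b y * edot be (Y y) - al * (w y * edot (Y y) (Y y) *
          weight a b y)).
    by apply: eq_Rintegral => y _; rewrite /w' /xi; ring.
  rewrite moment_sub; last 2 first.
  + by apply: exp_bounded_mul; [exact: exp_bounded_mul|exact: exp_bounded_edot].
  + by apply: exp_bounded_mul; [exact: exp_bounded_cst|apply: exp_bounded_mul => //;
      apply: exp_bounded_mul => //; exact: exp_bounded_sq].
  rewrite moment_scale; last by apply: exp_bounded_mul => //; apply: exp_bounded_mul => //;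
      exact: exp_bounded_sq.
  have -> : moment (fun y => w y * weight a b y * edot be (Y y)) =
      edot (\row_i tilted_moment (fun y => w y * Y y 0 i) a b) be.
    rewrite edotC /edot; under [RHS]eq_bigr do rewrite mxE.
    rewrite -moment_sum; last first.
      by move=> i; apply: exp_bounded_mul => //; apply: exp_bounded_mul => //;
          exact: exp_bounded_coord.
    congr moment; apply/funext => y; rewrite mulr_sumr; apply: eq_bigr => i _; ring.
  by congr (`| _ |); rewrite /tilted_moment; ring.
- rewrite mulr_ge0//; first by rewrite divr_ge0// sqr_ge0.
  by apply: Rintegral_ge0 => y _.
- by rewrite divr_gt0.
Qed.

End moments.

(** * Moments of one-dimensional Gaussians *)

Section gaussian_moments.
Context {R : realType}.
Local Notation RB := (measurableTypeR R).
Local Notation mu1 := (@lebesgue_measure R).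

(** Unnormalised, with variance [1 / (2 * c)]. *)
Definition gauss (c m r : R) : R := expR (- (c * (r - m) ^+ 2)).

Lemma gauss_gt0 c m r : 0 < gauss c m r. Proof. exact: expR_gt0. Qed.

Lemma measurable_gauss c m : measurable_fun [set: RB] (gauss c m).
Proof.
apply: measurableT_comp => //; apply: measurable_funN; apply: measurable_funM => //.
by apply: measurable_funX; exact: measurable_funB.
Qed.

Lemma integral_translation (m : R) (f : RB -> \bar R) :
  measurable_fun setT f -> (forall x, (0 <= f x)%E) ->
  (\int[mu1]_x f x = \int[mu1]_x f (x + m)%R)%E.
Proof.
move=> mf f0; rewrite (@integral_affine _ 1 m)// mul1e.
by apply: eq_integral => x _; rewrite mul1r.
Qed.

Definition gauss_mass (c : R) : R := Num.sqrt pi / Num.sqrt c.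

Lemma gauss_mass_gt0 c : 0 < c -> 0 < gauss_mass c.
Proof. by move=> c0; rewrite divr_gt0 ?sqrtr_gt0 ?pi_gt0. Qed.

Let integral_gauss0 c : 0 < c -> (\int[mu1]_r (gauss c 0 r)%:E = (gauss_mass c)%:E)%E.
Proof.
move=> c0; have s0 : 0 < Num.sqrt c by rewrite sqrtr_gt0.
have h := @integralT_gauss R.
rewrite (@integral_affine _ (Num.sqrt c) 0) in h => //; last 2 first.
- by apply/measurable_EFinP; exact: measurable_gauss_fun.
- by move=> x; rewrite lee_fin gauss_fun_ge0.
have -> : (\int[mu1]_r (gauss c 0 r)%:E = \int[mu1]_x (gauss_fun (Num.sqrt c * x + 0)%R)%:E)%E.
  apply: eq_integral => x _; rewrite /gauss /gauss_fun subr0 addr0 exprMn sqr_sqrtr//.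
  exact: ltW.
have : ((Num.sqrt c)^-1%:E * ((Num.sqrt c)%:E * \int[mu1]_x (gauss_fun (Num.sqrt c * x +
    0)%R)%:E)
   = (Num.sqrt c)^-1%:E * (Num.sqrt pi)%:E)%E by rewrite h.
by rewrite muleA -EFinM mulVf ?gt_eqF// mul1e -EFinM mulrC.
Qed.

Lemma integral_gauss c m : 0 < c -> (\int[mu1]_r (gauss c m r)%:E = (gauss_mass c)%:E)%E.
Proof.
move=> c0; rewrite -integral_gauss0// [in RHS](@integral_translation (- m)); last 2 first.
- by apply/measurable_EFinP; exact: measurable_gauss.
- by move=> x; rewrite lee_fin ltW ?gauss_gt0.
by apply: eq_integral => x _; rewrite /gauss subr0.
Qed.

Lemma integrable_gauss c m : 0 < c -> mu1.-integrable setT (EFin \o gauss c m).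
Proof.
move=> c0; apply/integrableP; split.
  by apply/measurable_EFinP; exact: measurable_gauss.
rewrite (eq_integral (fun r : RB => (gauss c m r)%:E)); first by rewrite integral_gauss// ltry.
by move=> r _; rewrite gee0_abs// lee_fin ltW ?gauss_gt0.
Qed.

Lemma Rintegral_gauss c m : 0 < c -> \int[mu1]_r gauss c m r = gauss_mass c.
Proof. by move=> c0; rewrite /Rintegral integral_gauss. Qed.

Let ae_eq_small (x K : R) : (forall e, 0 < e -> e <= 1 -> `|x| <= K * e) -> x = 0.
Proof.
move=> h; apply/eqP; rewrite -normr_le0; apply/ler_addgt0Pr => e e0; rewrite add0r.
have K0 : 0 <= K by have := h 1; rewrite mulr1 ltr01 lexx => /(_ isT isT); exact: le_trans.
have e1 : 0 < Num.min 1 (e / (K + 1)) by rewrite lt_min ltr01 divr_gt0// ltr_wpDl.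
apply: le_trans (h _ e1 _) _; first by rewrite ge_min lexx.
apply: (@le_trans _ _ (K * (e / (K + 1)))).
  by rewrite ler_wpM2l// ge_min lexx orbT.
by rewrite mulrA ler_pdivrMr ?ltr_wpDl//; nra.
Qed.

Let S1 c := \int[mu1]_r (gauss c 0 r * r).
Let S2 c := \int[mu1]_r (gauss c 0 r * r ^+ 2).

Let dom c : 0 < c -> mu1.-integrable setT
  (EFin \o (fun r => gauss c 0 r * expR (c / 2 * (1 + r ^+ 2)))).
Proof.
move=> c0; have c20 : 0 < c / 2 by rewrite divr_gt0.
have := integrableZl measurableT (expR (c / 2)) (integrable_gauss 0 c20).
apply: eq_integrable => // r _; rewrite /= -EFinM /gauss -!expRD; congr (expR _)%:E.
by field.
Qed.

Let measurable_gaussM c (g : R -> R) : measurable_fun [set: RB] g ->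
  measurable_fun [set: RB] (fun r => gauss c 0 r * g r).
Proof. by move=> mg; apply: measurable_funM => //; exact: measurable_gauss. Qed.

Let iS c (g : R -> R) : 0 < c -> measurable_fun [set: RB] g ->
  (forall r, `|g r| <= 1 + r ^+ 2) ->
  mu1.-integrable setT (EFin \o (fun r => gauss c 0 r * g r)).
Proof.
move=> c0 mg hg; have c20 : 0 < c / 2 by rewrite divr_gt0.
have := integrableZl measurableT (c / 2)^-1 (dom c0).
apply: le_integrable => //; first by apply/measurable_EFinP; exact: measurable_gaussM.
move=> r _; rewrite /= lee_fin.
have h1 : 1 + r ^+ 2 <= (c / 2)^-1 * expR (c / 2 * (1 + r ^+ 2)).
  by rewrite ler_pdivlMl//; apply: le_trans (expR_ge1Dx _); lra.
have g0 : 0 <= gauss c 0 r by rewrite ltW ?gauss_gt0.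
rewrite normrM (ger0_norm g0); apply: le_trans (ler_norm _).
by rewrite mulrCA ler_wpM2l// (le_trans (hg r)).
Qed.

(** The mass is invariant under the translation by [h], so the coefficient of [h] in its expansion,
    which is [- 2 * c * S1 c], has to vanish. *)
Let S1_0 c : 0 < c -> S1 c = 0.
Proof.
move=> c0; pose K := 16 / (c / 2) ^+ 2 * \int[mu1]_r `|gauss c 0 r * expR (c / 2 * (1 +
    r ^+ 2))|.
have K0 : 0 <= K.
  by rewrite mulr_ge0 ?divr_ge0 ?sqr_ge0//; apply: Rintegral_ge0.
(* [L * h] bounds the variation of the exponent; the factor [c / 4 / L] in [h] keeps it below half
   of the spare exponent [c / 2]. *)
have [L LE] : exists L, L = 3 * c by eexists.
apply: (@ae_eq_small _ ((K * (L * (c / 4 / L)) ^+ 2 + c * gauss_mass c * (c / 4 / L) ^+ 2)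
  / (2 * c * (c / 4 / L)))) => e e0 e1.
have L0 : 0 < L by rewrite LE; lra.
have [h hE] : exists h, h = e * (c / 4 / L) by eexists.
have h0 : 0 < h by rewrite hE mulr_gt0 ?divr_gt0.
have h1 : h <= 1.
  rewrite hE LE; have -> : c / 4 / (3 * c) = 12^-1 by field; rewrite gt_eqF.
  lra.
have m1 := measurable_gauss c 0.
pose xi r : R := - (2 * c * h * r) - c * h ^+ 2.
have mxi : measurable_fun [set: RB] xi.
  by apply: measurable_funB => //; apply: measurable_funN; exact: measurable_funM.
have q0 (r : R) : 0 <= 1 + r ^+ 2 by rewrite addr_ge0 ?sqr_ge0.
have hx r : `|xi r| <= (L * h) * (1 + r ^+ 2).
  have rr : `|r| <= 1 + r ^+ 2.
    have : 0 <= (`|r| - 1) ^+ 2 by exact: sqr_ge0.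
    rewrite -[r ^+ 2]real_normK ?num_real//; have := normr_ge0 r; nra.
  apply: le_trans (ler_normB _ _) _; rewrite normrN.
  have -> : `|2 * c * h * r| = 2 * c * h * `|r|.
    by rewrite normrM ger0_norm// !mulr_ge0 ?ltW//.
  have -> : `|c * h ^+ 2| = c * h ^+ 2 by rewrite ger0_norm// mulr_ge0 ?sqr_ge0// ltW.
  have : c * h ^+ 2 <= c * h * (1 + r ^+ 2).
    rewrite expr2 mulrA; apply: ler_wpM2l; first by rewrite mulr_ge0 ?ltW.
    by apply: (le_trans h1); rewrite lerDl sqr_ge0.
  have : 2 * c * h * `|r| <= 2 * c * h * (1 + r ^+ 2).
    by apply: ler_wpM2l => //; rewrite !mulr_ge0 ?ltW.
  rewrite LE; lra.
have Lh : L * h <= c / 2 / 2.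
  rewrite hE mulrCA; have -> : L * (c / 4 / L) = c / 4 by field; rewrite gt_eqF.
  nra.
have iwx : mu1.-integrable setT (EFin \o (fun r => gauss c 0 r * xi r)).
  have i1 := integrableZl measurableT (- (2 * c * h)) (iS c0 (@measurable_id _ _ _)
     (fun r => _ : `|idfun r| <= 1 + r ^+ 2)).
  have i2 := integrableZl measurableT (c * h ^+ 2) (integrable_gauss 0 c0).
  have rr r : `|idfun r| <= 1 + r ^+ 2 :> R.
    rewrite /=; have : 0 <= (`|r| - 1) ^+ 2 by exact: sqr_ge0.
    rewrite -[r ^+ 2]real_normK ?num_real//; have := normr_ge0 r; nra.
  have := integrableB measurableT (i1 rr) i2; apply: eq_integrable => // r _.
  by rewrite /= -!EFinM -EFinB /xi; congr EFin; ring.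
have c20 : 0 < c / 2 by rewrite divr_gt0.
have Lh0 : 0 <= L * h by rewrite mulr_ge0// ltW.
have := integral_exp_expansion m1 mxi c20 Lh0 Lh q0 hx (dom c0) iwx.
have -> : \int[mu1]_r (gauss c 0 r * expR (xi r)) = gauss_mass c.
  rewrite -(@Rintegral_gauss c (- h))//; apply: eq_Rintegral => r _.
  by rewrite /gauss -expRD /xi; congr expR; ring.
rewrite Rintegral_gauss// subrr sub0r normrN.
have -> : \int[mu1]_r (gauss c 0 r * xi r) = - (2 * c * h) * S1 c - c * h ^+ 2 * gauss_mass c.
  rewrite -(Rintegral_gauss 0 c0) -RintegralZl//; last first.
    apply: (iS c0 (@measurable_id _ _ _)) => r /=.
    have : 0 <= (`|r| - 1) ^+ 2 by exact: sqr_ge0.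
    rewrite -[r ^+ 2]real_normK ?num_real//; have := normr_ge0 r; nra.
  rewrite -RintegralZl//; last exact: integrable_gauss.
  rewrite -RintegralB//.
  - by apply: eq_Rintegral => r _; rewrite /xi; ring.
  - have := integrableZl measurableT (- (2 * c *
      h)) (iS c0 (@measurable_id _ _ _) (fun r => _)).
    apply => r /=; have : 0 <= (`|r| - 1) ^+ 2 by exact: sqr_ge0.
    rewrite -[r ^+ 2]real_normK ?num_real//; have := normr_ge0 r; nra.
  - exact: (integrableZl measurableT (c * h ^+ 2) (integrable_gauss 0 c0)).
move=> hh; have ch : 0 < 2 * c * h by rewrite !mulr_gt0.
have : 2 * c * h * `|S1 c| <= (L * h) ^+ 2 * K + c * h ^+ 2 * gauss_mass c.
  have -> : 2 * c * h * `|S1 c| = `|- (2 * c * h) * S1 c|.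
    by rewrite normrM normrN (ger0_norm (ltW ch)).
  rewrite -[X in `|X|](subrK (c * h ^+ 2 * gauss_mass c)).
  apply: le_trans (ler_normD _ _) _; apply: lerD => //.
  rewrite ger0_norm//; apply: mulr_ge0; last by rewrite ltW ?gauss_mass_gt0.
  by apply: mulr_ge0; [exact: ltW|exact: sqr_ge0].
rewrite mulrC -ler_pdivlMr// => /le_trans; apply.
rewrite le_eqVlt; apply/orP; left; apply/eqP; rewrite hE.
by field; rewrite !gt_eqF.
Qed.

(** The dilation by [1 + h] divides the mass by [1 + h]; comparing the coefficients of [h] gives
    [2 * c * S2 c = gauss_mass c]. *)
Let S2E c : 0 < c -> S2 c = gauss_mass c / (2 * c).
Proof.
move=> c0; pose K := 16 / (c / 2) ^+ 2 * \int[mu1]_r `|gauss c 0 r * expR (c / 2 * (1 +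
    r ^+ 2))|.
have K0 : 0 <= K.
  by rewrite mulr_ge0 ?divr_ge0 ?sqr_ge0//; apply: Rintegral_ge0.
suff e0 : 2 * c * S2 c - gauss_mass c = 0.
  have <- : 2 * c * S2 c = gauss_mass c by lra.
  by field; rewrite gt_eqF.
have m1 := measurable_gauss c 0.
have m2 : measurable_fun [set: RB] (fun r : R => r ^+ 2 : R) by exact: measurable_funX.
have i2 : mu1.-integrable setT (EFin \o (fun r => gauss c 0 r * r ^+ 2)).
  by apply: iS => // r; rewrite ger0_norm ?sqr_ge0// lerDr.
pose B := (3 * c) ^+ 2 * K + gauss_mass c + c * `|S2 c|.
apply: (@ae_eq_small _ (B / 12)) => e e0 e1.
(* The factor 12 makes [3 * c * h], which bounds the variation of the exponent, at most [c / 4]. *)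
have [h hE] : exists h, h = e / 12 by eexists.
have h0 : 0 < h by rewrite hE divr_gt0.
have h1 : h <= 12^-1 by rewrite hE; lra.
pose xi r : R := - (c * ((1 + h) ^+ 2 - 1) * r ^+ 2).
have mxi : measurable_fun [set: RB] xi.
  by apply: measurable_funN; exact: measurable_funM.
have q0 (r : R) : 0 <= 1 + r ^+ 2 by rewrite addr_ge0 ?sqr_ge0.
have u0 : 0 <= (1 + h) ^+ 2 - 1 by nra.
have u1 : (1 + h) ^+ 2 - 1 <= 3 * h by nra.
have hx r : `|xi r| <= (3 * c * h) * (1 + r ^+ 2).
  have cu : 0 <= c * ((1 + h) ^+ 2 - 1) by apply: mulr_ge0 => //; exact: ltW.
  rewrite normrN ger0_norm; last by apply: mulr_ge0 => //; exact: sqr_ge0.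
  apply: ler_pM => //; [exact: sqr_ge0| |by rewrite lerDr].
  rewrite [3 * c]mulrC -mulrA; apply: ler_wpM2l => //; exact: ltW.
have Lh : 3 * c * h <= c / 2 / 2 by nra.
have Lh0 : 0 <= 3 * c * h by rewrite !mulr_ge0 ?ltW//.
have iwx : mu1.-integrable setT (EFin \o (fun r => gauss c 0 r * xi r)).
  have := integrableZl measurableT (- (c * ((1 + h) ^+ 2 - 1))) i2.
  by apply: eq_integrable => // r _; rewrite /= -EFinM /xi; congr EFin; ring.
have c20 : 0 < c / 2 by rewrite divr_gt0.
have := integral_exp_expansion m1 mxi c20 Lh0 Lh q0 hx (dom c0) iwx.
have h10 : 0 < 1 + h by lra.
have -> : \int[mu1]_r (gauss c 0 r * expR (xi r)) = gauss_mass c / (1 + h).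
  rewrite (_ : gauss_mass c / _ = gauss_mass (c * (1 + h) ^+ 2)); last first.
    rewrite /gauss_mass sqrtrM ?ltW// sqrtr_sqr ger0_norm ?ltW//.
    by rewrite invfM mulrA.
  rewrite -(@Rintegral_gauss _ 0); last by rewrite mulr_gt0 ?exprn_gt0.
  apply: eq_Rintegral => r _; rewrite /gauss -expRD /xi; congr expR; ring.
rewrite Rintegral_gauss//.
have -> : \int[mu1]_r (gauss c 0 r * xi r) = - (c * ((1 + h) ^+ 2 - 1)) * S2 c.
  rewrite -RintegralZl//; apply: eq_Rintegral => r _; rewrite /xi; ring.
rewrite -/K => hh.
have : h * `|2 * c * S2 c - gauss_mass c| <= h * (B * h).
  have h10' : 1 + h != 0 by rewrite gt_eqF.
  have idn : h * (2 * c * S2 c - gauss_mass c) =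
     (gauss_mass c / (1 + h) - gauss_mass c - - (c * ((1 + h) ^+ 2 - 1)) * S2 c)
     - (gauss_mass c * h ^+ 2 / (1 + h) + c * S2 c * h ^+ 2) by field.
  have -> : h * `|2 * c * S2 c - gauss_mass c| = `|h * (2 * c * S2 c - gauss_mass c)|.
    by rewrite normrM (ger0_norm (ltW h0)).
  rewrite idn.
  apply: le_trans (ler_normB _ _) _.
  have z1 : `|gauss_mass c * h ^+ 2 / (1 + h) + c * S2 c * h ^+ 2| <= h * ((gauss_mass c +
      c * `|S2 c|) * h).
    apply: le_trans (ler_normD _ _) _; rewrite mulrDl mulrDr; apply: lerD.
      rewrite ger0_norm; last first.
        apply: mulr_ge0; last by rewrite invr_ge0 ltW.
        by apply: mulr_ge0; [rewrite ltW ?gauss_mass_gt0|exact: sqr_ge0].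
      rewrite ler_pdivrMr//; have := gauss_mass_gt0 c0; have := h0; rewrite expr2.
      move=> a1 a2; have := mulr_gt0 (mulr_gt0 (mulr_gt0 a2 a1) a1) a1; lra.
    rewrite normrM (ger0_norm (sqr_ge0 h)) normrM (ger0_norm (ltW c0)) expr2; lra.
  have : h * (((3 * c) ^+ 2 * K + (gauss_mass c + c * `|S2 c|)) * h) =
     (3 * c * h) ^+ 2 * K + h * ((gauss_mass c + c * `|S2 c|) * h) by ring.
  move: z1 hh; rewrite /B; lra.
rewrite ler_pM2l// => /le_trans; apply.
by rewrite hE mulrA mulrAC.
Qed.

Lemma integral_gauss_sqr c m k : 0 < c ->
  (\int[mu1]_r ((r + k) ^+ 2 * gauss c m r)%:E = (gauss_mass c * ((2 * c)^-1 + (m +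
      k) ^+ 2))%:E)%E.
Proof.
move=> c0.
have mk k' m' : measurable_fun [set: RB] (fun r => ((r + k') ^+ 2 * gauss c m' r)%:E).
  apply/measurable_EFinP; apply: measurable_funM; last exact: measurable_gauss.
  by apply: measurable_funX; exact: measurable_funD.
rewrite (@integral_translation m); [|exact: mk|]; last first.
  by move=> r; rewrite lee_fin mulr_ge0 ?sqr_ge0// ltW ?gauss_gt0.
have rr (r : R) : `|idfun r| <= 1 + r ^+ 2.
  rewrite /=; have : 0 <= (`|r| - 1) ^+ 2 by exact: sqr_ge0.
  rewrite -[r ^+ 2]real_normK ?num_real//; have := normr_ge0 r; nra.
have i1 := iS c0 (@measurable_id _ _ _) rr.
have i2 : mu1.-integrable setT (EFin \o (fun r => gauss c 0 r * r ^+ 2)).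
  have m2 : measurable_fun [set: RB] (fun r : R => r ^+ 2 : R) by exact: measurable_funX.
  by apply: iS => // r; rewrite ger0_norm ?sqr_ge0// lerDr.
have i0 := integrable_gauss 0 c0.
have iZ (g : R -> R) x : mu1.-integrable setT (EFin \o g) ->
    mu1.-integrable setT (EFin \o (fun r => x * g r)).
  by move=> ig; have := integrableZl measurableT x ig; apply: eq_integrable.
have iD (g1 g2 : R -> R) : mu1.-integrable setT (EFin \o g1) ->
    mu1.-integrable setT (EFin \o g2) ->
    mu1.-integrable setT (EFin \o (fun r => g1 r + g2 r)).
  by move=> ig1 ig2; have := integrableD measurableT ig1 ig2; apply: eq_integrable.
pose F r := gauss c 0 r * r ^+ 2 + 2 * (m + k) * (gauss c 0 r * r) + (m + k) ^+ 2 * gauss c 0 r.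
have i12 := iD _ _ i2 (iZ _ (2 * (m + k)) i1).
have iF : mu1.-integrable setT (EFin \o F) by exact: (iD _ _ i12 (iZ _ ((m + k) ^+ 2) i0)).
transitivity (\int[mu1]_r (F r)%:E)%E.
  apply: eq_integral => r _; congr EFin.
  by rewrite /F /gauss addrK subr0; ring.
rewrite -(fineK (integrable_fin_num measurableT iF)); congr EFin.
rewrite -[LHS]/(\int[mu1]_r F r) /F RintegralD//; last exact: iZ.
rewrite RintegralD//; last exact: iZ.
rewrite !RintegralZl// Rintegral_gauss// -/(S1 c) -/(S2 c) S1_0// S2E//.
by field; rewrite gt_eqF.
Qed.

End gaussian_moments.

(** * Midpoint log-concave continuous functions are quasi-concave *)

Section quasiconcave.
Context {R : realType}.

(** Otherwise the minimum over [[u, w]] is attained only inside. At the leftmost minimiser [t] the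
    value at [t - e] is strictly larger and the value at [t + e] no smaller, against midpoint
    log-concavity. *)
Lemma midpoint_quasiconcave (D : R -> R) : continuous D -> (forall r, 0 < D r) ->
  (forall r s, D r * D s <= D ((r + s) / 2) ^+ 2) ->
  forall u x w, u <= x -> x <= w -> Num.min (D u) (D w) <= D x.
Proof.
move=> cD D0 Dmid u x w ux xw; rewrite leNgt; apply/negP => Dx.
have uw := le_trans ux xw.
have [c cuw cmin] := EVT_min uw (continuous_subspaceT cD).
pose S := `[u, w] `&` D @^-1` [set y | y <= D c].
have cS : compact S.
  apply: compact_closedI; first exact: segment_compact.
  by apply: closed_comp => [y _|]; [exact: cD|exact: closed_le].
have S0 : S !=set0 by exists c; split => /=.
have cid : {within S, continuous (id : R -> R)} by apply: continuous_subspaceT => y;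
    exact: cvg_id.
have [t + tmin] := compact_EVT_min S0 cS cid.
rewrite inE => -[/=]; rewrite in_itv/= => /andP[ut tw] Dt.
have Dcx : D c <= D x by apply: cmin; rewrite in_itv/= ux xw.
move: Dx; rewrite lt_min => /andP[Dxu Dxw].
have ut' : u < t.
  rewrite lt_neqAle ut andbT; apply/eqP => e; move: Dxu; rewrite e ltNge.
  by rewrite (le_trans Dt Dcx).
have tw' : t < w.
  rewrite lt_neqAle tw andbT; apply/eqP => e; move: Dxw; rewrite -e ltNge.
  by rewrite (le_trans Dt Dcx).
pose e := Num.min (t - u) (w - t).
have e0 : 0 < e by rewrite lt_min !subr_gt0 ut' tw'.
have eu : e <= t - u by rewrite ge_min lexx.
have ew : e <= w - t by rewrite ge_min lexx orbT.
have h1 : D c < D (t - e).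
  rewrite ltNge; apply/negP => h.
  have : t <= t - e.
    by apply: tmin; rewrite inE; split => //=; rewrite in_itv/=; apply/andP; split; lra.
  lra.
have h2 : D c <= D (t + e) by apply: cmin; rewrite in_itv/=; apply/andP; split; lra.
have := Dmid (t - e) (t + e); rewrite (_ : (_ + _) / 2 = t); last by field.
have := D0 t; have := D0 c; nra.
Qed.

End quasiconcave.

(** * Strict comparison of a variance with that of a Gaussian factor *)

Section gaussian_comparison.
Context {R : realType}.
Local Notation RB := (measurableTypeR R).
Local Notation mu1 := (@lebesgue_measure R).

Lemma Rintegral_gt0 (g : R -> R) (u v : R) : u < v ->
  mu1.-integrable setT (EFin \o g) -> (forall r, 0 <= g r) ->
  (forall r, u < r -> r < v -> 0 < g r) -> 0 < \int[mu1]_r g r.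
Proof.
move=> uv ig g0 guv; rewrite lt_neqAle; apply/andP; split; last exact: Rintegral_ge0.
apply/eqP => e0.
have ig0 : (\int[mu1]_r (g r)%:E = 0)%E.
  by rewrite -(fineK (integrable_fin_num measurableT ig)); congr EFin.
have g0' (r : RB) : (0 <= (g r)%:E)%E by rewrite lee_fin.
have := ge0_integral_eq0 (measurable_int mu1 ig) g0' ig0 => ae0.
have muv : (0 < mu1 `]u, v[)%E.
  by rewrite lebesgue_measure_itv/= lte_fin uv -EFinD lte_fin subr_gt0.
have [r [/=]] := nonnull_ae_nonempty muv (measurable_itv _) ae0.
rewrite in_itv/= => /andP[ur rv] /eqP; rewrite eqe => /eqP gr.
by have := guv r ur rv; rewrite gr ltxx.
Qed.

(** The first moment is read off as [(Q1 - Q0 - P0) / 2] from two shifted second moments, so that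
    the data are integrals of nonnegative functions, to which Tonelli applies. *)
Lemma moments_Rintegral (p : R -> R) (P0 Q0 Q1 : R) : measurable_fun [set: RB] p ->
  (forall r, 0 <= p r) ->
  (\int[mu1]_r (p r)%:E = P0%:E)%E ->
  (\int[mu1]_r ((r + 0) ^+ 2 * p r)%:E = Q0%:E)%E ->
  (\int[mu1]_r ((r + 1) ^+ 2 * p r)%:E = Q1%:E)%E ->
  forall x y, mu1.-integrable setT (EFin \o (fun r => (r - x) * (r - y) * p r)) /\
   \int[mu1]_r ((r - x) * (r - y) * p r) = Q0 - (x + y) * ((Q1 - Q0 - P0) / 2) + x * y * P0.
Proof.
move=> mp p0 I0 I1 I2 x y.
have int (g : R -> R) (Q : R) : measurable_fun [set: RB] g -> (forall r, 0 <= g r) ->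
   (\int[mu1]_r (g r)%:E = Q%:E)%E -> mu1.-integrable setT (EFin \o g).
  move=> mg g0 gQ; apply/integrableP; split; first exact/measurable_EFinP.
  rewrite (eq_integral (fun r : RB => (g r)%:E)); first by rewrite gQ ltry.
  by move=> r _; rewrite gee0_abs// lee_fin.
have mk k : measurable_fun [set: RB] (fun r : R => (r + k) ^+ 2 * p r).
  by apply: measurable_funM => //; apply: measurable_funX; exact: measurable_funD.
have k0 k r : 0 <= (r + k) ^+ 2 * p r by rewrite mulr_ge0 ?sqr_ge0.
have i0 := int _ _ mp p0 I0.
have i1 := int _ _ (mk 0) (k0 0) I1.
have i2 := int _ _ (mk 1) (k0 1) I2.
have iZ (g : R -> R) z : mu1.-integrable setT (EFin \o g) ->
    mu1.-integrable setT (EFin \o (fun r => z * g r)).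
  by move=> ig; have := integrableZl measurableT z ig; apply: eq_integrable.
have iD (g1 g2 : R -> R) : mu1.-integrable setT (EFin \o g1) ->
    mu1.-integrable setT (EFin \o g2) ->
    mu1.-integrable setT (EFin \o (fun r => g1 r + g2 r)).
  by move=> ig1 ig2; have := integrableD measurableT ig1 ig2; apply: eq_integrable.
pose F r := (1 + (x + y) / 2) * ((r + 0) ^+ 2 * p r) + - ((x + y) / 2) * ((r + 1) ^+ 2 * p r)
  + (x * y + (x + y) / 2) * p r.
have iF1 := iD _ _ (iZ _ (1 + (x + y) / 2) i1) (iZ _ (- ((x + y) / 2)) i2).
have iF : mu1.-integrable setT (EFin \o F).
  exact: (iD _ _ iF1 (iZ _ (x * y + (x + y) / 2) i0)).
have FE : (fun r => (r - x) * (r - y) * p r) = F.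
  by apply/funext => r; rewrite /F; field.
rewrite FE; split => //; rewrite /F RintegralD//; last exact: iZ.
rewrite RintegralD//; [|exact: iZ|exact: iZ].
rewrite !RintegralZl// /Rintegral I0 I1 I2/=; by field.
Qed.

(* Compare [D r * gauss c m r] with the Gaussian [k * gauss c m r] of the same mass and mean:
   the sign of the difference is -, +, -, hence the sign of its second moment. *)
Lemma variance_lt (D : R -> R) (c m P0 Q0 Q1 : R) : 0 < c -> continuous D ->
  (forall r, 0 < D r) ->
  (forall r s, D r * D s <= D ((r + s) / 2) ^+ 2) ->
  (forall e, 0 < e -> exists b, forall r, b < `|r| -> D r < e) ->
  (\int[mu1]_r (D r * gauss c m r)%:E = P0%:E)%E ->
  (\int[mu1]_r ((r + 0) ^+ 2 * (D r * gauss c m r))%:E = Q0%:E)%E ->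
  (\int[mu1]_r ((r + 1) ^+ 2 * (D r * gauss c m r))%:E = Q1%:E)%E ->
  (Q1 - Q0 - P0) / 2 = m * P0 ->
  Q0 < P0 * (m ^+ 2 + (2 * c)^-1).
Proof.
move=> c0 cD D0 Dmid Dinf I0 I1 I2 mean.
have mD : measurable_fun [set: RB] D by exact: continuous_measurable_fun.
have mG := measurable_gauss c m.
have mp : measurable_fun [set: RB] (fun r => D r * gauss c m r) by exact: measurable_funM.
have p0 r : 0 <= D r * gauss c m r by apply: mulr_ge0; apply: ltW => //; exact: gauss_gt0.
have z0 := gauss_mass_gt0 c0.
pose k := P0 / gauss_mass c.
have mq : measurable_fun [set: RB] (fun r => k * gauss c m r) by exact: measurable_funM.
have P00 : 0 <= P0 by rewrite -lee_fin -I0; apply: integral_ge0 => r _; rewrite lee_fin.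
have k0 : 0 <= k by rewrite divr_ge0// ltW.
have q0 r : 0 <= k * gauss c m r by apply: mulr_ge0 => //; apply: ltW; exact: gauss_gt0.
have J0 : (\int[mu1]_r (k * gauss c m r)%:E = P0%:E)%E.
  under eq_integral do rewrite EFinM.
  rewrite ge0_integralZl_EFin//.
  - by rewrite integral_gauss// -EFinM /k divfK// gt_eqF.
  - by move=> r _; rewrite lee_fin ltW ?gauss_gt0.
  - exact/measurable_EFinP.
have Jk l : (\int[mu1]_r ((r + l) ^+ 2 * (k * gauss c m r))%:E =
    (P0 * ((2 * c)^-1 + (m + l) ^+ 2))%:E)%E.
  rewrite (eq_integral (fun r : RB => k%:E * (((r : R) + l) ^+ 2 * gauss c m r)%:E)%E);
      last first.
    by move=> r _; rewrite -EFinM; congr EFin; ring.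
  rewrite ge0_integralZl_EFin//; last 2 first.
  - by move=> r _; rewrite lee_fin mulr_ge0 ?sqr_ge0// ltW ?gauss_gt0.
  - apply/measurable_EFinP; apply: measurable_funM => //.
    by apply: measurable_funX; exact: measurable_funD.
  by rewrite integral_gauss_sqr// -EFinM mulrA /k divfK// gt_eqF.
have Mp := moments_Rintegral mp p0 I0 I1 I2.
have Mq := moments_Rintegral mq q0 J0 (Jk 0) (Jk 1).
(* Since mass and mean agree, the value does not depend on the roots [x] and [y]; it remains to
   place them where the difference changes sign. *)
have diff x y : mu1.-integrable setT (EFin \o
      (fun r => (r - x) * (r - y) * (k * gauss c m r) - (r - x) * (r - y) * (D r *
          gauss c m r))) /\
    \int[mu1]_r ((r - x) * (r - y) * (k * gauss c m r) - (r - x) * (r - y) * (D r *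
        gauss c m r)) =
    P0 * (m ^+ 2 + (2 * c)^-1) - Q0.
  have [ip ep] := Mp x y; have [iq eq] := Mq x y; split.
    by have := integrableB measurableT iq ip; apply: eq_integrable.
  rewrite RintegralB// ep eq mean; set i := (2 * c)^-1; by field.
suff [x [y [u [v [uv ge gt]]]]] : exists x y u v, [/\ u < v,
    forall r, 0 <= (r - x) * (r - y) * (k - D r) &
    forall r, u < r -> r < v -> 0 < (r - x) * (r - y) * (k - D r)].
  have [id ed] := diff x y.
  rewrite -subr_gt0 -ed; apply: (Rintegral_gt0 uv id) => r.
    by rewrite -mulrBr -mulrBl mulrA; apply: mulr_ge0 (ge r) _; apply/ltW/gauss_gt0.
  move=> ur rv; rewrite -mulrBr -mulrBl mulrA mulr_gt0 ?gauss_gt0//; exact: gt.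
have kpos : 0 < k.
  rewrite divr_gt0// -lte_fin -I0.
  have i0 : mu1.-integrable setT (EFin \o (fun r => D r * gauss c m r)).
    apply/integrableP; split; first exact/measurable_EFinP.
    rewrite (eq_integral (fun r : RB => (D r * gauss c m r)%:E)); first by rewrite I0 ltry.
    by move=> r _; rewrite gee0_abs// lee_fin.
  rewrite -(fineK (integrable_fin_num measurableT i0)) lte_fin.
  apply: (Rintegral_gt0 ltr01 i0 p0) => r _ _; by rewrite mulr_gt0 ?gauss_gt0.
have [b hb] := Dinf k kpos.
(* If [D] never exceeded [k], the Gaussian would have strictly more mass, because [D < k] far
   out. *)
have [[r0 hr0]|hD] := pselect (exists r0, k < D r0); last first.
  exfalso.
  have Dk r : D r <= k by rewrite leNgt; apply/negP => h; apply: hD; exists r.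
  have ip : mu1.-integrable setT (EFin \o (fun r => k * gauss c m r - D r * gauss c m r)).
    have fin (g : R -> R) : measurable_fun [set: RB] g -> (forall r, 0 <= g r) ->
       (\int[mu1]_r (g r)%:E = P0%:E)%E -> mu1.-integrable setT (EFin \o g).
      move=> mg g0 gQ; apply/integrableP; split; first exact/measurable_EFinP.
      rewrite (eq_integral (fun r : RB => (g r)%:E)); first by rewrite gQ ltry.
      by move=> r _; rewrite gee0_abs// lee_fin.
    have := integrableB measurableT (fin _ mq q0 J0) (fin _ mp p0 I0).
    by apply: eq_integrable.
  have : 0 < \int[mu1]_r (k * gauss c m r - D r * gauss c m r).
    apply: (@Rintegral_gt0 _ `|b| (`|b| + 1)) => //; first by rewrite ltrDl.
      by move=> r; rewrite -mulrBl mulr_ge0 ?subr_ge0// ltW ?gauss_gt0.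
    move=> r br _; rewrite -mulrBl mulr_gt0 ?gauss_gt0// subr_gt0; apply: hb.
    by apply: le_lt_trans (ler_norm b) _; apply: lt_le_trans br (ler_norm _).
  suff -> : \int[mu1]_r (k * gauss c m r - D r * gauss c m r) = 0 by rewrite ltxx.
  rewrite RintegralB//.
  - by rewrite /Rintegral J0 I0 subrr.
  - apply/integrableP; split; first exact/measurable_EFinP.
    rewrite (eq_integral (fun r : RB => (k * gauss c m r)%:E)); first by rewrite J0 ltry.
    by move=> r _; rewrite gee0_abs// lee_fin.
  - apply/integrableP; split; first exact/measurable_EFinP.
    rewrite (eq_integral (fun r : RB => (D r * gauss c m r)%:E)); first by rewrite I0 ltry.
    by move=> r _; rewrite gee0_abs// lee_fin.
(* Beyond [L] on either side [D < k], while [k < D r0] inside: the intermediate value theorem gives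
   a crossing on each side of [r0]. *)
pose L := `|b| + `|r0| + 1.
have Lb r : L <= `|r| -> D r < k.
  move=> Lr; apply: hb; apply: lt_le_trans Lr; rewrite /L.
  have := ler_norm b; have := normr_ge0 r0; lra.
have L0 : 0 < L by rewrite /L; have := normr_ge0 b; have := normr_ge0 r0; lra.
have r0L : r0 < L by rewrite /L; have := normr_ge0 b; have := ler_norm r0; lra.
have Lr0 : - L < r0.
  by rewrite /L; have := normr_ge0 b; have := ler_norm (- r0); rewrite normrN; lra.
have [be bet Db] : exists2 be, be \in `[r0, L] & D be = k.
  apply: IVT; [exact: ltW|exact: continuous_subspaceT|].
  have := Lb L; rewrite (ger0_norm (ltW L0)) => /(_ (lexx _)) hL.
  by rewrite ge_min le_max (ltW hL) (ltW hr0) orbT.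
have [al alt Da] : exists2 al, al \in `[- L, r0] & D al = k.
  apply: IVT; [exact: ltW|exact: continuous_subspaceT|].
  have := Lb (- L); rewrite normrN (ger0_norm (ltW L0)) => /(_ (lexx _)) hL.
  by rewrite ge_min le_max (ltW hL) (ltW hr0) orbT.
move: bet alt; rewrite !in_itv/= => /andP[r0b bL] /andP[La ar0].
have qc := midpoint_quasiconcave cD D0 Dmid.
have inside r : al <= r -> r <= be -> k <= D r.
  by move=> h1 h2; have := qc _ _ _ h1 h2; rewrite Da Db minxx.
have right r : be <= r -> D r <= k.
  move=> h; rewrite leNgt; apply/negP => hr.
  have := qc _ _ _ r0b h; by rewrite Db ge_min => /orP[]; rewrite leNgt ?hr ?hr0.
have left r : r <= al -> D r <= k.
  move=> h; rewrite leNgt; apply/negP => hr.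
  have := qc _ _ _ h ar0; by rewrite Da ge_min => /orP[]; rewrite leNgt ?hr ?hr0.
(* On []L, L + 1[] the integrand is positive, which makes the final inequality strict. *)
exists al, be, L, (L + 1); split; first by rewrite ltrDl.
- move=> r; have [h1|h1] := leP r al.
    apply: mulr_ge0; last by rewrite subr_ge0 left.
    by apply: mulr_le0; rewrite subr_le0// (le_trans h1)// (le_trans ar0).
  have [h2|h2] := leP r be.
    apply: mulr_le0; last by rewrite subr_le0 inside// ltW.
    by apply: mulr_ge0_le0; rewrite ?subr_ge0 ?subr_le0// ltW.
  apply: mulr_ge0; last by rewrite subr_ge0 right// ltW.
  by apply: mulr_ge0; rewrite subr_ge0 ltW.
- move=> r h1 _; have hr : D r < k by apply: Lb; apply: le_trans (ltW h1) (ler_norm _).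
  by rewrite !mulr_gt0// subr_gt0//; lra.
Qed.

End gaussian_comparison.

(** * Variance of the tilted measure in a unit direction *)

Section marginal.
Context {R : realType} {n : nat}.
Local Notation RB := (measurableTypeR R).
Local Notation lebn := (@lebn R).
Local Notation mu1 := (@lebesgue_measure R).
Local Notation T := (n.-tuple RB).
Local Notation Y := (@row_of_tuple R n).

Lemma row_of_tuple_reflection (x z : T) : Y (reflection x z) = 2 *: Y z - Y x.
Proof. by apply/rowP => i; rewrite !mxE tnth_mktuple. Qed.

Lemma edot_unit_sqr_le (v e : 'rV[R]_n) : edot v v = 1 -> edot v e ^+ 2 <= edot e e.
Proof.
move=> v1; have := edotxx_ge0 (e - edot v e *: v).
rewrite !(edotBl, edotBr, edotZl, edotZr) v1 (edotC e v); lra.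
Qed.

Variable f : T -> R.
Hypothesis mf : measurable_fun setT f.
Hypothesis f0 : forall y, 0 <= f y.
Hypothesis f_decay : forall A, exists C, forall y, f y <= C * expR (- (A * ell (Y y))).
Hypothesis f_mass : (0 < \int[lebn n]_y (f y)%:E)%E.
Hypothesis f_lc : forall x, \forall z \ae lebn n, f x * f (reflection x z) <= f z * f z.

Variables (a : R) (b v : 'rV[R]_n).
Hypothesis a0 : 0 < a.
Hypothesis v1 : edot v v = 1.

Let s (y : T) := edot v (Y y).
(** Multiplied by [expR (- (2 * a * r ^+ 2))] it becomes [weight a b y * gauss (4 * a) (s y / 2) r];
    smoothing in [r] replaces integrals over the hyperplanes orthogonal to [v] by integrals over the
    whole space. The exponent is jointly concave in [r] and [y], as Prekopa-Leindler requires. *)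
Let q (r : R) (y : T) := expR (edot b (Y y) - a * (edot (Y y) (Y y) - s y ^+ 2)
  - 2 * a * (r - s y) ^+ 2).
(* [M r * expR (- (2 * a * r ^+ 2))] is, up to a constant, the density of the law of [s / 2]
   under the tilted measure convolved with the centred Gaussian of variance [1 / (8 * a)]. *)
Let M (r : R) := moment f (q r).

Let exp_bounded_s : exp_bounded s. Proof. exact: exp_bounded_edot. Qed.

Let exp_bounded_ss : exp_bounded (fun y => s y ^+ 2).
Proof. by rewrite (_ : (fun y => _) = (fun y => s y * s y))//; exact: exp_bounded_mul. Qed.

Let exp_bounded_rs (r : R) : exp_bounded (fun y => (r - s y) ^+ 2).
Proof.
rewrite (_ : (fun y => _) = (fun y => (r - s y) * (r - s y)))//.
by apply: exp_bounded_mul; apply: exp_bounded_sub => //; exact: exp_bounded_cst.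
Qed.

Let exp_bounded_q r : exp_bounded (q r).
Proof.
apply: (@exp_bounded_expR _ _ _ (ell b)); last 2 first.
- exact: ell_ge0.
- move=> y; apply: (@le_trans _ _ (edot b (Y y))); last first.
    by apply: le_trans (ler_norm _) _; exact: normr_edot_le.
  have := edot_unit_sqr_le (Y y) v1; have := sqr_ge0 (r - s y); rewrite -/(s y).
  have := a0; nra.
- have h : exp_bounded (fun y => edot b (Y y) - a * (edot (Y y) (Y y) - s y ^+ 2) -
      2 * a * (r - s y) ^+ 2).
    apply: exp_bounded_sub; last by apply: exp_bounded_mul => //; exact: exp_bounded_cst.
    apply: exp_bounded_sub; first exact: exp_bounded_edot.
    by apply: exp_bounded_mul; [exact: exp_bounded_cst|apply: exp_bounded_sub => //;
        exact: exp_bounded_sq].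
  exact: h.1.
Qed.

Let q_gt0 r y : 0 < q r y. Proof. exact: expR_gt0. Qed.

Let M_gt0 r : 0 < M r. Proof. exact: moment_gt0. Qed.

Let ME r : (\int[lebn n]_y (q r y * f y)%:E = (M r)%:E)%E.
Proof. by rewrite fineK//; exact: (integrable_fin_num _ (exp_bounded_int mf f0 f_decay
    (exp_bounded_q r))). Qed.

Let M_lc r r' : M r * M r' <= M ((r + r') / 2) ^+ 2.
Proof.
pose m := (r + r') / 2; rewrite -/m expr2.
suff : (\int[lebn n]_y (q r y * f y)%:E * \int[lebn n]_y (q r' y * f y)%:E <=
  \int[lebn n]_y (q m y * f y)%:E * \int[lebn n]_y (q m y * f y)%:E)%E.
  by rewrite !ME -!EFinM lee_fin.
have mqf u : measurable_fun setT (fun y => (q u y * f y)%:E).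
  by apply/measurable_EFinP; apply: measurable_funM => //; exact: (exp_bounded_q u).1.
apply: prekopa_leindler_ae => // [x|x|x|x].
- by rewrite lee_fin mulr_ge0// ltW.
- by rewrite lee_fin mulr_ge0// ltW.
- by rewrite lee_fin mulr_ge0// ltW.
- have := f_lc x; apply: filterS => z h.
  rewrite -!EFinM lee_fin mulrACA [leRHS]mulrACA.
  apply: ler_pM; rewrite ?mulr_ge0 ?(ltW (q_gt0 _ _))//.
  rewrite /q -!expRD ler_expR /s row_of_tuple_reflection.
  have e := edot_unit_sqr_le (Y x - Y z) v1.
  move: e; rewrite !(edotBl, edotBr, edotZl, edotZr) (edotC (Y z) (Y x)).
  set xx := edot (Y x) (Y x); set xz := edot (Y x) (Y z); set zz := edot (Y z) (Y z).
  set sx := edot v (Y x); set sz := edot v (Y z).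
  set bx := edot b (Y x); set bz := edot b (Y z).
  move=> e; rewrite -subr_ge0.
  (* The gap between twice the exponent at the midpoint and the sum of the two exponents is a sum of
     two nonnegative terms, the first by [edot_unit_sqr_le] at [Y x - Y z]. *)
  have -> : bz - a * (zz - sz ^+ 2) - 2 * a * ((r + r') / 2 - sz) ^+ 2 +
    (bz - a * (zz - sz ^+ 2) - 2 * a * ((r + r') / 2 - sz) ^+ 2) -
    (bx - a * (xx - sx ^+ 2) - 2 * a * (r - sx) ^+ 2 +
    (2 * bz - bx - a * (2 * (2 * zz - xz) - (2 * xz - xx) - (2 * sz - sx) ^+ 2) -
     2 * a * (r' - (2 * sz - sx)) ^+ 2)) =
    2 * a * ((xx - xz - (xz - zz)) - (sx - sz) ^+ 2) +
    4 * a * ((r - r') / 2 - (sx - sz)) ^+ 2 by field.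
  rewrite addr_ge0// mulr_ge0 ?sqr_ge0 ?subr_ge0//; apply: mulr_ge0 => //; exact: ltW.
Qed.

Let K1 := moment f (fun y => expR (ell b * ell (Y y))).
Let K2 := moment f (fun y => `|s y| * expR (ell b * ell (Y y))).

Let exp_bounded_abs_s : exp_bounded (fun y => `|s y|).
Proof.
have [m [C [B [C0 B0 h]]]] := exp_bounded_s; split; first exact: measurableT_comp.
by exists C, B; split => // y; rewrite normr_id.
Qed.

Let expR_lip (x y u : R) : x <= u -> y <= u -> expR x - expR y <= `|x - y| * expR u.
Proof.
move=> xu yu; have [xy|yx] := leP x y.
  apply: (@le_trans _ _ 0); first by rewrite subr_le0 ler_expR.
  by rewrite mulr_ge0// expR_ge0.
rewrite ger0_norm ?subr_ge0 ?(ltW yx)//.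
apply: (@le_trans _ _ ((x - y) * expR x));
    last by rewrite ler_wpM2l ?subr_ge0 ?(ltW yx)// ler_expR.
have := expR_ge1Dx (y - x); rewrite -(ler_pM2r (expR_gt0 x)) -expRD subrK; lra.
Qed.

(** The exponents are bounded by [ell b * ell (Y y)] uniformly in [r], so the constants [K1] and
    [K2] serve for all [r] and [M] is locally Lipschitz. *)
Let M_lip r r' : M r - M r' <= 2 * a * `|r - r'| * (`|r + r'| * K1 + 2 * K2).
Proof.
have aE : exp_bounded (fun y => expR (ell b * ell (Y y))) by apply: exp_bounded_exp_ell;
    exact: ell_ge0.
have asE : exp_bounded (fun y => `|s y| * expR (ell b * ell (Y y))) by exact: exp_bounded_mul.
rewrite -(moment_scale mf f0 f_decay _ aE) -(moment_scale mf f0 f_decay _ asE).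
have a1 : exp_bounded (fun y => `|r + r'| * expR (ell b * ell (Y y))).
  by apply: exp_bounded_mul => //; exact: exp_bounded_cst.
have a2 : exp_bounded (fun y => 2 * (`|s y| * expR (ell b * ell (Y y)))).
  by apply: exp_bounded_mul => //; exact: exp_bounded_cst.
have a3 := exp_bounded_add a1 a2.
rewrite -(moment_add mf f0 f_decay a1 a2) -(moment_scale mf f0 f_decay _ a3) -(moment_sub
    mf f0 f_decay (exp_bounded_q r) (exp_bounded_q r')).
apply: (moment_le mf f0 f_decay) => [||y].
- exact: exp_bounded_sub.
- by apply: exp_bounded_mul => //; exact: exp_bounded_cst.
have qle u : edot b (Y y) - a * (edot (Y y) (Y y) - s y ^+ 2) - 2 * a * (u - s y) ^+ 2 <=
    ell b * ell (Y y).
  apply: (@le_trans _ _ (edot b (Y y))); last first.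
    by apply: le_trans (ler_norm _) _; exact: normr_edot_le.
  have := edot_unit_sqr_le (Y y) v1; have := sqr_ge0 (u - s y); rewrite -/(s y).
  have := a0; nra.
apply: le_trans (expR_lip (qle r) (qle r')) _.
rewrite mulrA -mulrDl [leRHS]mulrA ler_wpM2r ?expR_ge0//.
rewrite (_ : _ - _ - (_ - _) = - ((2 * a) * ((r - r') * ((r + r') - 2 * s y)))); last by ring.
rewrite normrN !normrM (ger0_norm (ltW a0)) -mulrA -mulrA.
rewrite (ger0_norm (ler0n _ 2)) -!mulrA.
rewrite ler_wpM2l// ler_wpM2l// ?(ltW a0)// ler_wpM2l//.
apply: le_trans (ler_normB _ _) _; rewrite normrM.
by rewrite (ger0_norm (ler0n _ 2)).
Qed.

Let M_continuous : continuous M.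
Proof.
have K10 : 0 <= K1.
  apply: ltW; apply: moment_gt0 => // [|y]; last exact: expR_gt0.
  by apply: exp_bounded_exp_ell; exact: ell_ge0.
have K20 : 0 <= K2.
  by apply: Rintegral_ge0 => y _; rewrite !mulr_ge0 ?expR_ge0.
move=> r; apply/cvgrPdist_lt => e e0.
pose L := 2 * a * ((2 * `|r| + 1) * K1 + 2 * K2) + 1.
have L0 : 0 < L.
  by rewrite ltr_wpDl// !mulr_ge0 ?addr_ge0 ?mulr_ge0 ?addr_ge0 ?mulr_ge0// ltW.
have h : forall r1 r2, `|r1 + r2| <= 2 * `|r| + 1 -> M r1 - M r2 <= L * `|r1 - r2|.
  move=> r1 r2 hr; apply: le_trans (M_lip _ _) _.
  rewrite mulrAC ler_wpM2r// /L.
  apply: (@le_trans _ _ (2 * a * ((2 * `|r| + 1) * K1 + 2 * K2))); last by rewrite lerDl.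
  by rewrite ler_wpM2l ?mulr_ge0 ?(ltW a0)// lerD2r ler_wpM2r.
near=> u.
have ur : `|r - u| < Num.min 1 (e / L).
  by near: u; apply: cvgr_dist_lt; rewrite // lt_min ltr01 divr_gt0.
move: ur; rewrite lt_min => /andP[u1 u2].
have hs : `|r + u| <= 2 * `|r| + 1.
  rewrite (_ : r + u = 2 * r - (r - u)); last by ring.
  apply: le_trans (ler_normB _ _) _; rewrite normrM (ger0_norm (ler0n _ 2)).
  by rewrite lerD2l ltW.
have h1 := h _ _ hs; have := h u r; rewrite addrC distrC => /(_ hs) h2.
rewrite ltr_pdivlMr// mulrC in u2.
move: (M r) (M u) h1 h2 u2 => x1 x2 h1 h2 u2.
by rewrite lter_norml; apply/andP; split; lra.
Unshelve. all: by end_near. Qed.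

(** Completing the square in [r] costs [la ^+ 2 / (8 * a)] and turns [la * r] into [la * s y], whose
    exponential moment is finite. As [la] is arbitrary, [M] decays faster than every exponential on
    both sides. *)
Let M_decay la : exists C, forall r, M r * expR (la * r) <= C.
Proof.
have aE : exp_bounded (fun y => expR (edot b (Y y) + la * s y)).
  apply: (@exp_bounded_expR _ _ _ (ell b + `|la| * ell v)).
  - apply: measurable_funD; first exact: (exp_bounded_edot b).1.
    by apply: measurable_funM => //; exact: exp_bounded_s.1.
  - by rewrite addr_ge0 ?mulr_ge0 ?ell_ge0.
  - move=> y; rewrite mulrDl lerD//; first by apply: le_trans (ler_norm _) _;
      exact: normr_edot_le.
    apply: le_trans (ler_norm _) _; rewrite normrM -mulrA ler_wpM2l//; exact: normr_edot_le.
exists (expR (la ^+ 2 / (8 * a)) * moment f (fun y => expR (edot b (Y y) + la * s y))) => r.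
rewrite -(moment_scale mf f0 f_decay _ aE) mulrC -(moment_scale mf f0 f_decay _
    (exp_bounded_q r)).
apply: (moment_le mf f0 f_decay) => [||y].
- by apply: exp_bounded_mul => //; exact: exp_bounded_cst.
- by apply: exp_bounded_mul => //; exact: exp_bounded_cst.
rewrite /q -!expRD ler_expR -subr_ge0.
rewrite (_ : _ - _ = a * (edot (Y y) (Y y) - s y ^+ 2) +
    2 * a * ((r - s y) - la / (4 * a)) ^+ 2); last by field; rewrite !gt_eqF.
by rewrite addr_ge0// mulr_ge0 ?sqr_ge0 ?mulr_ge0 ?subr_ge0 ?edot_unit_sqr_le// ltW.
Qed.

Let measurable_s : measurable_fun [set: RB * T] (fun z => s z.2).
Proof. exact: measurableT_comp exp_bounded_s.1 measurable_snd. Qed.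

Let measurable_q2 : measurable_fun [set: RB * T] (fun z => q z.1 z.2).
Proof.
apply: measurableT_comp; first exact: measurable_expR.
apply: measurable_funB.
  have h : exp_bounded (fun y => edot b (Y y) - a * (edot (Y y) (Y y) - s y ^+ 2)).
    apply: exp_bounded_sub; first exact: exp_bounded_edot.
    by apply: exp_bounded_mul; [exact: exp_bounded_cst|apply: exp_bounded_sub => //;
        exact: exp_bounded_sq].
  exact: measurableT_comp h.1 measurable_snd.
apply: measurable_funM => //; apply: measurable_funX.
by apply: measurable_funB => //; exact: measurable_fst.
Qed.

(** Tonelli: [g] is integrated first against the Gaussian centred at [s y / 2], and [w] records the
    result. *)
Let marginal_moment (g : R -> R) (w : T -> R) : measurable_fun [set: RB] g ->
    (forall r, 0 <= g r) ->
  exp_bounded w ->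
  (forall y, \int[mu1]_r (g r * gauss (4 * a) (s y / 2) r)%:E = (gauss_mass (4 * a) *
      w y)%:E)%E ->
  (\int[mu1]_r (g r * (M r * expR (- (2 * a * r ^+ 2))))%:E = (gauss_mass (4 * a) *
      tilted_moment f w a b)%:E)%E.
Proof.
move=> mg g0 aw0 gE.
pose F (z : RB * T) : \bar R :=
  ((g z.1 * expR (- (2 * a * (z.1 : R) ^+ 2))) * (q z.1 z.2 * f z.2))%:E.
have mF : measurable_fun [set: RB * T] F.
  apply/measurable_EFinP; apply: measurable_funM.
    have h : measurable_fun [set: RB] (fun r : R => g r * expR (- (2 * a * r ^+ 2))).
      apply: measurable_funM => //.
      apply: measurableT_comp; first exact: measurable_expR.
      by apply: measurable_funN; apply: measurable_funM => //; exact: measurable_funX.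
    exact: measurableT_comp h measurable_fst.
  by apply: measurable_funM => //; exact: measurableT_comp mf measurable_snd.
have F0 z : (0 <= F z)%E.
  rewrite lee_fin; apply: mulr_ge0; first by apply: mulr_ge0; [exact: g0|exact: expR_ge0].
  by apply: mulr_ge0; [exact: expR_ge0|exact: f0].
have aw : exp_bounded (fun y => w y * weight a b y).
  by apply: exp_bounded_mul => //; apply: exp_bounded_weight; exact: ltW.
transitivity (\int[mu1]_r \int[lebn n]_y F (r, y))%E.
  apply: eq_integral => r _; rewrite mulrCA mulrC EFinM -ME -ge0_integralZl_EFin//.
  - by move=> y _; rewrite lee_fin mulr_ge0// ltW.
  - by apply/measurable_EFinP; apply: measurable_funM => //; exact: (exp_bounded_q r).1.
  - by rewrite mulr_ge0 ?expR_ge0.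
rewrite (@fubini_tonelli _ _ _ _ _ mu1 (lebn n))//.
have key (r u be e : R) : - (2 * a * r ^+ 2) + (be - a * (e - u ^+ 2) - 2 * a * (r - u) ^+ 2) =
  be - a * e + - (4 * a * (r - u / 2) ^+ 2) by field.
rewrite -(moment_scale mf f0 f_decay _ aw).
have aw' : exp_bounded (fun y => gauss_mass (4 * a) * (w y * weight a b y)).
  by apply: exp_bounded_mul => //; exact: exp_bounded_cst.
rewrite fineK ?(integrable_fin_num _ (exp_bounded_int mf f0 f_decay aw'))//.
apply: eq_integral => y _.
rewrite (eq_integral (fun r : RB => (weight a b y * f y)%:E *
    (g r * gauss (4 * a) (s y / 2) r)%:E)%E); last first.
  move=> r _; rewrite -EFinM; congr EFin.
  have -> : weight a b y * f y * (g r * gauss (4 * a) (s y / 2) r) =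
    g r * (weight a b y * gauss (4 * a) (s y / 2) r) * f y by ring.
  rewrite mulrA -[X in X * _]mulrA; congr (_ * _ * _).
  by rewrite -!expRD; congr expR; exact: key.
rewrite ge0_integralZl_EFin ?mulr_ge0 ?(ltW (weight_gt0 _ _ _))//.
- by rewrite gE -EFinM; congr EFin; ring.
- by move=> r _; rewrite lee_fin mulr_ge0// ltW ?gauss_gt0.
- by apply/measurable_EFinP; apply: measurable_funM => //; exact: measurable_gauss.
Qed.

(** [s / 2] plus an independent Gaussian of variance [1 / (8 * a)] has variance
    [Var s / 4 + 1 / (8 * a)]. [variance_lt] at [c = 2 * a] bounds this by [1 / (4 * a)], whence
    [Var s < 1 / (2 * a)]. *)
Lemma directional_variance_lt :
  tilted_moment f (fun y => s y ^+ 2) a b - tilted_moment f s a b ^+ 2 / tilted_moment f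
      (fun=> 1) a b <
  tilted_moment f (fun=> 1) a b / (2 * a).
Proof.
have a40 : 0 < 4 * a by rewrite mulr_gt0.
have z0 := gauss_mass_gt0 a40.
have I0 := tilted_moment_gt0 mf f0 f_decay f_mass b (ltW a0).
have aw := exp_bounded_weight b (ltW a0).
set I1 := tilted_moment f (fun=> 1) a b in I0 *; set Is := tilted_moment f s a b;
    set Iss := tilted_moment f _ a b.
have IE k : tilted_moment f (fun y => (8 * a)^-1 + (s y / 2 + k) ^+ 2) a b =
    Iss / 4 + k * Is + (k ^+ 2 + (8 * a)^-1) * I1.
  have A1 : exp_bounded (fun y => 1 * weight a b y) by apply: exp_bounded_mul => //;
      exact: exp_bounded_cst.
  have As : exp_bounded (fun y => s y * weight a b y) by exact: exp_bounded_mul.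
  have Ass : exp_bounded (fun y => s y ^+ 2 * weight a b y) by exact: exp_bounded_mul.
  have B c w : exp_bounded w -> exp_bounded (fun y => c * w y) by move=> h;
      apply: exp_bounded_mul => //; exact: exp_bounded_cst.
  have -> : tilted_moment f (fun y => (8 * a)^-1 + (s y / 2 + k) ^+ 2) a b =
      moment f (fun y => 4^-1 * (s y ^+ 2 * weight a b y) + k * (s y * weight a b y) +
        (k ^+ 2 + (8 * a)^-1) * (1 * weight a b y)).
    by congr moment; apply/funext => y; field; rewrite !gt_eqF.
  rewrite !(moment_add mf f0 f_decay); try by [exact: B|apply: exp_bounded_add; exact: B].
  by rewrite (moment_scale mf f0 f_decay _ Ass) (moment_scale mf f0 f_decay _ As)
      (moment_scale mf f0 f_decay _ A1) [4^-1 * _]mulrC.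
have [mu muE] : exists mu, mu = Is / (2 * I1) by eexists.
(* The density divided by the Gaussian centred at its own mean [mu]: [M] times the exponential of an
   affine function, hence still log-concave. *)
pose D r := M r * expR (- (4 * a * mu * r) + 2 * a * mu ^+ 2).
have DE r : D r * gauss (2 * a) mu r = M r * expR (- (2 * a * r ^+ 2)).
  by rewrite /D /gauss -mulrA -expRD; congr (_ * expR _); ring.
have D0 r : 0 < D r by rewrite mulr_gt0 ?expR_gt0.
have mX k : measurable_fun [set: RB] (fun r : R => (r + k) ^+ 2).
  by apply: measurable_funX; exact: measurable_funD.
have aX k : exp_bounded (fun y => (8 * a)^-1 + (s y / 2 + k) ^+ 2).
  apply: exp_bounded_add; first exact: exp_bounded_cst.
  rewrite (_ : (fun y => _) = (fun y => (s y / 2 + k) * (s y / 2 + k)))//.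
  by apply: exp_bounded_mul; (apply: exp_bounded_add; [apply: exp_bounded_mul => //|]);
      exact: exp_bounded_cst.
have Q k : (\int[mu1]_r ((r + k) ^+ 2 * (D r * gauss (2 * a) mu r))%:E =
    (gauss_mass (4 * a) * (Iss / 4 + k * Is + (k ^+ 2 + (8 * a)^-1) * I1))%:E)%E.
  rewrite -IE -(marginal_moment (mX k) (fun r => sqr_ge0 _) (aX k)).
    by apply: eq_integral => r _; rewrite DE.
  by move=> y; rewrite integral_gauss_sqr//; congr (_ * ((_)^-1 + _))%:E; ring.
have P : (\int[mu1]_r (D r * gauss (2 * a) mu r)%:E = (gauss_mass (4 * a) * I1)%:E)%E.
  rewrite -(@marginal_moment (fun=> 1) (fun=> 1))//.
  - by apply: eq_integral => r _; rewrite DE mul1r.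
  - exact: exp_bounded_cst.
  - by move=> y; under eq_integral do rewrite mul1r; rewrite integral_gauss// mulr1.
have := @variance_lt R D (2 * a) mu _ _ _ _ _ D0 _ _ P (Q 0) (Q 1).
have -> : (2 * (2 * a))^-1 = (4 * a)^-1 by congr (_ ^-1); ring.
move=> /(_ _ _ _ _ _) h.
have : gauss_mass (4 * a) * (Iss / 4 + 0 * Is + (0 ^+ 2 + (8 * a)^-1) * I1) <
       gauss_mass (4 * a) * I1 * (mu ^+ 2 + (4 * a)^-1).
  apply: h.
  - by rewrite mulr_gt0.
  - move=> r; apply: continuousM; first exact: M_continuous.
    apply: (@continuous_comp _ _ _ (fun r => - (4 * a * mu * r) + 2 * a * mu ^+ 2)).
      apply: continuousD; last exact: cst_continuous.
      apply: continuousN; apply: continuousM; first exact: cst_continuous.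
      exact: cvg_id.
    exact: continuous_expR.
  - move=> r r'; rewrite /D mulrACA exprMn; apply: ler_pM; last 2 first.
    + exact: M_lc.
    + rewrite le_eqVlt; apply/orP; left; apply/eqP.
      by rewrite (expr2 (expR _)) -!expRD; congr expR; field.
    + by apply: mulr_ge0; exact: ltW.
    + by rewrite -expRD expR_ge0.
  (* The rates [1 - 4 * a * mu] and [- 1 - 4 * a * mu], one for each sign of [r], give
     [D r * expR |r| <= C]. *)
  - move=> e e0; have [C1 h1] := M_decay (1 - 4 * a * mu);
      have [C2 h2] := M_decay (- 1 - 4 * a * mu).
    pose C := (Num.max C1 C2) * expR (2 * a * mu ^+ 2).
    exists (C / e) => r; rewrite ltr_pdivrMr// => hr.
    have : D r * expR `|r| <= C.
      have [la [laE h]] : exists la, `|r| = (la +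
          4 * a * mu) * r /\ M r * expR (la * r) <= Num.max C1 C2.
        have [r0|r0] := leP 0 r.
          exists (1 - 4 * a * mu); rewrite ger0_norm// subrK mul1r; split => //.
          by rewrite le_max h1.
        exists (- 1 - 4 * a * mu); rewrite ltr0_norm// subrK mulN1r; split => //.
        by rewrite le_max h2 orbT.
      have -> : D r * expR `|r| = M r * expR (la * r) * expR (2 * a * mu ^+ 2).
        by rewrite /D laE -!mulrA -!expRD; congr (_ * expR _); ring.
      by rewrite /C ler_wpM2r// expR_ge0.
    have h3 : D r * (1 + `|r|) <= D r * expR `|r| by rewrite ler_pM2l// expR_ge1Dx.
    have := D0 r; have := normr_ge0 r; nra.
  - by rewrite muE; field; rewrite !gt_eqF.
rewrite -subr_gt0 -mulrA -mulrBr pmulr_rgt0// => H.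
rewrite -subr_gt0.
rewrite (_ : _ - _ = 4 * (I1 * (mu ^+ 2 + (4 * a)^-1) - (Iss / 4 + 0 * Is + (0 ^+ 2 +
    (8 * a)^-1) * I1))).
  by rewrite mulr_gt0.
by rewrite muE; field; rewrite !gt_eqF.
Qed.

End marginal.

Lemma edotxx_le0 (R : realType) n (u : 'rV[R]_n) : edot u u <= 0 -> u = 0.
Proof.
move=> u0; have /eqP : edot u u = 0 by apply/eqP; rewrite eq_le u0 edotxx_ge0.
rewrite psumr_eq0; last by move=> j _; rewrite -expr2 sqr_ge0.
move=> /allP h; apply/rowP => i; rewrite mxE.
by have := h i; rewrite mem_index_enum mulf_eq0 orbb => /(_ isT)/eqP.
Qed.

(** * The log-partition function: derivatives, covariance bound and coercivity *)

Section log_partition.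
Context {R : realType} {n : nat}.
Local Notation RB := (measurableTypeR R).
Local Notation lebn := (@lebn R).
Local Notation T := (n.-tuple RB).
Local Notation Y := (@row_of_tuple R n).

Variable f : T -> R.
Hypothesis mf : measurable_fun setT f.
Hypothesis f0 : forall y, 0 <= f y.
Hypothesis f_decay : forall A, exists C, forall y, f y <= C * expR (- (A * ell (Y y))).
Hypothesis f_mass : (0 < \int[lebn n]_y (f y)%:E)%E.
Hypothesis f_lc : forall x, \forall z \ae lebn n, f x * f (reflection x z) <= f z * f z.

(* In terms of the heat flow, [a = 1 / (4 t)] and [b = x / (2 t)]. *)
Definition partition_function a (b : 'rV[R]_n) := tilted_moment f (fun=> 1) a b.

Definition log_partition a b := ln (partition_function a b).

Definition energy a b := tilted_moment f (fun y =>
    edot (Y y) (Y y)) a b / partition_function a b.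

Definition mean a b := \row_i (tilted_moment f (fun y => Y y 0 i) a b / partition_function a b).

Definition cov a b := \matrix_(i, j)
  (tilted_moment f (fun y => Y y 0 i *
      Y y 0 j) a b / partition_function a b - mean a b 0 i * mean a b 0 j).

Lemma partition_function_gt0 a b : 0 < a -> 0 < partition_function a b.
Proof. by move=> /ltW; exact: tilted_moment_gt0. Qed.

Lemma expansion2_partition_function a b : 0 < a -> expansion2 partition_function a b
  (- (energy a b * partition_function a b)) (partition_function a b *: mean a b).
Proof.
move=> a0; have p0 := partition_function_gt0 b a0.
have := expansion2_tilted_moment mf f0 f_decay b (exp_bounded_cst 1) a0; congr expansion2.
- rewrite divfK ?gt_eqF//; congr (- tilted_moment _ _ _ _).
  by apply/funext => y; rewrite mul1r.
- apply/rowP => i; rewrite !mxE mulrC divfK ?gt_eqF//; congr tilted_moment.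
  by apply/funext => y; rewrite mul1r.
Qed.

Lemma expansion2_log_partition a b : 0 < a ->
    expansion2 log_partition a b (- energy a b) (mean a b).
Proof.
move=> a0; have p0 := partition_function_gt0 b a0.
have := expansion2_ln p0 (expansion2_partition_function b a0); congr expansion2.
- by rewrite mulrN mulrC mulfK// gt_eqF.
- by rewrite scalerA mulVf ?scale1r// gt_eqF.
Qed.

Lemma expansion2_mean a b i : 0 < a ->
  exists c, expansion2 (fun a b => mean a b 0 i) a b c (row i (cov a b)).
Proof.
move=> a0; have p0 := partition_function_gt0 b a0.
have := expansion2_mul (expansion2_tilted_moment mf f0 f_decay b (exp_bounded_coord i) a0)
    (expansion2_inv p0 (expansion2_partition_function b a0)).
set F := fun a b => _ / _; set c := _ + _ => h; exists c.
rewrite (_ : (fun a b => _) = F); last by apply/funext => ?; apply/funext => ?; rewrite mxE.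
move: h; congr expansion2; apply/rowP => j; rewrite !mxE.
by field; rewrite gt_eqF.
Qed.

Let tilted_moment_sum (k : 'I_n -> R) (w : 'I_n -> T -> R) a b : 0 <= a ->
    (forall i, exp_bounded (w i)) ->
  tilted_moment f (fun y => \sum_i k i * w i y) a b = \sum_i k i * tilted_moment f (w i) a b.
Proof.
move=> a0 aw; rewrite /tilted_moment -(moment_sum mf f0 f_decay); last first.
  by move=> i; apply: exp_bounded_mul => //; exact: exp_bounded_weight.
by congr moment; apply/funext => y; rewrite mulr_suml; apply: eq_bigr => i _; rewrite mulrA.
Qed.

Lemma tr_cov a b : 0 <= a -> \tr (cov a b) = energy a b - edot (mean a b) (mean a b).
Proof.
move=> a0; rewrite /mxtrace; under eq_bigr do rewrite mxE.
rewrite sumrB -mulr_suml; congr (_ / _ - _).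
transitivity (\sum_i 1 * tilted_moment f (fun y => Y y 0 i * Y y 0 i) a b).
  by apply: eq_bigr => i _; rewrite mul1r.
rewrite -tilted_moment_sum//; last by move=> i; apply: exp_bounded_mul;
    exact: exp_bounded_coord.
by congr tilted_moment; apply/funext => y; apply: eq_bigr => i _; rewrite mul1r.
Qed.

Let tilted_moment_edot v a b : 0 <= a -> tilted_moment f (fun y => edot v (Y y)) a b =
  edot v (mean a b) * partition_function a b.
Proof.
move=> a0; rewrite (@tilted_moment_sum (v 0) (fun i y => Y y 0 i))//;
    last exact: exp_bounded_coord.
rewrite /edot mulr_suml; apply: eq_bigr => i _; rewrite mxE -!mulrA mulVf ?mulr1//.
by rewrite gt_eqF//; exact: tilted_moment_gt0.
Qed.

Let tilted_moment_edot_sqr v a b : 0 <= a -> tilted_moment f (fun y => edot v (Y y) ^+ 2) a b =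
  (edot v (v *m cov a b) + edot v (mean a b) ^+ 2) * partition_function a b.
Proof.
move=> a0; have p0 : partition_function a b != 0 by rewrite gt_eqF//; exact: tilted_moment_gt0.
have -> : (fun y => edot v (Y y) ^+ 2) =
    (fun y => \sum_j v 0 j * (\sum_i v 0 i * (Y y 0 i * Y y 0 j))).
  apply/funext => y; rewrite expr2 {2}/edot mulr_sumr; apply: eq_bigr => j _.
  rewrite mulrCA; congr (_ * _); rewrite mulr_suml; apply: eq_bigr => i _.
  by rewrite mulrA.
rewrite tilted_moment_sum//; last first.
  move=> j; apply: exp_bounded_sum => i; apply: exp_bounded_mul; first exact: exp_bounded_cst.
  by apply: exp_bounded_mul; exact: exp_bounded_coord.
rewrite expr2 {2}/edot mulr_sumr /edot -big_split/= mulr_suml; apply: eq_bigr => j _.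
rewrite tilted_moment_sum//; last by move=> i; apply: exp_bounded_mul; exact: exp_bounded_coord.
rewrite mulrCA -mulrDr -mulrA; congr (_ * _).
rewrite mxE mulr_suml -big_split/= mulr_suml; apply: eq_bigr => i _.
by rewrite [cov a b i j]mxE; field.
Qed.

Lemma cov_lt a b u : 0 < a -> u != 0 -> 0 < edot u u - 2 * a * edot u (u *m cov a b).
Proof.
move=> a0 u0; have p0 := partition_function_gt0 b a0.
have uu : 0 < edot u u by rewrite ltNge; apply: contra u0 => /edotxx_le0 ->.
pose k := Num.sqrt (edot u u).
have k0 : 0 < k by rewrite sqrtr_gt0.
have kk : k * k = edot u u by rewrite -expr2 sqr_sqrtr ?ltW.
pose v := k^-1 *: u.
have uE : u = k *: v by rewrite scalerA divff ?scale1r// gt_eqF.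
have v1 : edot v v = 1.
  by rewrite edotZl edotZr -kk; field; rewrite gt_eqF.
have := directional_variance_lt mf f0 f_decay f_mass f_lc b a0 v1.
rewrite -/(partition_function a b) tilted_moment_edot_sqr ?(ltW a0)// tilted_moment_edot
    ?(ltW a0)//.
set c := edot v _; set d := edot v _; set p := partition_function a b => h.
have {}h : 0 < p * (1 - 2 * a * c).
  move: h; rewrite -subr_gt0 => h.
  rewrite (_ : p * _ = 2 * a * (p / (2 * a) - ((c + d ^+ 2) * p - (d * p) ^+ 2 / p))).
    by apply: mulr_gt0 => //; exact: mulr_gt0.
  by field; rewrite !gt_eqF.
rewrite uE -scalemxAl !(edotZl k, edotZr k) v1 -/c.
rewrite (_ : _ - _ = k * k * (1 - 2 * a * c)); last by ring.
by rewrite mulr_gt0 ?mulr_gt0//; move: h; rewrite pmulr_rgt0.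
Qed.

(** With [w = be - 2 * a * y], the quadratic term is [- w ^+ 2 / (4 * a)] and absorbs [la * |w|] at
    the price [a * la ^+ 2]. *)
Lemma coord_quad_le (a la be y : R) : 0 < a -> 0 <= la ->
  la * `|be| + (be * y - a * (y * y) - be * be / (4 * a)) <= 2 * a * la * `|y| + a * la ^+ 2.
Proof.
move=> a0 la0; pose w := be - 2 * a * y.
have h1 : la * `|be| <= la * (2 * a * `|y| + `|w|).
  rewrite ler_wpM2l//; have -> : be = 2 * a * y + w by rewrite /w; ring.
  apply: le_trans (ler_normD _ _) _; rewrite lerD2r !normrM.
  by rewrite (ger0_norm (ler0n _ 2)) (ger0_norm (ltW a0)).
have -> : be * y - a * (y * y) - be * be / (4 * a) = - (`|w| ^+ 2 / (4 * a)).
  by rewrite real_normK ?num_real// /w; field; rewrite gt_eqF.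
have h2 : 0 <= (`|w| - 2 * a * la) ^+ 2 / (4 * a).
  by rewrite divr_ge0 ?sqr_ge0// mulr_ge0// ltW.
have e : (`|w| - 2 * a * la) ^+ 2 / (4 * a) = `|w| ^+ 2 / (4 * a) - la * `|w| + a * la ^+ 2.
  by field; rewrite gt_eqF.
rewrite e in h2; lra.
Qed.

(** The left side is [- phi_t] up to a constant, in the variable [b]. This is super-linearity of
    [phi_t], which makes the dual finite and attained. *)
Lemma log_partition_coercive a la : 0 < a -> 0 <= la ->
  exists K, forall b, log_partition a b - edot b b / (4 * a) <= K - la * ell b.
Proof.
move=> a0 la0.
have aE : exp_bounded (fun y => expR (2 * a * la * ell (Y y))).
  by apply: exp_bounded_exp_ell; rewrite !mulr_ge0// ltW.
pose C := expR (n%:R * (a * la ^+ 2)) * moment f (fun y => expR (2 * a * la * ell (Y y))).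
exists (ln C) => b.
have p0 := partition_function_gt0 b a0.
have aw : exp_bounded (fun y => 1 * weight a b y).
  by apply: exp_bounded_mul; [exact: exp_bounded_cst|apply: exp_bounded_weight; exact: ltW].
rewrite lerBrDr -[leLHS]expRK ler_ln ?posrE ?expR_gt0//; last first.
  by rewrite mulr_gt0 ?expR_gt0//; apply: moment_gt0 => // y; exact: expR_gt0.
rewrite -addrA expRD lnK ?posrE// /partition_function /tilted_moment mulrC.
rewrite /C -(moment_scale mf f0 f_decay _ aw) -(moment_scale mf f0 f_decay _ aE).
apply: (moment_le mf f0 f_decay) => [||y].
- by apply: exp_bounded_mul => //; exact: exp_bounded_cst.
- by apply: exp_bounded_mul => //; exact: exp_bounded_cst.
rewrite mul1r /weight -!expRD ler_expR.
have : \sum_i (la * `|b 0 i| + (b 0 i * Y y 0 i - a * (Y y 0 i * Y y 0 i) - b 0 i *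
    b 0 i / (4 * a))) <=
    \sum_i (2 * a * la * `|Y y 0 i| + a * la ^+ 2).
  by apply: ler_sum => i _; exact: coord_quad_le.
rewrite !big_split/= !sumrN -!mulr_sumr -mulr_suml.
rewrite big_const_ord iter_addr_0 -[_ *+ n]mulr_natl -/(ell b) -/(ell (Y y)).
rewrite -/(edot b (Y y)) -/(edot (Y y) (Y y)) -/(edot b b).
lra.
Qed.

End log_partition.

(** * From quadratic remainders to derivatives *)

Section quadratic_remainder.
Context {R : realType}.

Lemma normr_coord_le n (x : 'rV[R]_n) i : `|x 0 i| <= `|x|.
Proof.
rewrite [leRHS]/Num.norm/= mx_normrE; apply/bigmax_geP; right => /=.
by exists (0, i).
Qed.

Lemma ell_le_norm n (x : 'rV[R]_n) : ell x <= n%:R * `|x|.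
Proof.
rewrite mulr_natl -[n in _ *+ n]card_ord -sumr_const.
by apply: ler_sum => i _; exact: normr_coord_le.
Qed.

Lemma quadratic_near (T : normedModType R) (g : T -> R) (K d : R) : 0 < d -> 0 <= K ->
  (forall h : T, `|h| <= d -> `|g h| <= K * `|h| ^+ 2) ->
  forall e, 0 < e -> \forall h \near (0 : T), `|g h| <= e * `|h|.
Proof.
move=> d0 K0 hg e e0; near=> h.
have hd : `|h| < Num.min d (e / (K + 1)).
  near: h; apply: (@cvgr0_norm_lt _ _ _ _ _ id); first exact: cvg_id.
  by rewrite lt_min d0 divr_gt0// ltr_wpDl.
move: hd; rewrite lt_min => /andP[hd he].
apply: le_trans (hg _ (ltW hd)) _; rewrite expr2 mulrA ler_wpM2r//.
rewrite ltr_pdivlMr ?ltr_wpDl// in he.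
have := normr_ge0 h; nra.
Unshelve. all: by end_near. Qed.

Lemma is_derive_quadratic (g : R -> R) (t c K d : R) : 0 < d -> 0 <= K ->
  (forall h, `|h| <= d -> `|g (t + h) - g t - c * h| <= K * h ^+ 2) ->
  is_derive t 1 g c.
Proof.
move=> d0 K0 hg.
have cv : h^-1 *: (g (h *: 1 + t) - g t) @[h --> 0^'] --> c.
  apply/cvgrPdist_le => e e0; near=> h.
  have h0 : h != 0 by near: h; exact: nbhs_dnbhs_neq.
  have hh : `|g (t + h) - g t - c * h| <= e * `|h|.
    near: h; apply: nbhs_dnbhs.
    apply: (@quadratic_near _ (fun h => g (t + h) - g t - c * h) K d d0 K0 _ e e0) => h /hg.
    by rewrite real_normK ?num_real.
  rewrite /GRing.scale/= mulr1 [h + t]addrC.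
  rewrite -(ler_pM2r (_ : 0 < `|h|)) ?normr_gt0// -normrM mulrBl mulrAC mulVf// mul1r.
  by rewrite distrC.
apply: DeriveDef; first exact: cvgP cv.
exact: cvg_lim cv.
Unshelve. all: by end_near. Qed.

Variable n : nat.

Let edot_linear (l : 'rV[R]_n) : linear (edot l).
Proof. by move=> k x y; rewrite edotDr edotZr. Qed.

HB.instance Definition _ (l : 'rV[R]_n) :=
  GRing.isLinear.Build R 'rV[R]_n R _ (edot l) (edot_linear l).

Lemma edot_continuous (l : 'rV[R]_n) : continuous (edot l).
Proof.
move=> x; apply: differentiable_continuous.
rewrite (_ : edot l = \sum_(i < n) (fun y : 'rV[R]_n => l 0 i *: (y 0 i : R^o))).
  by apply: differentiable_sum => i; apply: differentiableZ; exact: differentiable_coord.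
by apply/funext => y; rewrite fct_sumE.
Qed.

Lemma differentiable_quadratic (g : 'rV[R]_n -> R) x l (K d : R) : 0 < d -> 0 <= K ->
  (forall h, ell h <= d -> `|g (x + h) - g x - edot l h| <= K * ell h ^+ 2) ->
  differentiable g x /\ forall v, 'D_v g x = edot l v.
Proof.
move=> d0 K0 hg.
have E : g \o shift x = cst (g x) + edot l +o_ (0 : 'rV[R]_n) id.
  apply/eqaddoP => e e0.
  (* [ell h] is at most [n] times the sup norm; [n + 1] avoids a division by zero when [n = 0]. *)
  have dn : 0 < d / (n%:R + 1) by rewrite divr_gt0// ltr_wpDl.
  have Kn : 0 <= K * n%:R ^+ 2 by rewrite mulr_ge0 ?sqr_ge0.
  have r h : `|h| <= d / (n%:R + 1) ->
      `|g (h + x) - (g x + edot l h)| <= K * n%:R ^+ 2 * `|h| ^+ 2.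
    move=> hd; rewrite opprD addrA [h + x]addrC.
    apply: le_trans (hg _ _) _.
      apply: le_trans (ell_le_norm h) _; rewrite ler_pdivlMr ?ltr_wpDl// in hd.
      have := normr_ge0 h; nra.
    rewrite -mulrA -exprMn ler_wpM2l//.
    by rewrite lerXn2r ?nnegrE ?ell_ge0 ?ell_le_norm// mulr_ge0.
  exact: (quadratic_near dn Kn r e0).
have dE := diff_unique (@edot_continuous l) E.
have dg : differentiable g x.
  by apply/diff_locallyP; rewrite dE; split => //; exact: edot_continuous.
by split => // v; rewrite deriveE// dE.
Qed.

End quadratic_remainder.

(** * Critical points and positive definite matrices *)

Section quadratic_expansion_more.
Context {R : realType} {n : nat}.
Implicit Types (a : R) (b z u : 'rV[R]_n).

Lemma expansion2_edot z a b : expansion2 (fun _ b => edot b z) a b 0 z.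
Proof.
exists 0, 1; split => // al be _.
by rewrite edotDl mul0r add0r (edotC be z) [edot b z + _]addrC addrK subrr normr0 mul0r.
Qed.

Lemma expansion2_edotxx a b : expansion2 (fun _ b => edot b b) a b 0 (2 *: b).
Proof.
exists 1, 1; split => // al be _.
have -> : edot (b + be) (b + be) - edot b b - (0 * al + edot (2 *: b) be) = edot be be.
  by rewrite !(edotDl, edotDr, edotZl) (edotC be b); ring.
rewrite mul1r; apply: le_trans (normr_edot_le _ _) _.
by rewrite -expr2 lerXn2r ?nnegrE ?ell_ge0 ?hnorm_ge0// lerDr.
Qed.

Lemma expansion2_invM k a b : 0 < k -> 0 < a ->
    expansion2 (fun a _ => (k * a)^-1) a b (- (k * a ^+ 2)^-1) 0.
Proof.
move=> k0 a0.
have := expansion2_inv (mulr_gt0 k0 a0) (expansion2_mul (expansion2_cst k a b)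
    (expansion2_a a b)); congr expansion2.
  by field; rewrite !gt_eqF.
by rewrite !scaler0 addr0 scaler0.
Qed.

Lemma expansion2_differentiable (F : R -> 'rV[R]_n -> R) a b c l : expansion2 F a b c l ->
  differentiable (F a) b.
Proof.
move=> [K [d [K0 d0 h]]].
apply: (proj1 (@differentiable_quadratic _ _ _ _ l K d d0 K0 _)) => be hd.
have := h 0 be; rewrite /hnorm normr0 add0r addr0 mulr0 add0r; exact.
Qed.

Lemma expansion2_max (F : R -> 'rV[R]_n -> R) a b c l : expansion2 F a b c l ->
  (forall b', F a b' <= F a b) -> l = 0.
Proof.
move=> [K [d [K0 d0 h]]] bmax; apply: edotxx_le0; rewrite leNgt; apply/negP => e0.
set e := edot l l in e0; have l0 := ell_ge0 l.
pose q := K * ell l ^+ 2; have q0 : 0 <= q by rewrite mulr_ge0 ?sqr_ge0.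
(* A step along the gradient [l] that stays in the domain of the expansion and is short enough for
   the gain [s * e] to beat the remainder [s ^+ 2 * q]. *)
pose s := Num.min (d / (ell l + 1)) (e / (q + 1)).
have s0 : 0 < s by rewrite lt_min !divr_gt0// ltr_wpDl.
have s1 : s * (ell l + 1) <= d.
  by rewrite -ler_pdivlMr ?ltr_wpDl// ge_min lexx.
have s2 : s * (q + 1) <= e.
  by rewrite -ler_pdivlMr ?ltr_wpDl// ge_min lexx orbT.
have := h 0 (s *: l); rewrite /hnorm normr0 add0r addr0 mulr0 add0r ellZ (ger0_norm (ltW s0)).
have sd : s * ell l <= d by apply: le_trans s1; rewrite ler_wpM2l ?(ltW s0)// lerDl.
move=> /(_ sd); rewrite edotZr -/e exprMn mulrCA -/q => /ler_normlP[].
have := bmax (b + s *: l); have : s * (s * q) < s * e.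
  by rewrite ltr_pM2l//; apply: lt_le_trans s2; rewrite ltr_pM2l// ltrDl.
rewrite expr2; lra.
Qed.

Lemma edot_mulmx_tr u (M : 'M[R]_n) : edot u (u *m M^T) = edot u (u *m M).
Proof.
have E (x y : 'rV[R]_n) : edot x y = (x *m y^T) 0 0.
  by rewrite mxE; apply: eq_bigr => i _; rewrite mxE.
by rewrite E [RHS]edotC E trmx_mul trmxK mulmxA.
Qed.

Lemma norm_le_ell u : `|u| <= ell u.
Proof.
rewrite [leLHS]/Num.norm/= mx_normrE; apply: bigmax_le => [|[j i] _]; first exact: ell_ge0.
by rewrite (ord1 j); exact: coord_le_ell.
Qed.

Section positive_definite.
Variable M : 'M[R]_n.
Hypothesis Mpos : forall u, u != 0 -> 0 < edot u (u *m M).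

Lemma positive_definite_unitmx : M \in unitmx.
Proof.
rewrite -row_free_unit -kermx_eq0; apply/rowV0P => v /sub_kermxP vM.
by apply/eqP; apply/negPn/negP => /Mpos; rewrite vM edot0r ltxx.
Qed.

Lemma positive_definite_coercive : exists2 k, 0 < k &
  forall u, k * ell u ^+ 2 <= edot u (u *m M).
Proof.
pose S := [set u : 'rV[R]_n | `|u| = 1].
(* The unit sphere is empty when [n = 0], and then every vector is zero. *)
have [S0|nS] := pselect (S !=set0); last first.
  exists 1 => // u; have [->|u0] := eqVneq u 0; first by rewrite ell0 edotC edot0r expr0n mulr0.
  exfalso; apply: nS; exists (`|u|^-1 *: u); rewrite /S/= normrZ normfV normr_id mulVf//.
  by rewrite normr_eq0.
have cS : compact S.
  apply: bounded_closed_compact.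
    by exists 1; split => // M1 h u /= ->; exact: ltW.
  apply: (@closed_comp _ _ (fun u : 'rV[R]_n => `|u|) [set 1]).
    by move=> u _; exact: norm_continuous.
  exact: closed_eq.
have cq : continuous (fun u => edot u (u *m M)).
  move=> u; apply: (@differentiable_continuous R 'rV[R]_n R).
  rewrite (_ : (fun u => _) = \sum_j (fun u : 'rV[R]_n => (u 0 j : R) * (u *m M) 0 j));
      last first.
    by apply/funext => v; rewrite fct_sumE.
  apply: differentiable_sum => j; apply: differentiableM; first exact: differentiable_coord.
  rewrite (_ : (fun u => _) = (fun u => edot u (\row_k M k j))).
    exact: expansion2_differentiable (expansion2_edot (\row_k M k j) 0 u).
  by apply/funext => v; rewrite mxE; apply: eq_bigr => k _; rewrite mxE.
have [c cS1 cmin] := EVT_min_rV S0 cS (continuous_subspaceT cq).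
have c0 : c != 0.
  by move: cS1; rewrite inE /S/= => c1; rewrite -normr_gt0 c1.
have n0 : 0 < (n%:R + 1 : R) by rewrite ltr_wpDl.
exists (edot c (c *m M) / (n%:R + 1) ^+ 2); first by rewrite divr_gt0 ?Mpos// exprn_gt0.
move=> u; have [->|u0] := eqVneq u 0.
  by rewrite ell0 (edotC 0) edot0r expr0n mulr0.
have nu : 0 < `|u| by rewrite normr_gt0.
have := cmin (`|u|^-1 *: u); rewrite inE /S/= normrZ normfV normr_id mulVf ?gt_eqF//.
move=> /(_ erefl); rewrite -scalemxAl edotZl edotZr => h.
have h2 : edot c (c *m M) * `|u| ^+ 2 <= edot u (u *m M).
  move: h; rewrite -(ler_pM2r (exprn_gt0 2 nu)) => h; apply: le_trans h _.
  by rewrite le_eqVlt; apply/orP; left; apply/eqP; field; rewrite gt_eqF.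
apply: le_trans h2; rewrite -mulrA ler_wpM2l ?(ltW (Mpos c0))//.
rewrite mulrC ler_pdivrMr ?exprn_gt0// -exprMn.
rewrite lerXn2r ?nnegrE ?ell_ge0 ?mulr_ge0 ?(ltW n0)//.
apply: le_trans (ell_le_norm u) _; rewrite mulrC ler_wpM2l// lerDl//.
Qed.

End positive_definite.

End quadratic_expansion_more.

(** * Maximisers of the dual problem and derivatives of its value *)

Section dual_maximisers.
Context {R : realType} {n : nat}.
Implicit Types (a : R) (b z u : 'rV[R]_n).
Variables (L E : R -> 'rV[R]_n -> R) (mean : R -> 'rV[R]_n -> 'rV[R]_n).
Variable cov : R -> 'rV[R]_n -> 'M[R]_n.
Hypothesis expansion2_L : forall a b, 0 < a -> expansion2 L a b (- E a b) (mean a b).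
Hypothesis expansion2_mean : forall a b i, 0 < a ->
  exists c, expansion2 (fun a b => mean a b 0 i) a b c (row i (cov a b)).
Hypothesis cov_lt : forall a b u, 0 < a -> u != 0 ->
  0 < edot u u - 2 * a * edot u (u *m cov a b).
Hypothesis L_coercive : forall a la, 0 < a -> 0 <= la ->
  exists K, forall b, L a b - edot b b / (4 * a) <= K - la * ell b.

(** [x.z - phi_t x] without the term in [ln (4 * pi * t)], after the substitution
    [b = 2 * a * x]. *)
Definition dual_objective z a b := edot b z / (2 * a) - edot b b / (4 * a) + L a b.
Local Notation V := dual_objective.

Definition dual_gradient a b := b - (2 * a) *: mean a b.
Local Notation G := dual_gradient.

(** Transposed because the rows of [cov] are the gradients of the components of [mean], whereas
    increments are row vectors multiplied on the left. *)
Definition dual_jacobian a b := (1%:M - (2 * a) *: cov a b)^T.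
Local Notation A := dual_jacobian.

Lemma expansion2_dual_objective z a b : 0 < a -> expansion2 (V z) a b
  (- (edot b z / (2 * a ^+ 2)) + edot b b / (4 * a ^+ 2) - E a b)
  ((2 * a)^-1 *: (z - G a b)).
Proof.
move=> a0; have k2 : 0 < (2 : R) by [].
have k4 : 0 < (4 : R) by [].
have h1 := expansion2_mul (expansion2_edot z a b) (expansion2_invM b k2 a0).
have h2 := expansion2_mul (expansion2_cst (-1) a b) (expansion2_mul (expansion2_edotxx a b)
    (expansion2_invM b k4 a0)).
have := expansion2_add (expansion2_add h1 h2) (expansion2_L b a0).
rewrite (_ : (fun a b => _ + L a b) = V z); last first.
  by apply/funext => a'; apply/funext => b'; rewrite mulN1r.
congr expansion2.
  by field; rewrite gt_eqF.
apply/rowP => i; rewrite /G !mxE.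
by field; rewrite gt_eqF.
Qed.

Lemma dual_objective_has_max z a : 0 < a -> exists b, forall b', V z a b' <= V z a b.
Proof.
move=> a0; have a20 : 0 < 2 * a by rewrite mulr_gt0.
(* This slope beats that of the linear term by 1, so the objective stays below [K - ell b]. *)
have la0 : 0 <= ell z / (2 * a) + 1 by rewrite addr_ge0// divr_ge0 ?ell_ge0// ltW.
have [K hK] := L_coercive a0 la0.
have VK b : V z a b <= K - ell b.
  have h1 : edot b z / (2 * a) <= ell z / (2 * a) * ell b.
    rewrite mulrAC ler_wpM2r ?invr_ge0 ?(ltW a20)// mulrC.
    by apply: le_trans (ler_norm _) _; exact: normr_edot_le.
  have := hK b; rewrite /V; lra.
pose r := Num.max 0 (K - V z a 0).
pose S := [set b : 'rV[R]_n | `|b| <= r].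
have S0 : S !=set0 by exists 0; rewrite /S/= normr0 le_max lexx.
have cS : compact S.
  apply: bounded_closed_compact.
    by exists r; split => [|M1 h u /= hu]; [exact: num_real|exact: le_trans hu (ltW h)].
  apply: (@closed_comp _ _ (fun u : 'rV[R]_n => `|u|) [set x | x <= r]).
    by move=> u _; exact: norm_continuous.
  exact: closed_le.
have cV : continuous (V z a).
  by move=> b; apply: differentiable_continuous;
      exact: expansion2_differentiable (expansion2_dual_objective z b a0).
have [c _ cmax] := EVT_max_rV S0 cS (continuous_subspaceT cV).
exists c => b; have [bS|bS] := leP `|b| r; first by apply: cmax; rewrite inE.
apply: (@le_trans _ _ (V z a 0)); last by apply: cmax; rewrite inE /S/= normr0 le_max lexx.
apply: le_trans (VK b) _; rewrite lerBlDr -lerBlDl.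
apply: le_trans (norm_le_ell b); apply: le_trans (ltW bS).
by rewrite le_max lexx orbT.
Qed.

Lemma dual_maximisers_exist : exists B : R -> 'rV[R]_n -> 'rV[R]_n,
  forall a z, 0 < a -> forall b, V z a b <= V z a (B a z).
Proof.
have h (p : R * 'rV[R]_n) : exists b0, 0 < p.1 -> forall b, V p.2 p.1 b <= V p.2 p.1 b0.
  have [p0|np] := ltP 0 p.1; last by exists 0.
  by have [b0 h] := dual_objective_has_max p.2 p0; exists b0.
by have [B hB] := choice h; exists (fun a z => B (a, z)) => a z; exact: (hB (a, z)).
Qed.

Lemma dual_max_gradient z a b : 0 < a -> (forall b', V z a b' <= V z a b) -> G a b = z.
Proof.
move=> a0 /(expansion2_max (expansion2_dual_objective z b a0)) /eqP.
rewrite scaler_eq0 invr_eq0 gt_eqF ?mulr_gt0//= subr_eq0 => /eqP/esym; exact.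
Qed.

Lemma dual_jacobian_gt0 a b u : 0 < a -> u != 0 -> 0 < edot u (u *m A a b).
Proof.
move=> a0 u0; rewrite edot_mulmx_tr mulmxBr mulmx1 -scalemxAr edotBr edotZr.
exact: cov_lt.
Qed.

Lemma dual_gradient_expansion a b : 0 < a -> exists c K d, [/\ 0 <= K, 0 < d &
  forall al be, hnorm al be <= d ->
    ell (G (a + al) (b + be) - G a b - (al *: c + be *m A a b)) <= K * hnorm al be ^+ 2].
Proof.
move=> a0.
have h i : exists c K d, [/\ 0 <= K, 0 < d & forall al be, hnorm al be <= d ->
    `|G (a + al) (b + be) 0 i - G a b 0 i - (c * al + edot (row i (A a b)^T) be)| <=
    K * hnorm al be ^+ 2].
  have [c hc] := expansion2_mean b i a0.
  have := expansion2_add (expansion2_coord i a b) (expansion2_mul (expansion2_mul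
      (expansion2_cst (-2) a b) (expansion2_a a b)) hc).
  set cc := 0 + _; have -> : delta_mx 0 i + (- 2 * a *: row i (cov a b) +
     mean a b 0 i *: (-2 *: 0 + a *: 0)) = row i (A a b)^T.
    apply/rowP => j; rewrite /A trmxK !mxE eqxx/= eq_sym; ring.
  move=> [K [d [K0 d0 H]]]; exists cc, K, d; split => // al be hd.
  have := H al be hd; rewrite /G !mxE.
  by rewrite !mulNr.
have [c hc] := choice h.
have [K hK] := choice hc.
have [d hd] := choice hK.
have d0 i : 0 < d i by case: (hd i).
have K0 i : 0 <= K i by case: (hd i).
have s0 : 0 < (\sum_i (d i)^-1 + 1).
  by rewrite ltr_wpDl// sumr_ge0// => i _; rewrite invr_ge0 ltW.
exists (\row_i c i), (\sum_i K i), (\sum_i (d i)^-1 + 1)^-1; split.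
- exact: sumr_ge0.
- by rewrite invr_gt0.
move=> al be hh; rewrite mulr_suml; apply: ler_sum => i _.
have hi : hnorm al be <= d i.
  apply: le_trans hh _; rewrite -[leRHS]invrK lef_pV2 ?posrE ?invr_gt0//.
  rewrite (bigD1 i)//= -addrA lerDl addr_ge0// sumr_ge0// => j _.
  by rewrite invr_ge0 ltW.
have [_ _ /(_ _ _ hi)] := hd i.
suff -> : G (a + al) (b + be) 0 i - G a b 0 i - (c i * al + edot (row i (A a b)^T) be) =
  (G (a + al) (b + be) - G a b - (al *: (\row_i0 c i0) + be *m A a b)) 0 i by [].
rewrite !mxE [c i * al]mulrC edotC; congr (_ - (_ + _)).
by apply: eq_bigr => j _; rewrite !mxE.
Qed.

(** The derivative along the ray is the quadratic form of the Jacobian, positive at every point.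
    This monotonicity is global, so it controls maximisers not known beforehand to be close to each
    other. *)
Lemma dual_gradient_ray a b u r s : 0 < a -> u != 0 -> r < s ->
  edot u (G a (b + r *: u)) < edot u (G a (b + s *: u)).
Proof.
move=> a0 u0 rs; pose h x := edot u (G a (b + x *: u)).
pose h' x := edot u (u *m A a (b + x *: u)).
have dh (x : R) : is_derive x 1 h (h' x).
  have [c [K [d [K0 d0 hd]]]] := dual_gradient_expansion (b + x *: u) a0.
  have l0 := ell_ge0 u.
  apply: (@is_derive_quadratic _ _ _ _ (ell u ^+ 3 * K) (d / (ell u + 1))).
  - by rewrite divr_gt0// ltr_wpDl.
  - by rewrite mulr_ge0// exprn_ge0.
  move=> k; rewrite ler_pdivlMr ?ltr_wpDl// => hk.
  have hn : hnorm 0 (k *: u) <= d.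
    rewrite /hnorm normr0 add0r ellZ; apply: le_trans hk.
    by rewrite ler_wpM2l// lerDl.
  have := hd _ _ hn; rewrite addr0 scale0r add0r -(addrA b) -scalerDl => H.
  have -> : h (x + k) - h x - h' x * k =
      edot u (G a (b + (x + k) *: u) - G a (b + x *: u) - (k *: u) *m A a (b + x *: u)).
    by rewrite -scalemxAl (edotBr (G _ _ - G _ _)) (edotBr (G _ _)) (edotZr k) [k * _]mulrC.
  apply: le_trans (normr_edot_le _ _) _.
  apply: le_trans (ler_wpM2l l0 H) _.
  rewrite /hnorm normr0 add0r ellZ exprMn real_normK ?num_real//.
  by rewrite le_eqVlt; apply/orP; left; apply/eqP; ring.
have ch : continuous h.
  by move=> x; apply/differentiable_continuous/derivable1_diffP; case: (dh x).
have [c _ hc] := MVT rs (fun x _ => dh x) (continuous_subspaceT ch).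
by rewrite -subr_gt0 -/(h s) -/(h r) hc mulr_gt0 ?subr_gt0// dual_jacobian_gt0.
Qed.

(* On the sphere of radius [C * h] around [b0], with [h] the distance of the
   data, [G a - z] points outward; it then does so beyond the sphere as well. *)
Lemma dual_gradient_inverse_lipschitz a0 b0 : 0 < a0 -> exists C d, [/\ 0 <= C, 0 < d &
  forall a b, 0 < a -> `|a - a0| + ell (G a b - G a0 b0) <= d ->
    ell (b - b0) <= C * (`|a - a0| + ell (G a b - G a0 b0))].
Proof.
move=> a00; have [c [K [d [K0 d0 hd]]]] := dual_gradient_expansion b0 a00.
have [ka ka0 hk] := positive_definite_coercive (fun u => @dual_jacobian_gt0 a0 b0 u a00).
have c0 := ell_ge0 c.
(* In [2 + ell c], one unit pays for the displacement of [G], one for the remainder, and [ell c] for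
   the change of [a]. *)
pose C := (2 + ell c) / ka.
have C0 : 0 <= C by rewrite divr_ge0 ?addr_ge0// ltW.
have C1 : 0 < 1 + C by rewrite ltr_pwDl.
have D0 : 0 < K * (1 + C) ^+ 2 + 1 by rewrite ltr_wpDl// mulr_ge0 ?sqr_ge0.
exists C, (Num.min (d / (1 + C)) (K * (1 + C) ^+ 2 + 1)^-1); split => //.
  by rewrite lt_min divr_gt0// invr_gt0.
move=> a b a_gt0; set h := _ + ell _; rewrite le_min => /andP[hd1 hd2].
rewrite leNgt; apply/negP; set rho := ell (b - b0) => Cr.
have h0 : 0 <= h by rewrite addr_ge0// ell_ge0.
have r0 : 0 <= C * h by rewrite mulr_ge0.
have rho0 : 0 < rho by exact: le_lt_trans Cr.
pose u := rho^-1 *: (b - b0).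
have uE : rho *: u = b - b0 by rewrite scalerA divff ?scale1r// gt_eqF.
have lu : ell u = 1.
  by rewrite ellZ ger0_norm ?invr_ge0 ?(ltW rho0)// mulVf// gt_eqF.
have u0 : u != 0 by apply: contraPneq lu => ->; rewrite ell0 => /esym/eqP; rewrite oner_eq0.
have := dual_gradient_ray b0 a_gt0 u0 Cr; rewrite uE (addrC b0 (b - b0)) subrK.
have hal : `|a - a0| <= h by rewrite lerDl ell_ge0.
have hz : ell (G a b - G a0 b0) <= h by rewrite lerDr.
have hn : hnorm (a - a0) ((C * h) *: u) <= (1 + C) * h.
  by rewrite /hnorm ellZ lu mulr1 (ger0_norm r0) mulrDl mul1r lerD2r.
have hn' : hnorm (a - a0) ((C * h) *: u) <= d.
  by apply: le_trans hn _; rewrite mulrC -ler_pdivlMr.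
have := hd _ _ hn'; rewrite [a0 + _]addrC subrK; set rem := _ - _ - _ => hrem.
have hr : ell rem <= K * ((1 + C) * h) ^+ 2.
  apply: le_trans hrem _; rewrite ler_wpM2l// lerXn2r ?nnegrE ?hnorm_ge0//.
  by rewrite mulr_ge0// ltW.
have GE : G a (b0 + (C * h) *: u) =
    G a0 b0 + ((a - a0) *: c + ((C * h) *: u) *m A a0 b0) + rem.
  have aux (x y v : 'rV[R]_n) : x = y + v +
      (x - y - v) by rewrite -(addrA x) -opprD (addrC (y + v)) subrK.
  exact: aux.
have e1 : `|edot u (G a b - G a0 b0)| <= h.
  by apply: le_trans (normr_edot_le _ _) _; rewrite lu mul1r.
have e2 : `|edot u rem| <= K * ((1 + C) * h) ^+ 2.
  by apply: le_trans (normr_edot_le _ _) _; rewrite lu mul1r.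
have e3 : `|(a - a0) * edot u c| <= h * ell c.
  rewrite normrM ler_pM//; apply: le_trans (normr_edot_le _ _) _.
  by rewrite lu mul1r.
have e4 : ka <= edot u (u *m A a0 b0) by have := hk u; rewrite lu expr1n mulr1.
have e5 : (2 + ell c) * h <= C * h * edot u (u *m A a0 b0).
  apply: (@le_trans _ _ (C * h * ka)); last by rewrite ler_wpM2l.
  by rewrite /C mulrAC divfK ?gt_eqF.
have e6 : K * ((1 + C) * h) ^+ 2 <= h.
  rewrite exprMn mulrA expr2 mulrA -[leRHS]mul1r ler_wpM2r//.
  move: hd2; rewrite -[_^-1]mul1r ler_pdivlMr// mulrC; apply: le_trans.
  by rewrite ler_wpM2r// lerDl.
rewrite GE; rewrite (edotBr (G _ _)) in e1.
rewrite 2!edotDr (edotDr (_ *: c)) -scalemxAl (edotZr (a - a0)) (edotZr (C * h)).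
move: e1 e2 e3 => /ler_normlP[_ e1] /ler_normlP[e2 _] /ler_normlP[e3 _].
move: e1 e2 e3 e5 e6; lra.
Qed.

Variable B : R -> 'rV[R]_n -> 'rV[R]_n.
Hypothesis B_max : forall a z, 0 < a -> forall b, V z a b <= V z a (B a z).

Let GB a z : 0 < a -> G a (B a z) = z.
Proof. by move=> a0; apply: dual_max_gradient => // b; exact: B_max. Qed.

Let B_lipschitz a z : 0 < a -> exists C d, [/\ 0 <= C, 0 < d &
  forall al h, 0 < a + al -> `|al| + ell h <= d ->
    ell (B (a + al) (z + h) - B a z) <= C * (`|al| + ell h)].
Proof.
move=> a0; have [C [d [C0 d0 H]]] := dual_gradient_inverse_lipschitz (B a z) a0.
exists C, d; split => // al h al0 hd.
have := H (a + al) (B (a + al) (z + h)) al0; rewrite !GB//.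
by rewrite [a + al]addrC addrK [z + h]addrC addrK; apply.
Qed.

(** The maximiser moves by at most a multiple of [ell h] and the objective is stationary there, so
    its motion and the cross term [edot be h] count only to second order. The gradient [B / (2 * a)]
    is the maximiser in the variable [x]. *)
Lemma dual_value_differentiable a z : 0 < a ->
  differentiable (fun z => V z a (B a z)) z /\
  forall v, 'D_v (fun z => V z a (B a z)) z = edot ((2 * a)^-1 *: B a z) v.
Proof.
move=> a0; have a20 : 0 < 2 * a by rewrite mulr_gt0.
have [C [d [C0 d0 hC]]] := B_lipschitz z a0.
have [K [d' [K0 d'0 hK]]] := expansion2_dual_objective z (B a z) a0.
have C1 : 0 < 1 + C by rewrite ltr_pwDl.
apply: (@differentiable_quadratic _ _ _ _ _ (K * C ^+ 2 +
    C / (2 * a)) (Num.min d (d' / (1 + C)))).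
- by rewrite lt_min d0 divr_gt0.
- by rewrite addr_ge0 ?mulr_ge0 ?sqr_ge0// invr_ge0 ltW.
move=> h; rewrite le_min => /andP[hd hd'].
have := hC 0 h; rewrite addr0 normr0 add0r => /(_ a0 hd).
set be := B a (z + h) - B a z => hbe.
have l0 := ell_ge0 h; have be0 := ell_ge0 be.
have hn : hnorm 0 be <= d'.
  rewrite /hnorm normr0 add0r; apply: le_trans hbe _.
  by move: hd'; rewrite ler_pdivlMr// mulrC; apply: le_trans; rewrite ler_wpM2r// lerDr.
have := hK 0 be hn; rewrite addr0 GB// subrr scaler0 (edotC 0) edot0r mulr0 !addr0 subr0.
rewrite /hnorm normr0 add0r => H.
have bE : B a (z + h) = B a z + be by rewrite /be (addrC (B a z)) subrK.
have -> : V (z + h) a (B a (z + h)) - V z a (B a z) - edot ((2 * a)^-1 *: B a z) h =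
    (V z a (B a z + be) - V z a (B a z)) + edot be h / (2 * a).
  rewrite bE /V (edotDr z h) edotZl (edotDl _ _ h).
  by set x := edot (B a z) h; set y := L _ _; set y' := L _ _; field; rewrite gt_eqF.
apply: le_trans (ler_normD _ _) _; rewrite [leRHS]mulrDl; apply: lerD.
  apply: le_trans H _; rewrite -mulrA -exprMn ler_wpM2l// lerXn2r ?nnegrE ?mulr_ge0//.
rewrite normrM (ger0_norm (_ : 0 <= (2 * a)^-1)) ?invr_ge0 ?(ltW a20)//.
rewrite [leRHS]mulrAC ler_wpM2r ?invr_ge0 ?(ltW a20)//.
apply: le_trans (normr_edot_le _ _) _.
by rewrite expr2 mulrA ler_wpM2r.
Qed.

(** Since [B a] is a right inverse of [G a], the expansion of [G] at [B a z] reads [h = be *m A] up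
    to a remainder quadratic in [be], hence in [h] by the Lipschitz bound; it remains to invert
    [A]. *)
Lemma dual_maximiser_differentiable a z j : 0 < a ->
  differentiable (fun z => B a z 0 j) z /\
  forall v, 'D_v (fun z => B a z 0 j) z = (v *m invmx (A a (B a z))) 0 j.
Proof.
move=> a0; set N := invmx _.
have Nu : A a (B a z) \in unitmx.
  by apply: positive_definite_unitmx => u; exact: dual_jacobian_gt0.
have NE (x : 'rV[R]_n) : edot (col j N)^T x = (x *m N) 0 j.
  by rewrite edotC mxE; apply: eq_bigr => i _; rewrite !mxE.
have [C [d [C0 d0 hC]]] := B_lipschitz z a0.
have [c [K [d' [K0 d'0 hK]]]] := dual_gradient_expansion (B a z) a0.
have C1 : 0 < 1 + C by rewrite ltr_pwDl.
have lN := ell_ge0 (col j N)^T.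
have [D hD] : differentiable (fun z => B a z 0 j) z /\
  forall v, 'D_v (fun z => B a z 0 j) z = edot (col j N)^T v.
  apply: (@differentiable_quadratic _ _ _ _ _ (ell (col j N)^T * (K *
      C ^+ 2)) (Num.min d (d' / (1 + C)))).
  - by rewrite lt_min d0 divr_gt0.
  - by rewrite !mulr_ge0 ?sqr_ge0.
  move=> h; rewrite le_min => /andP[hd hd'].
  have := hC 0 h; rewrite addr0 normr0 add0r => /(_ a0 hd).
  set be := B a (z + h) - B a z => hbe.
  have l0 := ell_ge0 h; have be0 := ell_ge0 be.
  have hn : hnorm 0 be <= d'.
    rewrite /hnorm normr0 add0r; apply: le_trans hbe _.
    by move: hd'; rewrite ler_pdivlMr// mulrC; apply: le_trans; rewrite ler_wpM2r// lerDr.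
  have bE : B a (z + h) = B a z + be by rewrite /be (addrC (B a z)) subrK.
  have H := hK 0 be hn; rewrite addr0 -bE !GB// scale0r add0r [z + h]addrC addrK in H.
  rewrite /hnorm normr0 add0r in H; set rem := h - be *m A a (B a z) in H.
  have -> : B a (z + h) 0 j - B a z 0 j - edot (col j N)^T h = - edot (col j N)^T rem.
    rewrite !NE /rem mulmxBl mulmxK// bE !mxE; ring.
  rewrite normrN; apply: le_trans (normr_edot_le _ _) _.
  rewrite -mulrA ler_wpM2l//; apply: le_trans H _.
  by rewrite -mulrA -exprMn ler_wpM2l// lerXn2r ?nnegrE ?mulr_ge0.
by split => // v; rewrite hD NE.
Qed.

Lemma is_derive_dual_value a z : 0 < a -> let b := B a z in
  is_derive a 1 (fun a => V z a (B a z))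
    (- (edot b z / (2 * a ^+ 2)) + edot b b / (4 * a ^+ 2) - E a b).
Proof.
move=> a0 b.
have [C [d [C0 d0 hC]]] := B_lipschitz z a0.
have [K [d' [K0 d'0 hK]]] := expansion2_dual_objective z b a0.
have C1 : 0 < 1 + C by rewrite ltr_pwDl.
(* The radius [a / 2] keeps [a + k] positive. *)
apply: (@is_derive_quadratic _ _ _ _ (K * (1 +
    C) ^+ 2) (Num.min (a / 2) (Num.min d (d' / (1 + C))))).
- by rewrite !lt_min d0 !divr_gt0.
- by rewrite mulr_ge0// sqr_ge0.
move=> k; rewrite !le_min => /and3P[ha hd hd'].
have ak : 0 < a + k by move: ha => /ler_normlP[]; lra.
have := hC k 0 ak; rewrite addr0 ell0 addr0 => /(_ hd); rewrite -/b.
set be := B (a + k) z - b => hbe.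
have hn1 : hnorm k be <= (1 + C) * `|k| by rewrite mulrDl mul1r lerD2l.
have hn : hnorm k be <= d' by apply: le_trans hn1 _; rewrite mulrC -ler_pdivlMr.
have bE : B (a + k) z = b + be by rewrite /be (addrC b) subrK.
have := hK k be hn; rewrite {2}/b GB// subrr scaler0 (edotC 0) edot0r addr0 bE => H.
apply: le_trans H _.
rewrite -mulrA ler_wpM2l// -[k ^+ 2]real_normK ?num_real// -exprMn.
by rewrite lerXn2r ?nnegrE ?hnorm_ge0// mulr_ge0// ltW.
Qed.

Lemma dual_value_hessian a z : 0 < a ->
  [/\ twice_differentiable (fun z => V z a (B a z)) z,
      hessian (fun z => V z a (B a z)) z \in unitmx &
      invmx (hessian (fun z => V z a (B a z)) z) = (2 * a) *: A a (B a z)].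
Proof.
move=> a0; have a20 : 2 * a != 0 by rewrite gt_eqF// mulr_gt0.
set S := fun z => V z a (B a z).
have Nu : A a (B a z) \in unitmx.
  by apply: positive_definite_unitmx => u; exact: dual_jacobian_gt0.
have DS y j : 'D_(delta_mx 0 j) S y = (2 * a)^-1 * B a y 0 j.
  by rewrite (dual_value_differentiable y a0).2 edot_delta mxE.
have dB y j : differentiable (fun z => (2 * a)^-1 * B a z 0 j) y.
  apply: (@differentiableZ _ _ R^o (fun z => B a z 0 j)).
  exact: (dual_maximiser_differentiable y j a0).1.
have HE : hessian S z = (2 * a)^-1 *: invmx (A a (B a z)).
  apply/matrixP => i j; rewrite !mxE.
  rewrite (_ : (fun y => _) = (fun y => (2 * a)^-1 *: (B a y 0 j : R^o))); last first.
    by apply/funext => y; rewrite DS.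
  have [d hd] := dual_maximiser_differentiable z j a0.
  rewrite deriveZ/=; last exact: diff_derivable.
  by rewrite hd -rowE mxE.
have HU : hessian S z \in unitmx by rewrite HE unitmxZ ?unitfE ?invr_eq0// unitmx_inv.
split.
- split; first by near=> y; exact: (dual_value_differentiable y a0).1.
  rewrite (_ : gradient S = \sum_(j < n) (fun y =>
      ((2 * a)^-1 * B a y 0 j) *: (delta_mx 0 j : 'rV[R]_n))).
    by apply: differentiable_sum => j; apply: differentiableZl.
  apply/funext => y; rewrite fct_sumE; apply/rowP => i; rewrite mxE DS summxE.
  rewrite (bigD1 i)//= !mxE !eqxx mulr1 big1 ?addr0// => j ji.
  by rewrite !mxE eq_sym (negPf ji) andbF mulr0.
- exact: HU.
- by rewrite HE invmxZ -?HE// invmxK invrK.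
Unshelve. all: by end_near. Qed.

End dual_maximisers.

(** * The heat flow and its dual in terms of the log-partition function *)

Section heat_partition.
Context {R : realType} {n : nat}.
Local Notation RB := (measurableTypeR R).
Local Notation lebn := (@lebn R).
Local Notation T := (n.-tuple RB).
Local Notation Y := (@row_of_tuple R n).

Lemma heat_kernel_weight (t : R) (x : 'rV[R]_n) (y : T) : 0 < t ->
  let a := (4 * t)^-1 in let b := (2 * a) *: x in
  heat_kernel t x (Y y) =
  expR (- (edot b b / (4 * a))) / (4 * pi * t) `^ (n%:R / 2) * weight a b y.
Proof.
move=> t0 a b; have a0 : 0 < a by rewrite invr_gt0 mulr_gt0.
rewrite /heat_kernel /weight [RHS]mulrAC -expRD; congr (expR _ / _).
rewrite /enorm sqr_sqrtr ?edotxx_ge0// /b !(edotBl, edotBr, edotZl, edotZr) (edotC _ x).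
rewrite -/a; set u := edot x _; set v := edot _ (Y y); set w := edot x x.
by rewrite /a; field; rewrite gt_eqF.
Qed.

Variable phi : 'rV[R]_n -> \bar R.
Variable f : T -> R.
Hypothesis mf : measurable_fun setT f.
Hypothesis f0 : forall y, 0 <= f y.
Hypothesis f_decay : forall A, exists C, forall y, f y <= C * expR (- (A * ell (Y y))).
Hypothesis f_mass : (0 < \int[lebn n]_y (f y)%:E)%E.
Hypothesis phi_f : forall K : T -> R, measurable_fun setT K -> (forall y, 0 < K y) ->
  (\int[lebn n]_y (expeR (- phi (Y y)) * (K y)%:E) = \int[lebn n]_y (f y * K y)%:E)%E.

Local Notation L := (log_partition f).

Lemma heat_log_partition (t : R) (x : 'rV[R]_n) : 0 < t ->
  let a := (4 * t)^-1 in let b := (2 * a) *: x in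
  heat_log phi t x = (edot b b / (4 * a) + n%:R / 2 * ln (4 * pi * t) - L a b)%:E.
Proof.
move=> t0 a b; have a0 : 0 < a by rewrite invr_gt0 mulr_gt0.
have p0 := partition_function_gt0 mf f0 f_decay f_mass b a0.
have t40 : 0 < 4 * pi * t by rewrite !mulr_gt0 ?pi_gt0.
pose c := expR (- (edot b b / (4 * a))) / (4 * pi * t) `^ (n%:R / 2).
have c0 : 0 < c by rewrite divr_gt0 ?expR_gt0 ?powR_gt0.
have aw : exp_bounded (weight a b) by apply: exp_bounded_weight; exact: ltW.
have acw : exp_bounded (fun y => c * weight a b y) by apply: exp_bounded_mul => //;
    exact: exp_bounded_cst.
have hE : heat t (fun y => expeR (- phi y)) x = (c * partition_function f a b)%:E.
  rewrite /heat /integral_Rn -/(lebn n).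
  under eq_integral do rewrite heat_kernel_weight//.
  rewrite (phi_f acw.1); last by move=> y; rewrite mulr_gt0 ?weight_gt0.
  transitivity (moment f (fun y => c * weight a b y))%:E.
    rewrite fineK; last exact: (integrable_fin_num _ (exp_bounded_int mf f0 f_decay acw)).
    by apply: eq_integral => y _; rewrite mulrC.
  rewrite (moment_scale mf f0 f_decay)//; congr (_ * _)%:E.
  by congr moment; apply/funext => y; rewrite mul1r.
rewrite /heat_log hE (lne_EFin (mulr_gt0 c0 p0)) -EFinN; congr EFin.
have pw0 : 0 < (4 * pi * t) `^ (n%:R / 2) by exact: powR_gt0.
have lc : ln c = - (edot b b / (4 * a)) - n%:R / 2 * ln (4 * pi * t).
  rewrite /c lnM ?posrE ?expR_gt0 ?invr_gt0//.
  by rewrite expRK lnV ?posrE// ln_powR.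
have -> : ln (c * partition_function f a b) = ln c + L a b.
  by rewrite lnM// posrE.
by rewrite lc; ring.
Qed.

Lemma heat_dual_eq (t : R) (z bz : 'rV[R]_n) : 0 < t -> let a := (4 * t)^-1 in
  (forall b, dual_objective L z a b <= dual_objective L z a bz) ->
  heat_dual phi t z = (dual_objective L z a bz - n%:R / 2 * ln (4 * pi * t))%:E.
Proof.
move=> t0 a hz; have a0 : 0 < a by rewrite invr_gt0 mulr_gt0.
have E x : ((edot x z)%:E - heat_log phi t x =
    (dual_objective L z a ((2 * a) *: x) - n%:R / 2 * ln (4 * pi * t))%:E)%E.
  rewrite heat_log_partition// -EFinB -/a; congr EFin.
  rewrite /dual_objective (edotZl _ x z); set k := _ * ln _; set b := _ *: x; set u := edot x z.
  by rewrite [2 * a * u]mulrC mulfK ?gt_eqF ?mulr_gt0//; ring.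
apply/eqP; rewrite eq_le; apply/andP; split.
  apply/ereal_supP => _ [x _ <-]; rewrite E lee_fin lerB//.
(* The supremum is attained at the point [x] whose parameter [b] is [bz]. *)
apply: ereal_sup_ubound; exists ((2 * a)^-1 *: bz); first exact: Logic.I.
rewrite E scalerA divff ?scale1r//.
by rewrite gt_eqF// mulr_gt0.
Qed.

End heat_partition.

(** * Back to the time variable, and the evolution equation *)

Lemma hessian_sub_cst (R : realType) n (g : 'rV[R]_n -> R) (k : R) x :
  twice_differentiable g x -> (forall y, differentiable g y) ->
  twice_differentiable (fun y => g y - k) x /\ hessian (fun y => g y - k) x = hessian g x.
Proof.
move=> [_ dg] dy.
have E y v : 'D_v (fun y => g y - k) y = 'D_v g y.
  rewrite (_ : (fun y => g y - k) = g - cst k)//.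
  by rewrite deriveB ?derive_cst ?subr0//; exact: diff_derivable.
split; last first.
  apply/matrixP => i j; rewrite [LHS]mxE [RHS]mxE.
  have -> : (fun y => 'D_(delta_mx 0 j) (fun y => g y - k) y) = (fun y =>
      'D_(delta_mx 0 j) g y).
    by apply/funext => y; exact: E.
  by [].
split; first by near=> y; apply: differentiableB.
rewrite (_ : gradient _ = gradient g)//.
by apply/funext => y; apply/rowP => i; rewrite !mxE E.
Unshelve. all: by end_near. Qed.

Lemma is_derive_inverse_time (R : realType) (g : R -> R) (c k t : R) : 0 < t ->
  is_derive (4 * t)^-1 1 g c ->
  is_derive t 1 (fun s => g (4 * s)^-1 - k * ln (4 * pi * s))
    (- (4 * (4 * t)^-1 ^+ 2) * c - k / t).
Proof.
move=> t0 dg.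
have t40 : 4 * t != 0 by rewrite mulf_neq0// gt_eqF.
have dM (u : R) : is_derive t 1 (fun s : R => u * s) u.
  by have := is_deriveZ u (is_derive_id t 1); rewrite /GRing.scale/= mulr1.
have dinv : is_derive t 1 (fun s : R => (4 * s)^-1) (- (4 * t) ^- 2 * 4).
  exact: (is_deriveV t40 (dM 4)).
have pt0 : 0 < 4 * pi * t by rewrite !mulr_gt0 ?pi_gt0.
have dln : is_derive t 1 (fun s => ln (4 * pi * s)) ((4 * pi * t)^-1 * (4 * pi)).
  exact: (is_derive1_comp (is_derive1_ln pt0) (dM (4 * pi))).
have dgi := @is_derive1_comp R g (fun s => (4 * s)^-1) t _ _ dg dinv.
have d := is_deriveB dgi (is_deriveZ k dln); apply: is_derive_eq d _; rewrite /GRing.scale/=.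
by move: pi (@pi_gt0 R) => p p0; field; rewrite !gt_eqF.
Qed.

(** [- 4 * a ^+ 2] is the derivative of [a = 1 / (4 * t)]. The terms in [e] match through the trace
    of [C], and the normalisation of the heat kernel supplies [n / (2 * t)], which is the trace of
    [2 * a] times the identity. *)
Lemma trace_time_derivative (R : realType) n (t e : R) (b m : 'rV[R]_n) (C : 'M[R]_n) :
  0 < t -> \tr C = e - edot m m ->
  let a := (4 * t)^-1 in let z := b - (2 * a) *: m in
  - (4 * a ^+ 2) * (- (edot b z / (2 * a ^+ 2)) + edot b b / (4 * a ^+ 2) - e) - n%:R / 2 / t =
  enorm z ^+ 2 - \tr ((2 * a) *: (1%:M - (2 * a) *: C)^T).
Proof.
move=> t0 trC a z; rewrite /enorm sqr_sqrtr ?edotxx_ge0//.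
have -> : \tr ((2 * a) *: (1%:M - (2 * a) *: C)^T) = 2 * a * (n%:R - 2 * a * \tr C).
  by rewrite mxtraceZ mxtrace_tr mxtraceD mxtrace1 -scaleNr mxtraceZ mulNr.
rewrite trC /z.
rewrite !(edotBl, edotBr, edotZl, edotZr) (edotC m b).
set bb := edot b b; set bm := edot b m; set mm := edot m m.
by rewrite /a; field; rewrite gt_eqF.
Qed.

Theorem proposition2 (R : realType) (n : nat) (phi : 'rV[R]_n -> \bar R)
    (phi_gtNy : forall x, (-oo < phi x)%E)
    (phi_convex : econvex phi)
    (phi_superlinear : superlinear phi)
    (phi_mass : (0 < integral_Rn (fun x => expeR (- phi x)))%E)
    (z : 'rV[R]_n) (t : R) (t_gt0 : 0 < t) :
  let psi (s : R) (w : 'rV[R]_n) : R := fine (heat_dual phi s w) in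
  [/\ heat_dual phi t z \is a fin_num,
      twice_differentiable (psi t) z,
      hessian (psi t) z \in unitmx &
      is_derive t 1 (fun s : R => psi s z)
        (enorm z ^+ 2 - \tr (invmx (hessian (psi t) z)))].
Proof.
have [f [mf f0 f_decay phi_f f_lc]] :=
  log_concave_density phi_gtNy phi_convex phi_superlinear phi_mass.
have f_mass : (0 < \int[@lebn R n]_y (f y)%:E)%E.
  rewrite (eq_integral (fun y => (f y * 1)%:E)); last by move=> y _; rewrite mulr1.
  rewrite -(@phi_f (fun=> 1))//; apply: lt_le_trans phi_mass _.
  rewrite le_eqVlt; apply/orP; left; apply/eqP; apply: eq_integral => y _.
  by rewrite mule1.
pose L := log_partition f; pose E := energy f.
have hL : forall a b, 0 < a -> expansion2 L a b (- E a b) (mean f a b).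
  by move=> a b; exact: expansion2_log_partition.
have hm : forall a b i, 0 < a ->
    exists c, expansion2 (fun a b => mean f a b 0 i) a b c (row i (cov f a b)).
  by move=> a b i; exact: expansion2_mean.
have hc : forall a b u, 0 < a -> u != 0 ->
    0 < edot u u - 2 * a * edot u (u *m cov f a b).
  by move=> a b u; exact: cov_lt.
have hco : forall a la, 0 < a -> 0 <= la ->
    exists K, forall b, L a b - edot b b / (4 * a) <= K - la * ell b.
  by move=> a la; exact: log_partition_coercive.
have [B hB] := dual_maximisers_exist hL hco.
pose S a w := dual_objective L w a (B a w).
pose k (s : R) := n%:R / 2 * ln (4 * pi * s).
have inv0 (s : R) : 0 < s -> 0 < (4 * s)^-1 by move=> s0; rewrite invr_gt0 mulr_gt0.
have dualE s w : 0 < s -> heat_dual phi s w = (S (4 * s)^-1 w - k s)%:E.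
  move=> s0; apply: (heat_dual_eq mf f0 f_decay f_mass phi_f s0).
  by apply: hB; exact: inv0.
move=> psi; set a := (4 * t)^-1; have a0 : 0 < a := inv0 t t_gt0.
have psiE : psi t = fun w => S a w - k t by apply/funext => w; rewrite /psi dualE.
have [S2 HU HI] := dual_value_hessian hL hm hc hB z a0.
have dS y : differentiable (S a) y by exact: (dual_value_differentiable hL hm hc hB y a0).1.
have [P2 HP] := hessian_sub_cst (k t) S2 dS.
split.
- by rewrite dualE.
- by rewrite psiE.
- by rewrite psiE HP.
rewrite psiE HP HI.
have dSa := is_derive_dual_value hL hm hc hB z a0.
have d := is_derive_inverse_time (n%:R / 2) t_gt0 dSa.
apply: near_eq_is_derive; last first.
  apply: is_derive_eq d _.
  have trC := tr_cov mf f0 f_decay (B a z) (ltW a0).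
  have := trace_time_derivative (B a z) t_gt0 trC.
  by have := dual_max_gradient hL a0 (hB a z a0); rewrite /dual_gradient => -> ->.
(* The formula for the dual is available only at positive times, hence near [t]. *)
near=> s; rewrite /psi dualE; first by [].
by near: s; exact: lt_nbhsr.
Unshelve. all: by end_near. Qed.
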